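(* Let $V(x,y)=q(x,y)=\sum_{j\ne0}q_j(x)e^{2\pi i\lambda_jy}$ satisfy Hypotheses (V) with $q_{\rm av}\equiv0$, let $q_\epsilon(x)=q(x,x/\epsilon)$, and let $K\subset\mathbb{C}$ satisfy Hypotheses (K). Let $\Lambda_{\rm eff}(x)=\frac1{4\pi^2}\sum_{j\ne0}\frac{|q_j(x)|^2}{\lambda_j^2}$ and $\sigma^\epsilon_{\rm eff}=-\epsilon^2\Lambda_{\rm eff}$. Let $C>0$ and $\tau<3$. There exists $\epsilon_0>0$ such that the following hold, with implied constants independent of $\epsilon$ and $k$. (a) For all $0<\epsilon<\epsilon_0$ and $k\in K$ with $$\Big|k-\tfrac{i\epsilon^2}{2}\int_{-\infty}^\infty\Lambda_{\rm eff}\Big|\ge C\epsilon^\tau,$$ one has $$\left|\frac{t^{\sigma^\epsilon_{\rm eff}}(k)}{t^{q_\epsilon}(k)}-1\right|=\mathcal{O}(\epsilon^{3-\tau}).$$ (b) If in addition $\big|k-\frac{i\epsilon^2}{2}\int_{-\infty}^\infty\Lambda_{\rm eff}\big|\ge C|k|$, then $$\left|t^{\sigma^\epsilon_{\rm eff}}(k)-t^{q_\epsilon}(k)\right|=\mathcal{O}(\epsilon^{3-\tau})\quad\text{and}\quad\left|t^{q_\epsilon}(k)-\frac{k}{k-\frac{i\epsilon^2}{2}\int_{-\infty}^\infty\Lambda_{\rm eff}}\right|=\mathcal{O}(\epsilon^{3-\tau}).$$ (c) In particular, if $k=\epsilon^2\kappa$ with $\kappa\in\mathbb{C}$ fixed,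 $\kappa\ne\kappa^\star:=-\frac{1}{2i}\int\Lambda_{\rm eff}=\frac i2\int\Lambda_{\rm eff}$, then for $\epsilon>0$ sufficiently small $$\left|t^{\sigma^\epsilon_{\rm eff}}(\epsilon^2\kappa)-t^{q_\epsilon}(\epsilon^2\kappa)\right|=\mathcal{O}\left(\frac{\epsilon|\kappa|}{|\kappa-\kappa^\star|^2}\right)=\mathcal{O}(\epsilon),\qquad\left|t^{q_\epsilon}(\epsilon^2\kappa)-\frac{\kappa}{\kappa-\frac i2\int_{-\infty}^\infty\Lambda_{\rm eff}}\right|=\mathcal{O}(\epsilon).$$
   Context: Function spaces: for $\beta>0$, $L^\infty_\beta$ is the space of measurable $g:\mathbb{R}\to\mathbb{C}$ with $|g|_{L^\infty_\beta}=\operatorname{ess\,sup}_x e^{\beta|x|}|g(x)|<\infty$, and $|g|_{W^{n,\infty}_\beta}=\sum_{l=0}^n|\partial_x^l g|_{L^\infty_\beta}$. Hypotheses (V) (with $q_{\rm av}\equiv 0$): $V(x,y)=\sum_{j\in\mathbb{Z}\setminus\{0\}}q_j(x)e^{2\pi i\lambda_jy}$ is real-valued, $\overline{q_j}=q_{-j}$, $\lambda_{-j}=-\lambda_j$; there are $\theta,\beta>0$ with $\inf_{j\ne k}|\lambda_j-\lambda_k|\ge\theta$ and $\inf_{j\neq 0}|\lambda_j|\ge\theta$ ($\lambda_j$ real); and $\sum_{j\ne0}|q_j|_{W^{3,\infty}_\beta}<\infty$. Hypotheses (K) (with $q_{\rm av}\equiv 0$, for which $t^{0}\equiv1$ has no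 poles): $K$ is a compact subset of $\{k\in\mathbb{C}:|\Im k|<\alpha\}$ with $0<\alpha<\beta/2$. Jost solutions and transmission coefficient: for real-valued $U\in L^\infty_\beta$ and $|\Im k|<\beta/2$, $f^U_\pm(x;k)$ are the unique solutions of $f^U_+(x;k)=e^{ikx}+\int_x^\infty\frac{\sin(k(y-x))}{k}U(y)f^U_+(y;k)\,dy$, $f^U_-(x;k)=e^{-ikx}-\int_{-\infty}^x\frac{\sin(k(y-x))}{k}U(y)f^U_-(y;k)\,dy$ (with $\sin(kz)/k=z$ at $k=0$). With $\mathcal{W}[h_1,h_2]=h_1h_2'-h_2h_1'$, $t^U$ is defined by $\mathcal{W}[f^U_+,f^U_-](k)=-2ik/t^U(k)$; it is meromorphic, removable singularities being filled by continuity. Ratios $t^{U_1}/t^{U_2}$ are understood as $\mathcal{W}[f^{U_2}_+,f^{U_2}_-]/\mathcal{W}[f^{U_1}_+,f^{U_1}_-]$. *)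

(* Defs.v *)
From HB Require Import structures.
From mathcomp Require Import all_boot all_order all_algebra.
From mathcomp Require Import complex.
From mathcomp Require Import all_classical all_reals all_analysis.
From mathcomp Require Import ess_sup_inf.

Set Implicit Arguments.
Unset Strict Implicit.
Unset Printing Implicit Defensive.

Import Order.TTheory GRing.Theory Num.Theory.
Import numFieldNormedType.Exports.

Local Open Scope classical_set_scope.
Local Open Scope ring_scope.
Local Open Scope complex_scope.

Section ComplexAnalysis.
Context {R : realType}.
Implicit Types (f : R -> R[i]) (z k : R[i]) (x : R).

(* The modulus with values in [R]; [`|z|] itself lives in [R[i]]. *)
Definition cabs z : R := ComplexField.Normc.normc z.

Definition cexp z : R[i] :=
  (expR (complex.Re z))%:C *
  (cos (complex.Im z) +i* sin (complex.Im z)).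

Definition csin z : R[i] := (cexp ('i * z) - cexp (- ('i * z))) / (2 * 'i).

Definition sin_div k x : R[i] := if k == 0 then x%:C else csin (k * x%:C) / k.

Definition cmeasurable f : Prop :=
  measurable_fun setT (fun x => complex.Re (f x)) /\
  measurable_fun setT (fun x => complex.Im (f x)).

Definition cintegrable (D : set R) f : Prop :=
  (@lebesgue_measure R).-integrable D (fun x => (complex.Re (f x))%:E) /\
  (@lebesgue_measure R).-integrable D (fun x => (complex.Im (f x))%:E).

Definition cintegral (D : set R) f : R[i] :=
  Rintegral (@lebesgue_measure R) D (fun x => complex.Re (f x)) +i*
  Rintegral (@lebesgue_measure R) D (fun x => complex.Im (f x)).

Definition cderive f x : R[i] :=
  derive1 (fun y => complex.Re (f y)) x +i*
  derive1 (fun y => complex.Im (f y)) x.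

(* Sum over all nonzero integers.  It is only used for absolutely summable
   families, for which the symmetric order of summation is immaterial. *)
Definition sum_nz (a : int -> R) : R :=
  limn (fun N : nat => \sum_(1 <= n < N) (a n%:Z + a (- n%:Z))).

Definition csum_nz (a : int -> R[i]) : R[i] :=
  sum_nz (fun j => complex.Re (a j)) +i* sum_nz (fun j => complex.Im (a j)).

End ComplexAnalysis.

Section WeightedSpaces.
Context {R : realType}.

(* |g|_{L^oo_beta}, possibly +oo *)
Definition Linfty_norm (beta : R) (g : R -> R[i]) : \bar R :=
  ess_sup (@lebesgue_measure R) (fun x => (expR (beta * `|x|) * cabs (g x))%:E).

Definition test_function (phi : R -> R) : Prop :=
  (forall (n : nat) (x : R), derivable (derive1n n phi) x 1) /\
  exists M : R, forall x, M < `|x| -> phi x = 0.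

(* [h] is the distributional derivative of [g] *)
Definition weak_derivative (g h : R -> R[i]) : Prop :=
  forall phi, test_function phi ->
    cintegral setT (fun x => g x * (derive1 phi x)%:C) =
    - cintegral setT (fun x => h x * (phi x)%:C).

(* |g|_{W^{n,oo}_beta}, where [d l] is the weak derivative of order [l] of [g].
   Weak derivatives are unique up to null sets, so that the infimum is over at
   most one finite value; it is +oo when [g] is not in W^{n,oo}_beta. *)
Definition sobolev_norm (n : nat) (beta : R) (g : R -> R[i]) : \bar R :=
  ereal_inf [set s | exists d : nat -> R -> R[i],
    [/\ d 0%N = g,
        forall l, (l <= n)%N -> cmeasurable (d l),
        forall l, (l < n)%N -> weak_derivative (d l) (d l.+1) &
        s = (\sum_(l < n.+1) Linfty_norm beta (d l))%E]].

End WeightedSpaces.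

Section Scattering.
Context {R : realType}.
Implicit Types (U : R -> R) (k : R[i]) (f : R -> R[i]).

(* The Volterra equations of the Jost solutions.  Integrability of the
   integrands is what gives the integrals a meaning, and it makes the solution
   unique when |Im k| < beta / 2 and U is in L^oo_beta. *)
Definition is_jost_plus U k f : Prop := forall x : R,
  let F := fun y => sin_div k (y - x) * (U y)%:C * f y in
  cintegrable `]x, +oo[ F /\
  f x = cexp ('i * k * x%:C) + cintegral `]x, +oo[ F.

Definition is_jost_minus U k f : Prop := forall x : R,
  let F := fun y => sin_div k (y - x) * (U y)%:C * f y in
  cintegrable `]-oo, x[ F /\
  f x = cexp (- ('i * k * x%:C)) - cintegral `]-oo, x[ F.

Definition jost_plus U k : R -> R[i] :=
  xget (fun=> 0) [set f | is_jost_plus U k f].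

Definition jost_minus U k : R -> R[i] :=
  xget (fun=> 0) [set f | is_jost_minus U k f].

Definition wronskian (h1 h2 : R -> R[i]) (x : R) : R[i] :=
  h1 x * cderive h2 x - h2 x * cderive h1 x.

(* The Wronskian of two solutions with the same [k] does not depend on the
   point; we evaluate it at 0. *)
Definition jost_wronskian U k : R[i] :=
  wronskian (jost_plus U k) (jost_minus U k) 0.

(* W = - 2 i k / t.  Where the Wronskian vanishes, t is extended by its limit;
   this fills the removable singularities, and the value at a genuine pole is
   meaningless. *)
Definition transmission U k : R[i] :=
  if jost_wronskian U k != 0 then - (2 * 'i * k) / jost_wronskian U k
  else lim ((fun l : R[i]^o => - (2 * 'i * l) / jost_wronskian U l : R[i]^o)
            @ (k : R[i]^o)^').

(* t^{U1} / t^{U2} *)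
Definition transmission_ratio (U1 U2 : R -> R) k : R[i] :=
  jost_wronskian U2 k / jost_wronskian U1 k.

End Scattering.

Section OscillatoryPotentials.
Context {R : realType}.
Implicit Types (q : int -> R -> R[i]) (lam : int -> R).

(* The two-scale potential; q_0 and lambda_0 play no role. *)
Definition potential q lam (x y : R) : R[i] :=
  csum_nz (fun j => q j x * cexp ((2 * pi * lam j * y)%:C * 'i)).

Record hypotheses_V (beta theta : R) q lam : Prop := HypothesesV {
  V_beta_gt0 : 0 < beta;
  V_theta_gt0 : 0 < theta;
  V_real : forall x y, complex.Im (potential q lam x y) = 0;
  V_conj : forall (j : int) (x : R), j != 0 -> (q j x)^* = q (- j) x;
  V_opp : forall j : int, j != 0 -> lam (- j) = - lam j;
  V_separated : forall j k : int, j != 0 -> k != 0 -> j != k ->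
    theta <= `|lam j - lam k|;
  V_away0 : forall j : int, j != 0 -> theta <= `|lam j|;
  V_summable :
    (\esum_(j in [set j : int | (j != 0)%R]) sobolev_norm 3 beta (q j) < +oo)%E
}.

(* For q_av = 0 the condition on the poles of t^{q_av} = 1 is void. *)
Record hypotheses_K (beta alpha : R) (K : set R[i]) : Prop := HypothesesK {
  K_alpha_gt0 : 0 < alpha;
  K_alpha_lt : alpha < beta / 2;
  K_compact : compact (K : set R[i]^o);
  K_strip : forall k, K k -> `|complex.Im k| < alpha
}.

(* q(x, x / eps), a real number by [V_real] *)
Definition q_eps q lam (eps : R) (x : R) : R :=
  complex.Re (potential q lam x (x / eps)).

Definition Lambda_eff q lam (x : R) : R :=
  (4 * pi ^+ 2)^-1 * sum_nz (fun j => cabs (q j x) ^+ 2 / lam j ^+ 2).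

Definition sigma_eff q lam (eps : R) (x : R) : R :=
  - (eps ^+ 2 * Lambda_eff q lam x).

Definition kappa_star q lam : R[i] :=
  'i / 2 * (Rintegral (@lebesgue_measure R) setT (Lambda_eff q lam))%:C.

End OscillatoryPotentials.

(* Main.v *)
(* Cut the line at 0.  If f and g are the Jost solutions on the two half-lines
   (the left one reflected) and E_f = f'(0) + i k f(0), then
     - W = f(0) E_g + g(0) E_f - 2 i k f(0) g(0).
   Write T1, T2, T3 for the iterated tail integrals of the potential V.
   Integrating by parts against them gives f(0) = 1 + O(eps^2) and
     E_f = 2 i k - T1(0) f(0) + int T1^2 + O(eps^3)
   as soon as Tn = O(eps^n).  For V = q_eps these bounds hold mode by mode: the
   derivatives of q_j up to order 2 are classical by the du Bois-Reymond lemma,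
   and the second one is Lipschitz, which suffices for one more power of eps.
   In T1^2 only the pairs of modes (j, -j) do not oscillate, so that
   int T1^2 = eps^2 int Lambda_eff + O(eps^3); the leading part of T1(0) is odd
   under reflection, so that the two half-lines cancel up to O(eps^3).  Hence
     W = - 2 i (k - eps^2 kappa_star) + O(eps^3)
   for q_eps, and for sigma_eff as well, where E_f = 2 i k - int V + O(eps^4).
   The three claims are algebraic consequences. *)
Require Import Defs.
From HB Require Import structures.
From mathcomp Require Import all_boot all_order all_algebra.
From mathcomp Require Import complex ring lra.
From mathcomp Require Import all_classical all_reals all_analysis.
From mathcomp Require Import measurable_realfun ess_sup_inf.

Set Implicit Arguments.
Unset Strict Implicit.
Unset Printing Implicit Defensive.

Import Order.TTheory GRing.Theory Num.Theory.
Import numFieldNormedType.Exports.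

Local Open Scope classical_set_scope.
Local Open Scope ring_scope.
Local Open Scope complex_scope.

#[local] Arguments cabs {R} z : simpl never.
#[local] Arguments cexp {R} z : simpl never.

(** * Modulus and derivatives of complex functions *)

Section ComplexModulus.
Context {R : realType}.
Implicit Types (z w : R[i]) (x y : R).

(** Two obstacles shape the proof. The Jost solutions are picked by [xget] among all functions for
    which the Volterra integrals exist, so uniqueness must be proved without any a priori growth
    bound. And each q_j is known only through weak derivatives; it is replaced by a continuous
    representative, which changes no integral and hence no Jost solution. Cutting at 0 keeps each
    solution on the side where it grows at most like exp(al |x|); on the other side the available
    weight grows doubly exponentially. Two factors of rate al against a potential of rate be leave
    the rate be - 2 al, which enters the constants of the half-line estimates. The size of eps
    reaches the half-line analysis only through the bounds on Tn, so that part never sees the modes,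
    and the mode estimates never see k. For each eps the series is truncated with an error of order
    eps^3; the number of modes is not controlled, but the constants depend only on the sum of their
    bounds. The Wronskian estimate assumes no lower bound on k: at k = 0 the pair [ccos], [sin_div]
    replaces the two exponentials. *)

Lemma ReD z w : complex.Re (z + w) = complex.Re z + complex.Re w.
Proof. by case: z; case: w. Qed.

Lemma ImD z w : complex.Im (z + w) = complex.Im z + complex.Im w.
Proof. by case: z; case: w. Qed.

Lemma ReN z : complex.Re (- z) = - complex.Re z.
Proof. by case: z. Qed.

Lemma ImN z : complex.Im (- z) = - complex.Im z.
Proof. by case: z. Qed.

Lemma ReB z w : complex.Re (z - w) = complex.Re z - complex.Re w.
Proof. by rewrite ReD ReN. Qed.

Lemma ImB z w : complex.Im (z - w) = complex.Im z - complex.Im w.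
Proof. by rewrite ImD ImN. Qed.

Lemma ReM z w :
  complex.Re (z * w) = complex.Re z * complex.Re w - complex.Im z * complex.Im w.
Proof. by case: z; case: w. Qed.

Lemma ImM z w :
  complex.Im (z * w) = complex.Re z * complex.Im w + complex.Im z * complex.Re w.
Proof. by case: z; case: w => a b c d /=; rewrite addrC. Qed.

Definition ReImE := (ReD, ImD, ReN, ImN, ReM, ImM).

Lemma complex_ext z w :
  complex.Re z = complex.Re w -> complex.Im z = complex.Im w -> z = w.
Proof. by case: z; case: w => /= ? ? ? ? -> ->. Qed.

Lemma cabsE z : cabs z = Num.sqrt (complex.Re z ^+ 2 + complex.Im z ^+ 2).
Proof. by case: z. Qed.

Lemma cabs_ge0 z : 0 <= cabs z.
Proof. by rewrite cabsE sqrtr_ge0. Qed.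

Lemma cabs_sqr z : cabs z ^+ 2 = complex.Re z ^+ 2 + complex.Im z ^+ 2.
Proof. by rewrite cabsE sqr_sqrtr// addr_ge0 ?sqr_ge0. Qed.

Lemma cabsM z w : cabs (z * w) = cabs z * cabs w.
Proof. exact: ComplexField.Normc.normcM. Qed.

Lemma cabsV z : cabs z^-1 = (cabs z)^-1.
Proof. exact: ComplexField.Normc.normcV. Qed.

Lemma cabsD z w : cabs (z + w) <= cabs z + cabs w.
Proof. exact: le_normcD. Qed.

Lemma cabsN z : cabs (- z) = cabs z.
Proof. exact: normcN. Qed.

Lemma cabsB z w : cabs (z - w) <= cabs z + cabs w.
Proof. by rewrite -(cabsN w) cabsD. Qed.

Lemma cabsBC z w : cabs (z - w) = cabs (w - z).
Proof. by rewrite -cabsN opprB. Qed.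

Lemma cabs0 : cabs (0 : R[i]) = 0.
Proof. exact: ComplexField.Normc.normc0. Qed.

Lemma cabs1 : cabs (1 : R[i]) = 1.
Proof. exact: ComplexField.Normc.normc1. Qed.

Lemma cabs_eq0 z : (cabs z == 0) = (z == 0).
Proof.
apply/eqP/eqP => [|->]; last exact: cabs0.
exact: ComplexField.Normc.eq0_normc.
Qed.

Lemma cabs_gt0 z : (0 < cabs z) = (z != 0).
Proof. by rewrite lt_def cabs_ge0 andbT cabs_eq0. Qed.

Lemma cabs_real x : cabs x%:C = `|x|.
Proof. by rewrite cabsE /= expr0n /= addr0 sqrtr_sqr. Qed.

Lemma cabs_i : cabs ('i : R[i]) = 1.
Proof. by rewrite cabsE /= expr0n /= add0r expr1n sqrtr1. Qed.

Lemma cabsX z n : cabs (z ^+ n) = cabs z ^+ n.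
Proof. by elim: n => [|n IH]; rewrite ?expr0 ?cabs1// !exprS cabsM IH. Qed.

Lemma cabs_nat n : cabs (n%:R : R[i]) = n%:R.
Proof. by rewrite -[n%:R in LHS](rmorph_nat (real_complex R)) cabs_real normr_nat. Qed.

Lemma cabs_conj z : cabs (conjc z) = cabs z.
Proof. by rewrite !cabsE; case: z => a b /=; rewrite sqrrN. Qed.

Lemma conjM z w : conjc (z * w) = conjc z * conjc w.
Proof. by case: z; case: w => a b c d; apply: complex_ext => /=; ring. Qed.

Lemma cabs_Re z : `|complex.Re z| <= cabs z.
Proof. by rewrite cabsE -sqrtr_sqr ler_wsqrtr// lerDl sqr_ge0. Qed.

Lemma cabs_Im z : `|complex.Im z| <= cabs z.
Proof. by rewrite cabsE -sqrtr_sqr ler_wsqrtr// lerDr sqr_ge0. Qed.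

Lemma cabs_le_ReIm z : cabs z <= `|complex.Re z| + `|complex.Im z|.
Proof.
rewrite -(ger0_norm (cabs_ge0 z)) -ler_sqr ?nnegrE ?addr_ge0//.
rewrite ger0_norm ?cabs_ge0// cabs_sqr sqrrD -[X in X + _ <= _]real_normK ?num_real//.
rewrite -[X in _ + X <= _]real_normK ?num_real// lerD2r lerDl.
by rewrite mulrn_wge0 ?mulr_ge0.
Qed.

Lemma cabs_sum (I : Type) (s : seq I) (P : pred I) (F : I -> R[i]) :
  cabs (\sum_(j <- s | P j) F j) <= \sum_(j <- s | P j) cabs (F j).
Proof.
elim/big_ind2: _ => //; first by rewrite cabs0.
by move=> z a w b za wb; rewrite (le_trans (cabsD _ _)) ?lerD.
Qed.

(** Pairing with a fixed direction turns a complex inequality into a real one; the equality case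
    [Re_mul_conj_self] recovers the modulus afterwards. *)
Lemma Re_mul_conj_le z w : complex.Re (conjc z * w) <= cabs z * cabs w.
Proof. by rewrite -(cabs_conj z) -cabsM (le_trans _ (cabs_Re _)) ?ler_norm. Qed.

Lemma Re_mul_conj_self z : complex.Re (conjc z * z) = cabs z ^+ 2.
Proof. by rewrite cabs_sqr; case: z => a b; rewrite !ReImE /=; ring. Qed.

End ComplexModulus.

(** * Componentwise derivatives and continuity, and the mean value inequality *)

Section ComplexDerivative.
Context {R : realType}.
Implicit Types (f g : R -> R[i]) (x y : R) (a b : R[i]).

(** Componentwise, as [cderive] is. The relational form carries differentiability and the value
    together, so that derivatives compose without side conditions. *)
Definition cder f x a : Prop :=
  is_derive x (1 : R) (fun y => complex.Re (f y)) (complex.Re a) /\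
  is_derive x (1 : R) (fun y => complex.Im (f y)) (complex.Im a).

Definition ccont f : Prop :=
  continuous (fun x => complex.Re (f x)) /\
  continuous (fun x => complex.Im (f x)).

Lemma cder_cderive f x a : cder f x a -> cderive f x = a.
Proof.
move=> [h1 h2]; rewrite /cderive !derive1E.
by apply: complex_ext => /=; apply: derive_val.
Qed.

Lemma cder_eq f x a b : cder f x a -> a = b -> cder f x b.
Proof. by move=> h <-. Qed.

Lemma cder_ext f g x a : f =1 g -> cder f x a -> cder g x a.
Proof. by move=> /funext ->. Qed.

Lemma cderD f g x a b : cder f x a -> cder g x b ->
  cder (fun y => f y + g y) x (a + b).
Proof.
move=> [f1 f2] [g1 g2]; split; rewrite ?ReD ?ImD.
- rewrite [X in is_derive _ _ X _](_ : _ =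
    (fun y => complex.Re (f y)) + (fun y => complex.Re (g y))); first exact: is_deriveD.
  by apply/funext => y; rewrite ReD.
- rewrite [X in is_derive _ _ X _](_ : _ =
    (fun y => complex.Im (f y)) + (fun y => complex.Im (g y))); first exact: is_deriveD.
  by apply/funext => y; rewrite ImD.
Qed.

Lemma cderN f x a : cder f x a -> cder (fun y => - f y) x (- a).
Proof.
move=> [f1 f2]; split; rewrite ?ReN ?ImN.
- rewrite [X in is_derive _ _ X _](_ : _ =
    - (fun y => complex.Re (f y))); first exact: is_deriveN.
  by apply/funext => y; rewrite ReN.
- rewrite [X in is_derive _ _ X _](_ : _ =
    - (fun y => complex.Im (f y))); first exact: is_deriveN.
  by apply/funext => y; rewrite ImN.
Qed.

Lemma cderB f g x a b : cder f x a -> cder g x b ->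
  cder (fun y => f y - g y) x (a - b).
Proof. by move=> ? ?; apply: cderD => //; apply: cderN. Qed.

Lemma cderM f g x a b : cder f x a -> cder g x b ->
  cder (fun y => f y * g y) x (a * g x + f x * b).
Proof.
move=> [f1 f2] [g1 g2]; split; rewrite !ReImE.
- rewrite [X in is_derive _ _ X _](_ : _ =
    (fun y => complex.Re (f y)) * (fun y => complex.Re (g y)) -
    (fun y => complex.Im (f y)) * (fun y => complex.Im (g y))); last first.
    by apply/funext => y; rewrite ReM.
  apply: (is_derive_eq (is_deriveB (is_deriveM f1 g1) (is_deriveM f2 g2))); rewrite /GRing.scale /=.
  move: (complex.Re (f x)) (complex.Im (f x)) (complex.Re (g x))
    (complex.Im (g x)) (complex.Re a) (complex.Im a) (complex.Re b)
    (complex.Im b) => *; ring.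
- rewrite [X in is_derive _ _ X _](_ : _ =
    (fun y => complex.Re (f y)) * (fun y => complex.Im (g y)) +
    (fun y => complex.Im (f y)) * (fun y => complex.Re (g y))); last first.
    by apply/funext => y; rewrite ImM.
  apply: (is_derive_eq (is_deriveD (is_deriveM f1 g2) (is_deriveM f2 g1))); rewrite /GRing.scale /=.
  move: (complex.Re (f x)) (complex.Im (f x)) (complex.Re (g x))
    (complex.Im (g x)) (complex.Re a) (complex.Im a) (complex.Re b)
    (complex.Im b) => *; ring.
Qed.

Lemma cder_cst a x : cder (fun=> a) x 0.
Proof. by split => /=; apply: is_derive_cst. Qed.

Lemma cderZ f x a b : cder f x a -> cder (fun y => b * f y) x (b * a).
Proof.
move=> h; apply: (cder_eq (cderM (cder_cst b x) h)); by rewrite mul0r add0r.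
Qed.

Lemma cderZr f x a b : cder f x a -> cder (fun y => f y * b) x (a * b).
Proof.
move=> h; apply: (cder_eq (cderM h (cder_cst b x))); by rewrite mulr0 addr0.
Qed.

Lemma cder_real (h : R -> R) x l :
  is_derive x 1 h l -> cder (fun y => (h y)%:C) x l%:C.
Proof. by move=> hl; split => //=; apply: is_derive_cst. Qed.

Lemma cder_id x : cder (fun y => y%:C) x 1.
Proof. by split => /=; [apply: is_derive_id | apply: is_derive_cst]. Qed.

Lemma is_derive_comp1 (h : R -> R) (phi : R -> R) x m l :
  is_derive x 1 phi m -> is_derive (phi x) 1 h l ->
  is_derive x 1 (fun y => h (phi y)) (m * l).
Proof.
move=> hm hl; have := @is_derive1_comp _ h phi x l m hl hm.
by rewrite /GRing.scale /= mulrC.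
Qed.

Lemma cder_comp f (phi : R -> R) x (m : R) a :
  is_derive x 1 phi m -> cder f (phi x) a ->
  cder (fun y => f (phi y)) x (m%:C * a).
Proof.
move=> hm [h1 h2]; split; rewrite !ReImE /=.
- rewrite mul0r subr0; exact: (is_derive_comp1 hm h1).
- rewrite mul0r addr0; exact: (is_derive_comp1 hm h2).
Qed.

Lemma cder_continuous f x a : cder f x a ->
  {for x, continuous (fun y => complex.Re (f y))} /\
  {for x, continuous (fun y => complex.Im (f y))}.
Proof.
move=> [h1 h2]; split; apply: differentiable_continuous;
  by apply/derivable1_diffP; apply: ex_derive.
Qed.

Lemma cder_ccont f (df : R -> R[i]) : (forall x, cder f x (df x)) -> ccont f.
Proof. by move=> h; split => x; have [] := cder_continuous (h x). Qed.

Lemma ccontD f g : ccont f -> ccont g -> ccont (fun x => f x + g x).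
Proof.
move=> [f1 f2] [g1 g2]; split => x; under eq_fun do rewrite !ReImE.
- by apply: continuousD; [apply: f1 | apply: g1].
- by apply: continuousD; [apply: f2 | apply: g2].
Qed.

Lemma ccontN f : ccont f -> ccont (fun x => - f x).
Proof.
move=> [f1 f2]; split => x; under eq_fun do rewrite !ReImE.
- by apply: continuousN; apply: f1.
- by apply: continuousN; apply: f2.
Qed.

Lemma ccontB f g : ccont f -> ccont g -> ccont (fun x => f x - g x).
Proof. by move=> ? ?; apply: ccontD => //; apply: ccontN. Qed.

Lemma ccontM f g : ccont f -> ccont g -> ccont (fun x => f x * g x).
Proof.
move=> [f1 f2] [g1 g2]; split => x; under eq_fun do rewrite !ReImE.
- by apply: cvgB; apply: continuousM;
    [apply: f1 | apply: g1 | apply: f2 | apply: g2].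
- by apply: cvgD; apply: continuousM;
    [apply: f1 | apply: g2 | apply: f2 | apply: g1].
Qed.

Lemma ccont_cst a : ccont (fun=> a).
Proof. by split => x; apply: cst_continuous. Qed.

Lemma ccont_real (h : R -> R) : continuous h -> ccont (fun x => (h x)%:C).
Proof. by move=> ch; split => //= x; apply: cst_continuous. Qed.

Lemma ccont_ext f g : f =1 g -> ccont f -> ccont g.
Proof. by move=> /funext ->. Qed.

Lemma ccont_comp f (phi : R -> R) :
  continuous phi -> ccont f -> ccont (fun x => f (phi x)).
Proof.
move=> cphi [f1 f2]; split => x.
- by apply: (@continuous_comp _ _ _ phi (fun y => complex.Re (f y)));
    [apply: cphi | apply: f1].
- by apply: (@continuous_comp _ _ _ phi (fun y => complex.Im (f y)));
    [apply: cphi | apply: f2].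
Qed.

Lemma ccont_sum (I : Type) (s : seq I) (F : I -> R -> R[i]) :
  (forall j, ccont (F j)) -> ccont (fun y => \sum_(j <- s) F j y).
Proof.
move=> h; elim: s => [|j s IH].
  apply: ccont_ext (ccont_cst 0) => y; by rewrite big_nil.
apply: ccont_ext (ccontD (h j) IH) => y; by rewrite big_cons.
Qed.

Lemma ccont_cmeasurable f : ccont f -> cmeasurable f.
Proof. by move=> [f1 f2]; split; apply: continuous_measurable_fun. Qed.

Lemma is_derive_ge0_le (h dh : R -> R) x y : x <= y ->
  (forall t, x <= t <= y -> is_derive t 1 h (dh t)) ->
  (forall t, x <= t <= y -> 0 <= dh t) -> h x <= h y.
Proof.
move=> xy hd h0; have [t||c] := @MVT_segment R h dh x y xy.
- by rewrite in_itv /= => /andP[? ?]; apply: hd; rewrite !ltW.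
- apply: derivable_within_continuous => t; rewrite in_itv /= => ht.
  by apply: ex_derive; apply: hd.
- by rewrite in_itv /= -[h x <= _]subr_ge0 => /h0 ? ->; rewrite mulr_ge0// subr_ge0.
Qed.

(* The complex mean value inequality, reduced to the real one by pairing with
   the direction of the increment. *)
Lemma cder_le f df (g dg : R -> R) x y : x <= y ->
  (forall t, x <= t <= y -> cder f t (df t)) ->
  (forall t, x <= t <= y -> is_derive t 1 g (dg t)) ->
  (forall t, x <= t <= y -> cabs (df t) <= dg t) ->
  cabs (f y - f x) <= g y - g x.
Proof.
move=> xy hf hg hle; set z := f y - f x.
have [z0|z0] := eqVneq z 0.
  rewrite z0 cabs0 subr_ge0; apply: (is_derive_ge0_le xy hg) => t ht.
  by rewrite (le_trans (cabs_ge0 _) (hle t ht)).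
pose u : R[i] := z * ((cabs z)^-1)%:C.
have uz : complex.Re (conjc u * z) = cabs z.
  have -> : conjc u * z = (cabs z)^-1%:C * (conjc z * z).
    by rewrite /u conjM conjc_real; move: (conjc z) => zb; ring.
  by rewrite ReM /= mul0r subr0 Re_mul_conj_self expr2 mulKf// cabs_eq0.
have cu : cabs u = 1.
  by rewrite /u cabsM cabs_real ger0_norm ?invr_ge0 ?cabs_ge0// mulfV// cabs_eq0.
pose h t := g t - complex.Re (conjc u * f t).
have dh t : x <= t <= y -> is_derive t 1 h (dg t - complex.Re (conjc u * df t)).
  move=> ht; have [h1 _] := cderZ (conjc u) (hf t ht).
  by have := is_deriveB (hg t ht) h1.
suff : h x <= h y.
  by rewrite /h -uz /z mulrBr ReB; lra.
apply: (is_derive_ge0_le xy dh) => t ht.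
by rewrite subr_ge0 (le_trans (Re_mul_conj_le _ _))// cu mul1r hle.
Qed.

Lemma cder0_cst f x y : (forall t, cder f t 0) -> f x = f y.
Proof.
move=> hf; wlog xy : x y / x <= y.
  by move=> W; have [/W //|/ltW/W ->] := leP x y.
apply/eqP; rewrite eq_sym -subr_eq0 -cabs_eq0 eq_le cabs_ge0 andbT.
have -> : (0 : R) = cst 0 y - cst 0 x by rewrite subr0.
apply: (@cder_le f (fun=> 0) (cst 0) (fun=> 0) x y xy) => t _.
- exact: hf.
- by rewrite cabs0.
Qed.

End ComplexDerivative.

(** * Integrals and tails *)

Section RealTail.
Context {R : realType}.
Notation mu := (@lebesgue_measure R).
Implicit Types (f g h H : R -> R) (x y : R).

Lemma ae_imp (P Q : R -> Prop) : {ae mu, forall y, P y} ->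
  (forall y, P y -> Q y) -> {ae mu, forall y, Q y}.
Proof.
move=> [N [mN N0 hN]] PQ; exists N; split => // y /= nQ.
by apply: hN => /= /PQ.
Qed.

Lemma ae_all (P : R -> Prop) : (forall y, P y) -> {ae mu, forall y, P y}.
Proof. by move=> h; exists set0; split => //= y /(_ (h y)). Qed.

Lemma ae_and (P Q : R -> Prop) : {ae mu, forall y, P y} ->
  {ae mu, forall y, Q y} -> {ae mu, forall y, P y /\ Q y}.
Proof.
move=> [N [mN N0 hN]] [M [mM M0 hM]]; exists (N `|` M); split.
- exact: measurableU.
- by rewrite measureU0.
- move=> y /= /not_andP[h|h]; [left; exact: hN|right; exact: hM].
Qed.

Lemma integrable_ext (D : set R) (f g : R -> \bar R) : measurable D ->
  (forall y, D y -> f y = g y) -> mu.-integrable D f -> mu.-integrable D g.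
Proof.
move=> mD fg; apply: (@eq_integrable _ _ _ mu D mD f g) => y /set_mem; exact: fg.
Qed.

Lemma ae_le_integrable (D : set R) f g : measurable D -> measurable_fun D f ->
  mu.-integrable D (EFin \o g) ->
  {ae mu, forall y, D y -> `|f y| <= g y} ->
  mu.-integrable D (EFin \o f).
Proof.
move=> mD mf /integrableP[mg ig] fg; apply/integrableP; split.
  exact/measurable_EFinP.
apply: le_lt_trans ig; apply: ae_ge0_le_integral => //.
- by apply: measurableT_comp => //; exact/measurable_EFinP.
- exact: measurableT_comp.
- apply: (ae_imp fg) => y /= h Dy; rewrite lee_fin.
  by rewrite (le_trans (h Dy)) ?ler_norm.
Qed.

Lemma ae_le_Rintegral (D : set R) f g : measurable D ->
  mu.-integrable D (EFin \o f) -> mu.-integrable D (EFin \o g) ->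
  {ae mu, forall y, D y -> f y <= g y} ->
  Rintegral mu D f <= Rintegral mu D g.
Proof.
move=> mD intf intg fg; rewrite -subr_ge0 -RintegralB//.
have intB : mu.-integrable D (EFin \o (fun y => g y - f y)).
  have := @integrableB _ _ _ mu D mD _ _ intg intf; exact: eq_integrable.
have mB : measurable_fun D (fun y => g y - f y).
  by apply/measurable_EFinP; exact: (measurable_int mu).
(* The difference agrees almost everywhere with its absolute value, which is nonnegative
   everywhere. *)
rewrite /Rintegral (@ae_eq_integral _ _ _ mu D (EFin \o (fun y => `|g y - f y|))) => //.
- by apply: Rintegral_ge0 => y _; rewrite normr_ge0.
- exact/measurable_EFinP.
- by apply/measurable_EFinP; apply: measurableT_comp.
- by apply: (ae_imp fg) => y h Dy /=; rewrite ger0_norm// subr_ge0 h.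
Qed.

(** For a nonnegative integrand the improper fundamental theorem also yields integrability, because
    the value it gives is finite. *)
Lemma ge0_primitive_tail f F x l : (forall y, 0 <= f y) -> continuous f ->
  (forall y, is_derive y 1 F (f y)) -> F y @[y --> +oo%R] --> l ->
  mu.-integrable `]x, +oo[ (EFin \o f) /\
  Rintegral mu `]x, +oo[ f = l - F x.
Proof.
move=> f0 cf dF Fl.
have cF : continuous F.
  move=> y; apply: differentiable_continuous; apply/derivable1_diffP.
  by apply: ex_derive; apply: dF.
have mf : measurable_fun setT f by exact: continuous_measurable_fun.
have E : (\int[mu]_(y in `]x, +oo[) (f y)%:E = (l - F x)%:E)%E.
  rewrite integral_itv_obnd_cbnd; last first.
    by apply/measurable_EFinP; exact: measurable_funS mf.
  rewrite (@ge0_continuous_FTC2y _ f F x l)//.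
  - exact: continuous_subspaceT.
  - by apply: cvg_at_right_filter; apply: cF.
  - by move=> y _; rewrite derive1E; apply: derive_val.
split; last by rewrite /Rintegral E.
apply/integrableP; split; first by apply/measurable_EFinP; exact: measurable_funS mf.
under eq_integral do rewrite /= ger0_norm//.
by rewrite E ltry.
Qed.

Lemma cvg_expRN_pinfty (c : R) : 0 < c -> expR (- (c * y)) @[y --> +oo%R] --> (0 : R).
Proof.
move=> c0.
have h1 : (c * y) @[y --> +oo%R] --> +oo%R by apply: gt0_cvgMry => //; exact: cvg_id.
have := cvg_comp _ _ h1 (@cvgr_expR R); exact.
Qed.

End RealTail.

(** * Complex integrals, tail integrals and reflection *)

Section ComplexIntegral.
Context {R : realType}.
Notation mu := (@lebesgue_measure R).
Implicit Types (D : set R) (F G : R -> R[i]) (a : R[i]) (x y : R).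

Definition cmeasurable_on D F : Prop :=
  measurable_fun D (fun x => complex.Re (F x)) /\
  measurable_fun D (fun x => complex.Im (F x)).

Lemma ccont_cmeasurable_on D F : measurable D -> ccont F -> cmeasurable_on D F.
Proof.
move=> mD /ccont_cmeasurable[h1 h2].
by split; apply: measurable_funTS.
Qed.

Lemma cintegrable_measurable D F : measurable D ->
  cintegrable D F -> cmeasurable_on D F.
Proof.
by move=> mD [h1 h2]; split; apply/measurable_EFinP; apply: (measurable_int mu).
Qed.

Lemma cintegrable_ext D F G : measurable D -> (forall y, D y -> F y = G y) ->
  cintegrable D F -> cintegrable D G.
Proof.
move=> mD FG [h1 h2]; split.
- by apply: (integrable_ext mD _ h1) => y /FG ->.
- by apply: (integrable_ext mD _ h2) => y /FG ->.
Qed.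

Lemma cintegral_ext D F G : (forall y, D y -> F y = G y) ->
  cintegral D F = cintegral D G.
Proof.
by move=> FG; rewrite /cintegral; apply: complex_ext => /=;
  apply: eq_Rintegral => y /set_mem /FG ->.
Qed.

Lemma cintegrableS D E F : measurable D -> measurable E -> E `<=` D ->
  cintegrable D F -> cintegrable E F.
Proof. by move=> mD mE ED [h1 h2]; split; apply: (@integrableS _ _ _ mu D E). Qed.

Lemma cintegrableD D F G : measurable D -> cintegrable D F -> cintegrable D G ->
  cintegrable D (fun y => F y + G y).
Proof.
move=> mD [f1 f2] [g1 g2]; split.
- apply: (integrable_ext mD _ (@integrableD _ _ _ mu D mD _ _ f1 g1)) => y _.
  by rewrite /= ReD.
- apply: (integrable_ext mD _ (@integrableD _ _ _ mu D mD _ _ f2 g2)) => y _.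
  by rewrite /= ImD.
Qed.

Lemma cintegralD D F G : measurable D -> cintegrable D F -> cintegrable D G ->
  cintegral D (fun y => F y + G y) = cintegral D F + cintegral D G.
Proof.
move=> mD [f1 f2] [g1 g2]; apply: complex_ext; rewrite ?ReD ?ImD /=.
- by rewrite -RintegralD//; apply: eq_Rintegral => y _; rewrite ReD.
- by rewrite -RintegralD//; apply: eq_Rintegral => y _; rewrite ImD.
Qed.

Lemma cintegrableZ D F a : measurable D -> cintegrable D F ->
  cintegrable D (fun y => a * F y).
Proof.
move=> mD [f1 f2]; split.
- have := @integrableB _ _ _ mu D mD _ _
    (@integrableZl _ _ _ mu D mD (complex.Re a) _ f1)
    (@integrableZl _ _ _ mu D mD (complex.Im a) _ f2).
  by apply: (integrable_ext mD) => y _; rewrite /= ReM.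
- have := @integrableD _ _ _ mu D mD _ _
    (@integrableZl _ _ _ mu D mD (complex.Re a) _ f2)
    (@integrableZl _ _ _ mu D mD (complex.Im a) _ f1).
  by apply: (integrable_ext mD) => y _; rewrite /= ImM.
Qed.

Lemma cintegralZ D F a : measurable D -> cintegrable D F ->
  cintegral D (fun y => a * F y) = a * cintegral D F.
Proof.
move=> mD [f1 f2].
have z1 (r : R) := @integrableZl _ _ _ mu D mD r _ f1.
have z2 (r : R) := @integrableZl _ _ _ mu D mD r _ f2.
apply: complex_ext; rewrite ?ReM ?ImM /=.
- rewrite -!RintegralZl// -RintegralB//; [|exact: z1|exact: z2].
  by apply: eq_Rintegral => y _; rewrite ReM.
- rewrite -!RintegralZl// -RintegralD//; [|exact: z2|exact: z1].
  by apply: eq_Rintegral => y _; rewrite ImM.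
Qed.

Lemma cintegrableN D F : measurable D -> cintegrable D F ->
  cintegrable D (fun y => - F y).
Proof.
move=> mD /(cintegrableZ (-1) mD); apply: (cintegrable_ext mD) => y _.
by rewrite mulN1r.
Qed.

Lemma cintegralN D F : measurable D -> cintegrable D F ->
  cintegral D (fun y => - F y) = - cintegral D F.
Proof.
move=> mD iF; rewrite -mulN1r -cintegralZ//.
by apply: cintegral_ext => y _; rewrite mulN1r.
Qed.

Lemma cintegrableB D F G : measurable D -> cintegrable D F -> cintegrable D G ->
  cintegrable D (fun y => F y - G y).
Proof. by move=> mD iF iG; apply: cintegrableD => //; apply: cintegrableN. Qed.

Lemma cintegralB D F G : measurable D -> cintegrable D F -> cintegrable D G ->
  cintegral D (fun y => F y - G y) = cintegral D F - cintegral D G.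
Proof.
move=> mD iF iG; rewrite cintegralD ?cintegralN//; exact: cintegrableN.
Qed.

Lemma cintegrable0 D : cintegrable D (fun=> 0).
Proof. by split; apply: integrable0. Qed.

Lemma cintegral0 D : cintegral D (fun=> 0) = 0.
Proof.
by rewrite /cintegral /=; apply: complex_ext => /=; rewrite /Rintegral integral0.
Qed.

Lemma cintegrable_sum D (I : Type) (s : seq I) (F : I -> R -> R[i]) :
  measurable D -> (forall j, cintegrable D (F j)) ->
  cintegrable D (fun y => \sum_(j <- s) F j y) /\
  cintegral D (fun y => \sum_(j <- s) F j y) = \sum_(j <- s) cintegral D (F j).
Proof.
move=> mD iF; elim: s => [|j s [IH1 IH2]].
  rewrite big_nil; split.
    by apply: (cintegrable_ext mD _ (cintegrable0 D)) => y _; rewrite big_nil.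
  by rewrite -[RHS](cintegral0 D); apply: cintegral_ext => y _; rewrite big_nil.
rewrite big_cons -IH2 -cintegralD//; split.
  by apply: (cintegrable_ext mD _ (cintegrableD mD (iF j) IH1)) => y _; rewrite big_cons.
by apply: cintegral_ext => y _; rewrite big_cons.
Qed.

(** The modulus of the integral [z] is reached by integrating the real part of [conjc z * F], for
    which monotonicity is available. The domination is only almost everywhere, as bounds on L^oo
    functions are. *)
Lemma cintegral_le D F (g : R -> R) : measurable D -> cmeasurable_on D F ->
  mu.-integrable D (EFin \o g) ->
  {ae mu, forall y, D y -> cabs (F y) <= g y} ->
  cintegrable D F /\ cabs (cintegral D F) <= Rintegral mu D g.
Proof.
move=> mD [m1 m2] ig Fg.
have iF : cintegrable D F.
  split; apply: (ae_le_integrable mD _ ig) => //; apply: (ae_imp Fg) => y h Dy;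
    by rewrite (le_trans _ (h Dy)) ?cabs_Re ?cabs_Im.
split => //; set z := cintegral D F; have zE : cintegral D F = z by [].
clearbody z.
have [z0|z0] := eqVneq (cabs z) 0.
  rewrite z0; have -> : (0 : R) = Rintegral mu D (cst 0).
    by rewrite /Rintegral integral0.
  apply: ae_le_Rintegral => //; first exact: integrable0.
  by apply: (ae_imp Fg) => y h Dy; rewrite (le_trans (cabs_ge0 _) (h Dy)).
have iz := cintegrableZ (conjc z) mD iF.
have : complex.Re (conjc z * z) <= cabs z * Rintegral mu D g.
  rewrite -{2}zE -(cintegralZ (conjc z) mD iF) /= -RintegralZl//.
  apply: ae_le_Rintegral => //; [exact: iz.1|exact: (@integrableZl _ _ _ mu D mD (cabs z) _ ig)|].
  apply: (ae_imp Fg) => y h Dy; rewrite (le_trans (Re_mul_conj_le _ _))//.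
  by rewrite ler_wpM2l ?cabs_ge0 ?h.
by rewrite Re_mul_conj_self expr2 ler_pM2l// lt_def z0 cabs_ge0.
Qed.

(* Only the values on [0, +oo[ are constrained: a continuous function is
   integrable on bounded intervals anyway. *)
Definition exp_decay F : Prop := exists M g : R,
  [/\ 0 < g, 0 <= M & forall y, 0 <= y -> cabs (F y) <= M * expR (- (g * y))].

Definition tail F x : R[i] := cintegral `]x, +oo[ F.

Definition tail_integrable F : Prop := forall x, cintegrable `]x, +oo[ F.

Lemma integrable_expRN (M g x : R) : 0 < g ->
  mu.-integrable `]x, +oo[ (EFin \o (fun y => M * expR (- (g * y)))) /\
  Rintegral mu `]x, +oo[ (fun y => M * expR (- (g * y))) = M / g * expR (- (g * x)).
Proof.
move=> g0.
have dexp y : is_derive y 1 (fun z => - (g^-1 * expR (- (g * z)))) (expR (- (g * y))).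
  have d1 : is_derive y 1 (fun z : R => - (g * z)) (- g).
    have := is_deriveN (is_deriveZ g (is_derive_id y (1 : R))).
    by rewrite /GRing.scale /= mulr1.
  have d2 := is_derive_comp1 d1 (is_derive_expR (- (g * y))).
  apply: (is_derive_eq (is_deriveN (is_deriveZ g^-1 d2))).
  by rewrite /GRing.scale /=; field; rewrite gt_eqF.
have [| | |i1 i2] := @ge0_primitive_tail R _ _ x 0 _ _ dexp.
- by move=> y; exact: expR_ge0.
- move=> y; apply: (@continuous_comp _ _ _ (fun z : R => - (g * z)) expR).
    by apply: cvgN; apply: cvgM; [exact: cvg_cst|exact: cvg_id].
  exact: continuous_expR.
- rewrite -oppr0 -[in X in _ --> X](mulr0 g^-1); apply: cvgN; apply: cvgM.
    exact: cvg_cst.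
  exact: cvg_expRN_pinfty.
split; first exact: (@integrableZl _ _ _ mu `]x, +oo[ _ M _ i1).
by rewrite RintegralZl// i2; ring.
Qed.

Lemma tail_le F (M g x : R) : 0 < g -> cmeasurable_on `]x, +oo[ F ->
  {ae mu, forall y, x < y -> cabs (F y) <= M * expR (- (g * y))} ->
  cintegrable `]x, +oo[ F /\ cabs (tail F x) <= M / g * expR (- (g * x)).
Proof.
move=> g0 mF hF; have [i1 <-] := integrable_expRN M x g0.
apply: cintegral_le => //; apply: (ae_imp hF) => y h.
by rewrite /= in_itv /= andbT => /h.
Qed.

Lemma tail_integrable_sub F x y : x <= y ->
  cintegrable `]x, +oo[ F -> cintegrable `]y, +oo[ F.
Proof.
move=> xy; apply: cintegrableS => // z /=; rewrite !in_itv /= !andbT.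
exact: le_lt_trans.
Qed.

Lemma continuous_tail_integrable (f : R -> R) (a x : R) : continuous f ->
  mu.-integrable `]a, +oo[ (EFin \o f) -> mu.-integrable `]x, +oo[ (EFin \o f).
Proof.
move=> cf iF; have [xa|ax] := leP a x.
  apply: (@integrableS _ _ _ mu `]a, +oo[) => // z /=.
  by rewrite !in_itv /= !andbT; exact: le_lt_trans.
apply: (@integrableS _ _ _ mu (`[x, a] `|` `]a, +oo[)) => //.
- exact: measurableU.
- move=> z /=; rewrite !in_itv /= !andbT => xz.
  by have [za|az] := leP z a; [left; rewrite ltW|right].
- apply/integrableP; split.
    apply/measurable_EFinP; apply: measurable_funTS; exact: continuous_measurable_fun.
  rewrite ge0_integral_setU//=; last 2 first.
  + by apply: measurableT_comp => //; apply: measurableT_comp => //;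
      apply: measurable_funTS; exact: continuous_measurable_fun.
  + apply/disj_setPRL => z /=; rewrite !in_itv /= => + /andP[_ za].
    by rewrite andbT ltNge za.
  have /integrableP[_ i1] : mu.-integrable `[x, a] (EFin \o f).
    apply: continuous_compact_integrable; first exact: segment_compact.
    exact: continuous_subspaceT.
  by have /integrableP[_ i2] := iF; rewrite lte_add_pinfty.
Qed.

Lemma exp_decay_tail_integrable F : ccont F -> exp_decay F -> tail_integrable F.
Proof.
move=> cF [M [g [g0 M0 hF]]] x.
have [||[i1 i2] _] := @tail_le F M g 0 g0.
- exact: ccont_cmeasurable_on.
- by apply: ae_all => y /ltW/hF.
have [c1 c2] := cF.
by split; [apply: continuous_tail_integrable i1|apply: continuous_tail_integrable i2].
Qed.

Lemma Rtail_derive (f : R -> R) x : continuous f ->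
  (forall y, mu.-integrable `]y, +oo[ (EFin \o f)) ->
  is_derive x 1 (fun z => Rintegral mu `]z, +oo[ f) (- f x).
Proof.
move=> cf iF; pose b := x - 1.
have [||||d1 d2] := @continuous_FTC1_closed R f b x (x + 1).
- by rewrite ltrDl.
- apply: continuous_compact_integrable; first exact: segment_compact.
  exact: continuous_subspaceT.
- by rewrite /b ltrBlDr ltrDl.
- exact: cf.
have d3 : is_derive x 1 (fun z => Rintegral mu `[b, z] f) (f x).
  by rewrite derive1E in d2; apply: DeriveDef.
have i1 : mu.-integrable `[b, +oo[ (EFin \o f).
  apply: (@integrableS _ _ _ mu `]b - 1, +oo[) => // z /=.
  rewrite !in_itv /= !andbT; apply: lt_le_trans; by rewrite ltrBlDr ltrDl.
(* Near x the tail is the constant integral from b minus the integral over [b, z], and the latter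
   has derivative f x. *)
have := is_deriveB (is_derive_cst (Rintegral mu `[b, +oo[ f) x (1 : R)) d3.
rewrite sub0r; apply: near_eq_is_derive; near=> z.
have bz : b <= z.
  by near: z; apply: lt_le_nbhsr; rewrite /b ltrBlDr ltrDl.
by rewrite /= -(@Rintegral_itvB R f (BLeft b) +oo%O z).
Unshelve. all: by end_near. Qed.

Lemma tail_der F x : ccont F -> tail_integrable F -> cder (tail F) x (- F x).
Proof.
move=> [c1 c2] iF; rewrite /tail; split; rewrite ?ReN ?ImN /=.
- by apply: (Rtail_derive x c1) => y; exact: (iF y).1.
- by apply: (Rtail_derive x c2) => y; exact: (iF y).2.
Qed.

Lemma exp_decay_intro F (M g : R) : 0 < g ->
  (forall y, 0 <= y -> cabs (F y) <= M * expR (- (g * y))) -> exp_decay F.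
Proof.
move=> g0 hF; exists M, g; split => //.
have := hF 0 (lexx _); rewrite mulr0 oppr0 expR0 mulr1.
by apply: le_trans; exact: cabs_ge0.
Qed.

Lemma exp_decay_ext F G : F =1 G -> exp_decay F -> exp_decay G.
Proof. by move=> /funext ->. Qed.

Lemma exp_decayD F G : exp_decay F -> exp_decay G ->
  exp_decay (fun y => F y + G y).
Proof.
move=> [M [g [g0 M0 hF]]] [N [h [h0 N0 hG]]].
pose m := Num.min g h.
have m0 : 0 < m by rewrite lt_min g0.
apply: (@exp_decay_intro _ (M + N) m m0) => y y0.
rewrite (le_trans (cabsD _ _))// mulrDl lerD//.
- rewrite (le_trans (hF y y0))// ler_wpM2l// ler_expR lerN2 ler_wpM2r//.
  by rewrite ge_min lexx.
- rewrite (le_trans (hG y y0))// ler_wpM2l// ler_expR lerN2 ler_wpM2r//.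
  by rewrite ge_min lexx orbT.
Qed.

Lemma exp_decayZ F a : exp_decay F -> exp_decay (fun y => a * F y).
Proof.
move=> [M [g [g0 M0 hF]]]; apply: (@exp_decay_intro _ (cabs a * M) g g0) => y y0.
by rewrite cabsM -mulrA ler_wpM2l ?cabs_ge0 ?hF.
Qed.

Lemma exp_decayN F : exp_decay F -> exp_decay (fun y => - F y).
Proof. by move/(exp_decayZ (-1)); apply: exp_decay_ext => y; rewrite mulN1r. Qed.

(** This is how limits at infinity are taken below. If c were positive, the single point A / (c g)
    would refute the bound, since exp t >= 1 + t. *)
Lemma le_exp_decay0 (c A g : R) : 0 < g ->
  (forall x, 0 <= x -> c <= A * expR (- (g * x))) -> c <= 0.
Proof.
move=> g0 h; rewrite leNgt; apply/negP => c0.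
have A0 : 0 < A.
  have := h 0 (lexx _); rewrite mulr0 oppr0 expR0 mulr1; exact: lt_le_trans.
have X0 : 0 <= A / c / g by rewrite !divr_ge0// ltW.
have := h _ X0; rewrite (mulrC g) divfK ?gt_eqF// expRN ler_pdivlMr ?expR_gt0//.
rewrite leNgt => /negP; apply.
have e1 : 1 + A / c <= expR (A / c) by exact: expR_ge1Dx.
rewrite (lt_le_trans _ (ler_wpM2l (ltW c0) e1))// mulrDr mulr1 (mulrC c (_ / _)) divfK ?gt_eqF//.
by rewrite ltrDr.
Qed.

Lemma tail_bound F (M g x : R) : 0 < g -> ccont F ->
  (forall y, x < y -> cabs (F y) <= M * expR (- (g * y))) ->
  cabs (tail F x) <= M / g * expR (- (g * x)).
Proof.
move=> g0 cF hF; have [||//] := @tail_le F M g x g0.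
- exact: ccont_cmeasurable_on.
- exact: ae_all.
Qed.

Lemma exp_decay_tail F : ccont F -> exp_decay F -> exp_decay (tail F).
Proof.
move=> cF [M [g [g0 M0 hF]]].
apply: (@exp_decay_intro _ (M / g) g g0) => x x0; apply: tail_bound => // y xy.
by apply: hF; rewrite ltW// (le_lt_trans x0).
Qed.

(** The sum [tail F + G] has zero derivative and decays, so it vanishes. *)
Lemma tail_primitive F G x : ccont F -> exp_decay F ->
  (forall y, cder G y (F y)) -> exp_decay G -> tail F x = - G x.
Proof.
move=> cF eF dG eG; have iF := exp_decay_tail_integrable cF eF.
have d0 y : cder (fun z => tail F z + G z) y 0.
  by apply: (cder_eq (cderD (tail_der y cF iF) (dG y))); rewrite addNr.
apply/eqP; rewrite -addr_eq0 -cabs_eq0 eq_le cabs_ge0 andbT.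
have [M [g [g0 M0 h]]] := exp_decayD (exp_decay_tail cF eF) eG.
apply: (@le_exp_decay0 _ M g g0) => y y0.
by have /= -> := cder0_cst x y d0; exact: h.
Qed.

Lemma tailD F G x : tail_integrable F -> tail_integrable G ->
  tail (fun y => F y + G y) x = tail F x + tail G x.
Proof. by move=> iF iG; exact: cintegralD. Qed.

Lemma tailB F G x : tail_integrable F -> tail_integrable G ->
  tail (fun y => F y - G y) x = tail F x - tail G x.
Proof. by move=> iF iG; exact: cintegralB. Qed.

Lemma tailZ F a x : tail_integrable F -> tail (fun y => a * F y) x = a * tail F x.
Proof. by move=> iF; exact: cintegralZ. Qed.

Lemma tailN F x : tail_integrable F -> tail (fun y => - F y) x = - tail F x.
Proof. by move=> iF; exact: cintegralN. Qed.

Lemma tail_ext F G x : F =1 G -> tail F x = tail G x.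
Proof. by move=> /funext ->. Qed.

Lemma tail_by_parts u du v dv x :
  (forall y, cder u y (du y)) -> (forall y, cder v y (dv y)) ->
  ccont du -> ccont dv -> exp_decay (fun y => u y * v y) ->
  exp_decay (fun y => du y * v y) -> exp_decay (fun y => u y * dv y) ->
  tail (fun y => du y * v y) x = - (u x * v x) - tail (fun y => u y * dv y) x.
Proof.
move=> hu hv cdu cdv e1 e2 e3.
have cu := cder_ccont hu; have cv := cder_ccont hv.
have c2 := ccontM cdu cv; have c3 := ccontM cu cdv.
have E : tail (fun y => du y * v y + u y * dv y) x = - (u x * v x).
  apply: (tail_primitive (G := fun y => u y * v y)) => //.
  - exact: ccontD.
  - exact: exp_decayD.
  - by move=> y; apply: cderM.
have i2 := exp_decay_tail_integrable c2 e2.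
have i3 := exp_decay_tail_integrable c3 e3.
by rewrite -E tailD// addrK.
Qed.

Definition reflect (D : set R) : set R := [set y | D (- y)].

Lemma measurable_reflect D : measurable D -> measurable (reflect D).
Proof.
move=> mD; rewrite /reflect -[X in measurable X]setTI.
exact: (@oppr_measurable R setT measurableT D mD).
Qed.

Lemma ge0_integral_reflect D (f : R -> \bar R) : measurable D ->
  measurable_fun D f -> (forall y, 0 <= f y)%E ->
  (\int[mu]_(y in D) f y = \int[mu]_(y in reflect D) f (- y)%R)%E.
Proof.
move=> mD mf f0.
rewrite (_ : reflect D = (-%R : _ -> measurableTypeR R) @^-1` D)//.
rewrite -[RHS]ge0_integral_pushforward//=.
by apply: eq_measure_integral => //= A mA _; exact/esym/lebesgue_measureN.
Qed.

Lemma measurable_fun_reflect D (f : R -> R) : measurable D ->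
  measurable_fun D f -> measurable_fun (reflect D) (fun y => f (- y)).
Proof.
move=> mD mf; apply: (@measurable_comp _ _ _ _ _ _ D f _ (fun y => - y)) => //.
  by move=> _ [y Dy <-].
by apply: measurable_funTS; exact: oppr_measurable.
Qed.

Lemma integrable_reflect D (f : R -> R) : measurable D ->
  mu.-integrable D (EFin \o f) ->
  mu.-integrable (reflect D) (EFin \o (fun y => f (- y))) /\
  Rintegral mu D f = Rintegral mu (reflect D) (fun y => f (- y)).
Proof.
move=> mD intf.
have mf : measurable_fun D f by apply/measurable_EFinP; exact: (measurable_int mu).
have mrD := measurable_reflect mD.
(* The change of variables is proved for nonnegative functions, hence the split into positive and
   negative parts. *)
pose p y := Num.max (f y) 0; pose n y := Num.max (- f y) 0.
have mp : measurable_fun D p by apply: measurable_maxr.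
have mn : measurable_fun D n by apply: measurable_maxr => //; exact: measurableT_comp.
have p0 y : 0 <= p y by rewrite le_max lexx orbT.
have n0 y : 0 <= n y by rewrite le_max lexx orbT.
have fE y : f y = p y - n y.
  by rewrite /p /n; case: (leP 0 (f y)) => h; case: (leP 0 (- f y)) => h'; lra.
have K (h : R -> R) : (forall y, 0 <= h y) -> measurable_fun D h ->
    (forall y, h y <= `|f y|) ->
    [/\ mu.-integrable D (EFin \o h),
        mu.-integrable (reflect D) (EFin \o (fun y => h (- y))) &
        Rintegral mu D h = Rintegral mu (reflect D) (fun y => h (- y))].
  move=> h0 mh hf.
  have ih : mu.-integrable D (EFin \o h).
    apply: (ae_le_integrable mD mh (@integrable_norm _ _ _ mu D f intf)).
    by apply: ae_all => y _; rewrite ger0_norm.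
  split => //; last first.
    by rewrite /Rintegral (ge0_integral_reflect mD)//; exact/measurable_EFinP.
  apply/integrableP; split.
    by apply/measurable_EFinP; exact: measurable_fun_reflect.
  have /integrableP[_] := ih; rewrite (ge0_integral_reflect mD)//=.
  by apply/measurable_EFinP; apply: measurableT_comp.
have [|i1 i2 i3] := K p p0 mp.
  by move=> y; rewrite /p ge_max normr_ge0 ler_norm.
have [|j1 j2 j3] := K n n0 mn.
  by move=> y; rewrite /n ge_max normr_ge0 andbT -normrN ler_norm.
split.
  by apply: (integrable_ext mrD _ (@integrableB _ _ _ mu _ mrD _ _ i2 j2)) => y _ /=;
    rewrite fE.
have -> : f = (fun y => p y - n y) by apply/funext.
by rewrite !RintegralB// i3 j3.
Qed.

Lemma cintegral_reflect D F : measurable D -> cintegrable D F ->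
  cintegrable (reflect D) (fun y => F (- y)) /\
  cintegral D F = cintegral (reflect D) (fun y => F (- y)).
Proof.
move=> mD [f1 f2].
have [i1 e1] := integrable_reflect mD f1; have [i2 e2] := integrable_reflect mD f2.
by split => //; rewrite /cintegral e1 e2.
Qed.

Lemma ae_reflect (P : R -> Prop) : {ae mu, forall y, P y} -> {ae mu, forall y, P (- y)}.
Proof.
move=> [N [mN N0 hN]]; exists (reflect N); split.
- exact: measurable_reflect.
- by rewrite -[RHS]N0 -(lebesgue_measureN mN).
- by move=> y hy; apply: hN.
Qed.

End ComplexIntegral.

(** * Complex exponentials *)

Section Kernel.
Context {R : realType}.
Implicit Types (k a z w : R[i]) (x y : R).

Lemma is_derive_mulr (c x : R) : is_derive x 1 (fun y => c * y) c.
Proof.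
by have := is_deriveZ c (is_derive_id x (1 : R)); rewrite /GRing.scale /= mulr1.
Qed.

Lemma cexp0 : cexp (0 : R[i]) = 1.
Proof. by rewrite /cexp /= expR0 cos0 sin0 mul1r. Qed.

Lemma cexpD z w : cexp (z + w) = cexp z * cexp w.
Proof.
rewrite /cexp ReD ImD expRD cosD sinD.
by apply: complex_ext; rewrite !ReImE /=; ring.
Qed.

Lemma cexpN z : cexp z * cexp (- z) = 1.
Proof. by rewrite -cexpD subrr cexp0. Qed.

Lemma cabs_cexp z : cabs (cexp z) = expR (complex.Re z).
Proof.
rewrite /cexp cabsM cabs_real ger0_norm ?expR_ge0//.
by rewrite cabsE /= cos2Dsin2 sqrtr1 mulr1.
Qed.

Lemma cder_cexp a x :
  cder (fun y => cexp (a * y%:C)) x (a * cexp (a * x%:C)).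
Proof.
have ReE y : complex.Re (a * y%:C) = complex.Re a * y by rewrite ReM /= mulr0 subr0.
have ImE y : complex.Im (a * y%:C) = complex.Im a * y by rewrite ImM /= mulr0 add0r.
pose r := complex.Re a; pose i := complex.Im a.
have de := is_derive_comp1 (is_derive_mulr r x) (is_derive_expR (r * x)).
have dc := is_derive_comp1 (is_derive_mulr i x) (is_derive_cos (i * x)).
have ds := is_derive_comp1 (is_derive_mulr i x) (is_derive_sin (i * x)).
split.
- have -> : (fun y => complex.Re (cexp (a * y%:C))) =
      (fun y => expR (r * y)) * (fun y => cos (i * y)).
    by apply/funext => y; rewrite /cexp ReE ImE !ReImE /= mul0r subr0.
  apply: (is_derive_eq (is_deriveM de dc)).
  rewrite /cexp !(ReE, ImE, ReImE) /= /GRing.scale /= -/r -/i.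
  by move: (expR _) (cos _) (sin _) => *; ring.
- have -> : (fun y => complex.Im (cexp (a * y%:C))) =
      (fun y => expR (r * y)) * (fun y => sin (i * y)).
    by apply/funext => y; rewrite /cexp ReE ImE !ReImE /= mul0r addr0.
  apply: (is_derive_eq (is_deriveM de ds)).
  rewrite /cexp !(ReE, ImE, ReImE) /= /GRing.scale /= -/r -/i.
  by move: (expR _) (cos _) (sin _) => *; ring.
Qed.

(** With [sin_div] it forms a fundamental system of f'' = - k^2 f that stays independent at k = 0,
    unlike the two exponentials. *)
Definition ccos k x : R[i] := (cexp ('i * k * x%:C) + cexp (- ('i * k * x%:C))) / 2.

Lemma i_sqr : 'i * 'i = -1 :> R[i].
Proof. by rewrite -expr2 sqr_i. Qed.

Lemma sin_div_neq0 k x : k != 0 ->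
  sin_div k x = (cexp ('i * k * x%:C) - cexp (- ('i * k * x%:C))) / (2 * 'i * k).
Proof.
move=> k0; rewrite /sin_div (negbTE k0) /csin mulrA.
by rewrite [in RHS]invfM mulrA.
Qed.

Lemma ccos_k0 x : ccos (0 : R[i]) x = 1.
Proof. by rewrite /ccos !(mulr0, mul0r) oppr0 cexp0 -mulr2n divff// pnatr_eq0. Qed.

Lemma sin_div_k0 x : sin_div (0 : R[i]) x = x%:C.
Proof. by rewrite /sin_div eqxx. Qed.

Lemma i_neq0 : 'i != 0 :> R[i].
Proof. by rewrite -cabs_gt0 cabs_i. Qed.

(** Euler's formula in a form valid at k = 0, which spares the later proofs the case distinction. *)
Lemma cexp_ik k x : cexp ('i * k * x%:C) = ccos k x + 'i * k * sin_div k x.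
Proof.
have [->|k0] := eqVneq k 0.
  by rewrite ccos_k0 !(mulr0, mul0r) cexp0 addr0.
rewrite sin_div_neq0// /ccos; field.
by rewrite k0 i_neq0.
Qed.

Lemma cexp_Nik k x : cexp (- ('i * k * x%:C)) = ccos k x - 'i * k * sin_div k x.
Proof.
have [->|k0] := eqVneq k 0.
  by rewrite ccos_k0 !(mulr0, mul0r) oppr0 cexp0 addr0.
rewrite sin_div_neq0// /ccos; field.
by rewrite k0 i_neq0.
Qed.

Lemma ccos_sqr k x : ccos k x ^+ 2 + k ^+ 2 * sin_div k x ^+ 2 = 1.
Proof.
have := cexpN ('i * k * x%:C); rewrite cexp_ik cexp_Nik => <-.
move: (sin_div k x) (ccos k x) => s c.
(* [ring] treats the imaginary unit as an atom, so its square is kept as a product and replaced by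
   -1 afterwards. *)
transitivity (c ^+ 2 - ('i * 'i) * k ^+ 2 * s ^+ 2); last by ring.
by rewrite i_sqr; ring.
Qed.

Lemma cder_cexp_ik k x : cder (fun y => cexp ('i * k * y%:C)) x
  ('i * k * cexp ('i * k * x%:C)).
Proof. exact: cder_cexp. Qed.

Lemma cder_cexp_Nik k x : cder (fun y => cexp (- ('i * k * y%:C))) x
  (- ('i * k) * cexp (- ('i * k * x%:C))).
Proof.
have := cder_cexp (- ('i * k)) x; rewrite [X in cexp X]mulNr.
by apply: cder_ext => y; rewrite mulNr.
Qed.

Lemma cder_ccos k x : cder (ccos k) x (- k ^+ 2 * sin_div k x).
Proof.
have [->|k0] := eqVneq k 0.
  have -> : ccos (0 : R[i]) = fun=> 1 by apply/funext => y; rewrite ccos_k0.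
  by rewrite expr0n /= oppr0 mul0r; exact: cder_cst.
apply: (cder_eq (cderZr 2^-1 (cderD (cder_cexp_ik k x) (cder_cexp_Nik k x)))).
rewrite sin_div_neq0//.
move: (cexp _) (cexp _) => u v.
have -> : - k ^+ 2 = ('i * 'i) * k ^+ 2 by rewrite i_sqr mulN1r.
by field; rewrite k0 i_neq0.
Qed.

Lemma cder_sin_div k x : cder (sin_div k) x (ccos k x).
Proof.
have [->|k0] := eqVneq k 0.
  rewrite ccos_k0.
  have -> : sin_div (0 : R[i]) = real_complex R.
    by apply/funext => y; rewrite sin_div_k0.
  exact: cder_id.
have -> : sin_div k = fun y =>
    (cexp ('i * k * y%:C) - cexp (- ('i * k * y%:C))) / (2 * 'i * k).
  by apply/funext => y; rewrite sin_div_neq0.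
apply: (cder_eq (cderZr _ (cderB (cder_cexp_ik k x) (cder_cexp_Nik k x)))).
rewrite /ccos; have := i_neq0; move: (cexp _) (cexp _) => u v i0.
by field; rewrite k0 i0.
Qed.

Lemma ccont_ccos k : ccont (ccos k).
Proof. exact: cder_ccont (cder_ccos k). Qed.

Lemma ccont_sin_div k : ccont (sin_div k).
Proof. exact: cder_ccont (cder_sin_div k). Qed.

Lemma sin_div_at0 k : sin_div k 0 = 0.
Proof.
have [->|k0] := eqVneq k 0; first by rewrite sin_div_k0.
by rewrite sin_div_neq0// mulr0 oppr0 subrr mul0r.
Qed.

Lemma ccos_at0 k : ccos k 0 = 1.
Proof. by rewrite /ccos mulr0 oppr0 cexp0 -mulr2n divff// pnatr_eq0. Qed.

Lemma sin_divN k x : sin_div k (- x) = - sin_div k x.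
Proof.
have [->|k0] := eqVneq k 0; first by rewrite !sin_div_k0 rmorphN.
by rewrite !sin_div_neq0// rmorphN mulrN opprK -[RHS]mulNr opprB.
Qed.

Lemma sin_divB k x y :
  sin_div k (y - x) = sin_div k y * ccos k x - ccos k y * sin_div k x.
Proof.
have [->|k0] := eqVneq k 0.
  by rewrite !sin_div_k0 !ccos_k0 rmorphB mul1r mulr1.
rewrite !sin_div_neq0// /ccos rmorphB /= mulrBr opprB addrC.
rewrite cexpD [- _ + _]addrC cexpD.
move: (cexp _) (cexp _) (cexp _) (cexp _) => a b c d.
by field; rewrite k0 i_neq0.
Qed.

Lemma ccosB k x y :
  ccos k (y - x) = ccos k y * ccos k x + k ^+ 2 * sin_div k y * sin_div k x.
Proof.
have [->|k0] := eqVneq k 0.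
  by rewrite !ccos_k0 expr0n /= !mul0r addr0 mul1r.
rewrite !sin_div_neq0// /ccos rmorphB /= mulrBr opprB !cexpD.
move: (cexp ('i * k * x%:C)) (cexp (- ('i * k * x%:C)))
  (cexp ('i * k * y%:C)) (cexp (- ('i * k * y%:C))) => a d c b.
have -> : k ^+ 2 * ((c - b) / (2 * 'i * k)) * ((a - d) / (2 * 'i * k)) =
  - ((c - b) * (a - d) / 4).
  have -> : - ((c - b) * (a - d) / 4) = (c - b) * (a - d) / (4 * ('i * 'i)).
    by rewrite i_sqr mulrN1 invrN mulrN.
  by field; rewrite k0 i_neq0.
by field.
Qed.

Lemma Re_ik k x : complex.Re ('i * k * x%:C) = - complex.Im k * x.
Proof. by rewrite !ReImE /=; ring. Qed.

Lemma le_mulIm (al m x : R) : `|m| <= al -> m * x <= al * `|x|.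
Proof.
move=> h; rewrite (le_trans (ler_norm _))// normrM ler_wpM2r//.
Qed.

Lemma cabs_cexp_ik_le (al : R) k x : `|complex.Im k| <= al ->
  cabs (cexp ('i * k * x%:C)) <= expR (al * `|x|).
Proof.
by move=> h; rewrite cabs_cexp ler_expR Re_ik le_mulIm// normrN.
Qed.

Lemma cabs_cexp_Nik_le (al : R) k x : `|complex.Im k| <= al ->
  cabs (cexp (- ('i * k * x%:C))) <= expR (al * `|x|).
Proof.
by move=> h; rewrite cabs_cexp ler_expR ReN Re_ik mulNr opprK le_mulIm.
Qed.

Lemma cabs_ccos_le (al : R) k x : `|complex.Im k| <= al ->
  cabs (ccos k x) <= expR (al * `|x|).
Proof.
move=> h; rewrite /ccos cabsM cabsV cabs_nat ler_pdivrMr// mulr_natr mulr2n.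
apply: (le_trans (cabsD _ _)); apply: lerD.
  exact: cabs_cexp_ik_le.
exact: cabs_cexp_Nik_le.
Qed.

(** The bound for [ccos] is integrated from 0. This gives a constant independent of k, also near k =
    0, where dividing the sine by k would not. *)
Lemma cabs_sin_div_le (al : R) k x : 0 < al -> `|complex.Im k| <= al ->
  cabs (sin_div k x) <= al^-1 * expR (al * `|x|).
Proof.
move=> al0 h; wlog x0 : x / 0 <= x.
  move=> W; have [/W //|/ltW x0] := leP 0 x.
  by rewrite -cabsN -sin_divN -normrN W// oppr_ge0.
rewrite ger0_norm//.
have dg (t : R) : is_derive t 1 (fun y => al^-1 * expR (al * y)) (expR (al * t)).
  have de := is_derive_comp1 (is_derive_mulr al t) (is_derive_expR (al * t)).
  apply: (is_derive_eq (is_deriveZ al^-1 de)).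
  by rewrite /GRing.scale /= mulrA mulVf ?mul1r// gt_eqF.
have := @cder_le R (sin_div k) (ccos k) (fun y => al^-1 * expR (al * y))
  (fun y => expR (al * y)) 0 x x0.
rewrite sin_div_at0 subr0 mulr0 expR0 mulr1 => K.
apply: le_trans (K _ _ _) _.
- by move=> t _; exact: cder_sin_div.
- by move=> t /andP[t0 _]; rewrite -{2}(ger0_norm t0) cabs_ccos_le.
- by rewrite lerBlDr lerDl invr_ge0 ltW.
Qed.

End Kernel.

(** * The Volterra equation for the Jost solutions *)

Section GeometricLimit.
Context {R : realType}.

Lemma eq_ler (x y : R) : x = y -> x <= y.
Proof. by move->. Qed.

Lemma geometric_limit (u : nat -> R) (K : R) :
  (forall n, `|u n.+1 - u n| <= K * 2^-1 ^+ n) ->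
  exists l, forall n, `|l - u n| <= 2 * K * 2^-1 ^+ n.
Proof.
move=> hu; pose d := fun n => u n.+1 - u n.
have h2 : `|2^-1 : R| < 1 by rewrite ger0_norm ?invf_lt1 ?ltr1n ?invr_ge0.
have K0 : 0 <= K.
  by have := hu 0%N; rewrite expr0 mulr1; apply: le_trans; exact: normr_ge0.
have cd : cvgn (series d).
  apply: normed_cvg; apply: (@series_le_cvg _ _ (geometric K 2^-1)).
  - by move=> n; exact: normr_ge0.
  - by move=> n; rewrite /geometric /= mulr_ge0// exprn_ge0// invr_ge0.
  - exact: hu.
  - exact: is_cvg_geometric_series.
have dE n : series d n = u n - u 0%N.
  by rewrite /series /= telescope_sumr.
have cu : cvgn u.
  have -> : u = series d + cst (u 0%N).
    apply/funext => n; have -> : (series d + cst (u 0%N)) n = series d n + u 0%N by [].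
  by rewrite dE subrK.
  by apply: is_cvgD => //; exact: is_cvg_cst.
exists (limn u) => n.
(* The factor [1 - 2^-1 ^+ m] is the exact partial geometric sum; without it the induction would not
   close. *)
have step m : `|u (n + m)%N - u n| <= 2 * K * 2^-1 ^+ n * (1 - 2^-1 ^+ m).
  elim: m => [|m IH]; first by rewrite addn0 subrr normr0 expr0 subrr mulr0.
  rewrite addnS; have -> : u (n + m).+1 - u n = (u (n + m).+1 - u (n + m)%N) + (u (n + m)%N - u n) by ring.
  apply: (le_trans (ler_normD _ _)); apply: (le_trans (lerD (hu _) IH)).
  rewrite exprD exprS; move: (2^-1 ^+ n) (2^-1 ^+ m) => p q.
  by apply: eq_ler; field.
have cv : `|u m - u n| @[m --> \oo] --> `|limn u - u n|.
  by apply: cvg_norm; apply: cvgB => //; exact: cvg_cst.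
rewrite -(cvg_lim (@Rhausdorff R) cv); apply: limr_le.
  by apply/cvg_ex; exists `|limn u - u n|.
near=> m.
have nm : (n <= m)%N by near: m; exact: nbhs_infty_ge.
rewrite -(subnKC nm) (le_trans (step _))// ler_piMr//.
by rewrite !mulr_ge0// exprn_ge0// invr_ge0.
Unshelve. all: by end_near. Qed.

Lemma cgeometric_limit (z : nat -> R[i]) (K : R) :
  (forall n, cabs (z n.+1 - z n) <= K * 2^-1 ^+ n) ->
  exists l, forall n, cabs (l - z n) <= 4 * K * 2^-1 ^+ n.
Proof.
move=> hz.
have [n|a ha] := @geometric_limit (fun n => complex.Re (z n)) K.
  by rewrite -ReB (le_trans (cabs_Re _)).
have [n|b hb] := @geometric_limit (fun n => complex.Im (z n)) K.
  by rewrite -ImB (le_trans (cabs_Im _)).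
exists (a +i* b) => n; apply: (le_trans (cabs_le_ReIm _)).
rewrite ReB ImB /= (le_trans (lerD (ha n) (hb n)))//.
by apply: eq_ler; ring.
Qed.

Lemma cvg_half_pow (c W : R) : (forall n, c <= W * 2^-1 ^+ n) -> c <= 0.
Proof.
move=> h.
have h2 : `|2^-1 : R| < 1 by rewrite ger0_norm ?invf_lt1 ?ltr1n ?invr_ge0.
have := cvg_geometric W h2; rewrite /geometric => cv.
rewrite -(cvg_lim (@Rhausdorff R) cv); apply: limr_ge.
  by apply/cvg_ex; exists 0.
by apply: nearW => n /=; exact: h.
Qed.

(** The convergence is locally uniform, because the continuous weight W is bounded near each
    point. *)
Lemma ccont_half_approx (phi : nat -> R -> R[i]) (f : R -> R[i]) (W : R -> R) :
  (forall n, ccont (phi n)) -> continuous W ->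
  (forall n x, cabs (f x - phi n x) <= 2^-1 ^+ n * W x) -> ccont f.
Proof.
move=> cphi cW hf.
suff K (p : R[i] -> R) : (forall n, continuous (fun x => p (phi n x))) ->
    (forall a b, `|p a - p b| <= cabs (a - b)) -> continuous (fun x => p (f x)).
  by split; apply: K => [n|a b]; rewrite -?ReB -?ImB ?cabs_Re ?cabs_Im//;
    have [] := cphi n.
move=> cp hp x; apply/cvgrPdist_lt => e e0.
have Wx0 : 0 <= W x.
  by have := hf 0%N x; rewrite expr0 mul1r; apply: le_trans; exact: cabs_ge0.
have [n hn] : exists n, 2^-1 ^+ n * (2 * (W x + 1)) < e / 2.
  apply: contrapT => /forallNP hn; have := @cvg_half_pow (e / 2) (2 * (W x + 1)).
  have e2 : 0 < e / 2 by rewrite divr_gt0.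
  by rewrite leNgt e2 => /(_ _)/wrap[] // n; rewrite leNgt mulrC; apply/negP/hn.
near=> y.
have h1 : `|p (f x) - p (phi n x)| <= 2^-1 ^+ n * (W x + 1).
  by rewrite (le_trans (hp _ _))// (le_trans (hf n x))// ler_wpM2l// lerDl.
have Wy : W y <= W x + 1.
  near: y; have /cvgrPdist_lt/(_ 1 ltr01) := cW x.
  by apply: filterS => y; rewrite ltr_norml => /andP[? ?]; lra.
have h2 : `|p (f y) - p (phi n y)| <= 2^-1 ^+ n * (W x + 1).
  by rewrite (le_trans (hp _ _))// (le_trans (hf n y))// ler_wpM2l//.
have h3 : `|p (phi n x) - p (phi n y)| < e / 2.
  near: y; have /cvgrPdist_lt := cp n x; apply; by rewrite divr_gt0.
have -> : p (f x) - p (f y) = (p (f x) - p (phi n x)) + (p (phi n x) - p (phi n y))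
   - (p (f y) - p (phi n y)) by ring.
rewrite (le_lt_trans (ler_normB _ _))// (le_lt_trans (lerD (ler_normD _ _) (lexx _)))//.
lra.
Unshelve. all: by end_near. Qed.

End GeometricLimit.

(** * The weighted contraction estimate *)

Section Volterra.
Context {R : realType}.
Notation mu := (@lebesgue_measure R).
Variables (al be : R).
Hypotheses (al0 : 0 < al) (albe : al < be / 2).
Implicit Types (k : R[i]) (U : R -> R) (f : R -> R[i]) (x y A : R).

(** The decay that is left when a potential of rate [be] multiplies the kernel and the solution,
    each growing at rate [al]. *)
Definition jgap : R := be - 2 * al.
Definition jker : R := 1 + al^-1.
(** Chosen so that integrating the weight divides by [2 * jker * A], which cancels the constants of
    the kernel and the potential and leaves 1/2. *)
Definition jexp A : R := 2 * jker * A / jgap.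

(* The factor exp(L exp(-delta x)) makes multiplication by the potential
   followed by integration over ]x, +oo[ a contraction of ratio 1/2. *)
Definition jweight A x : R :=
  expR (al * `|x|) * expR (jexp A * expR (- (jgap * x))).

Lemma jgap_gt0 : 0 < jgap.
Proof. by rewrite /jgap; move: albe; lra. Qed.

Lemma jker_gt0 : 0 < jker.
Proof. by rewrite /jker addr_gt0// invr_gt0. Qed.

Lemma jexp_gt0 A : 0 < A -> 0 < jexp A.
Proof. by move=> A0; rewrite /jexp divr_gt0 ?jgap_gt0// !mulr_gt0// jker_gt0. Qed.

Lemma jweight_gt0 A x : 0 < jweight A x.
Proof. by rewrite /jweight mulr_gt0 ?expR_gt0. Qed.

Lemma expR_le_jweight A x : 0 < A -> expR (al * `|x|) <= jweight A x.
Proof.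
move=> A0; rewrite /jweight ler_peMr ?expR_ge0// -expR0 ler_expR.
by rewrite mulr_ge0 ?expR_ge0// ltW// jexp_gt0.
Qed.

Lemma jweight_le A x : 0 < A -> 0 <= x ->
  jweight A x <= expR (jexp A) * expR (al * x).
Proof.
move=> A0 x0; rewrite /jweight ger0_norm// mulrC ler_wpM2r ?expR_ge0// ler_expR.
rewrite ler_piMr//; first exact: ltW (jexp_gt0 A0).
rewrite -expR0 ler_expR oppr_le0.
by rewrite mulr_ge0// ltW// jgap_gt0.
Qed.

Lemma cvg_expR_comp (T : Type) (F : set_system T) (FF : Filter F)
    (h : T -> R) (l : R) : h y @[y --> F] --> l -> expR (h y) @[y --> F] --> expR l.
Proof. by move=> hl; apply: (cvg_comp _ _ hl); exact: continuous_expR. Qed.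

Lemma cvg_mulr (c x : R) : c * y @[y --> x] --> c * x.
Proof. by apply: cvgM; [exact: cvg_cst|exact: cvg_id]. Qed.

Lemma continuous_exp_expRN (g L : R) : continuous (fun y => expR (L * expR (- (g * y)))).
Proof.
move=> x; apply: cvg_expR_comp; apply: cvgM; first exact: cvg_cst.
by apply: cvg_expR_comp; apply: cvgN; exact: cvg_mulr.
Qed.

Lemma continuous_jweight A : continuous (jweight A).
Proof.
move=> x; apply: cvgM; last exact: continuous_exp_expRN.
apply: cvg_expR_comp; apply: cvgM; first exact: cvg_cst.
by apply: cvg_norm; exact: cvg_id.
Qed.

(** Up to the constant - L jgap the integrand is the derivative of its own second factor. *)
Lemma jweight_tail (L x : R) : 0 < L ->
  mu.-integrable `]x, +oo[
    (EFin \o (fun y => expR (- (jgap * y)) * expR (L * expR (- (jgap * y))))) /\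
  Rintegral mu `]x, +oo[
    (fun y => expR (- (jgap * y)) * expR (L * expR (- (jgap * y)))) <=
  expR (L * expR (- (jgap * x))) / (L * jgap).
Proof.
move=> L0; have g0 := jgap_gt0.
pose F y := - ((L * jgap)^-1 * expR (L * expR (- (jgap * y)))).
have dF (y : R) : is_derive y 1 F
    (expR (- (jgap * y)) * expR (L * expR (- (jgap * y)))).
  have d1 : is_derive y 1 (fun y => - (jgap * y)) (- jgap).
    exact: (is_deriveN (is_derive_mulr jgap y)).
  have d2 := is_deriveZ L (is_derive_comp1 d1 (is_derive_expR _)).
  have d3 := is_derive_comp1 d2 (is_derive_expR _).
  apply: (is_derive_eq (is_deriveN (is_deriveZ (L * jgap)^-1 d3))).
  transitivity (- ((L * jgap)^-1 * (L * (- jgap * expR (- (jgap * y))) *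
    expR (L * expR (- (jgap * y)))))) => //.
  set a := expR (- (jgap * y)); set b := expR (L * a).
  by field; rewrite !gt_eqF.
have [|||i1 i2] := @ge0_primitive_tail R _ F x (- (L * jgap)^-1) _ _ dF.
- by move=> y; rewrite mulr_ge0 ?expR_ge0.
- move=> y; apply: cvgM; last exact: continuous_exp_expRN.
  by apply: cvg_expR_comp; apply: cvgN; exact: cvg_mulr.
- have -> : - (L * jgap)^-1 = - ((L * jgap)^-1 * expR (L * 0)).
    by rewrite mulr0 expR0 mulr1.
  apply: cvgN; apply: cvgM; first exact: cvg_cst.
  apply: cvg_expR_comp.
  by apply: cvgM; [exact: cvg_cst|exact: cvg_expRN_pinfty].
split => //; rewrite i2 /F opprK addrC mulrC gerBl invr_ge0.
by rewrite ltW// mulr_gt0.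
Qed.

(** The left side adds the exponents of kernel, potential and solution. Only y <= |y| and - |x| <= x
    enter, so the estimate covers negative x and y as well. *)
Lemma volterra_exponents x y : x <= y ->
  al * (y - x) + (- (be * `|y|) + al * `|y|) <= al * `|x| - jgap * y.
Proof.
move=> xy; have h1 : y <= `|y| by exact: ler_norm.
have h2 : - `|x| <= x by exact: lerNnorml || (rewrite lerNl; exact: (le_trans (ler_norm _) (eq_ler (normrN x)))).
have := ler_wpM2l (ltW jgap_gt0) h1; have := ler_wpM2l (ltW al0) h1.
have := ler_wpM2l (ltW al0) h2; rewrite /jgap; lra.
Qed.

(** The constant [A'] of the potential is kept apart from the constant [A] of the weight: [A' = A]
    gives the contraction, and [A' = A * eps ^+ 2] gives the gain for a small potential. *)
Lemma volterra_bound A A' (N : R) (F : R -> R[i]) x : 0 < A -> 0 <= A' -> 0 <= N ->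
  cmeasurable_on `]x, +oo[ F ->
  {ae mu, forall y, x < y -> cabs (F y) <=
    jker * expR (al * (y - x)) * (A' * expR (- (be * `|y|))) * (N * jweight A y)} ->
  cintegrable `]x, +oo[ F /\
  cabs (tail F x) <= N * (A' / (2 * A)) * jweight A x.
Proof.
move=> A0 A'0 N0 mF hF; have L0 := jexp_gt0 A0.
have [i1 i2] := jweight_tail x L0.
pose c := jker * A' * N * expR (al * `|x|).
have c0 : 0 <= c by rewrite /c !mulr_ge0 ?expR_ge0// ltW// jker_gt0.
have [|||h1 h2] := @cintegral_le R `]x, +oo[ F
    (fun y => c * (expR (- (jgap * y)) * expR (jexp A * expR (- (jgap * y))))) _ mF.
- by [].
- exact: (@integrableZl _ _ _ mu `]x, +oo[ _ c _ i1).
- apply: (ae_imp hF) => y h; rewrite /= in_itv /= andbT => xy.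
  apply: (le_trans (h xy)); rewrite /c /jweight.
  set E := expR (jexp A * _).
  have -> : jker * expR (al * (y - x)) * (A' * expR (- (be * `|y|))) *
    (N * (expR (al * `|y|) * E)) = jker * A' * N * E *
     (expR (al * (y - x)) * (expR (- (be * `|y|)) * expR (al * `|y|))) by ring.
  have -> : jker * A' * N * expR (al * `|x|) * (expR (- (jgap * y)) * E) =
    jker * A' * N * E * (expR (al * `|x|) * expR (- (jgap * y))) by ring.
  rewrite -!expRD ler_wpM2l//.
    by rewrite !mulr_ge0 ?expR_ge0// ltW// jker_gt0.
  by rewrite ler_expR volterra_exponents// ltW.
split => //; apply: (le_trans h2); rewrite RintegralZl//.
apply: (le_trans (ler_wpM2l c0 i2)); rewrite /c /jweight /jexp.
have g0 := jgap_gt0; have k0 := jker_gt0.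
apply: eq_ler; set a := expR (al * _); set b := expR (_ * _).
by field; rewrite !gt_eqF.
Qed.

End Volterra.

Section KernelSplit.
Context {R : realType}.
Implicit Types (k : R[i]) (h : R -> R[i]) (x : R).

(** The addition formula separates the variables of the kernel. The remaining tails depend on x only
    through their endpoint, so [tail_der] can differentiate them. *)
Lemma volterra_sin_split k h x :
  cintegrable `]x, +oo[ (fun y => sin_div k y * h y) ->
  cintegrable `]x, +oo[ (fun y => ccos k y * h y) ->
  cintegrable `]x, +oo[ (fun y => sin_div k (y - x) * h y) /\
  tail (fun y => sin_div k (y - x) * h y) x =
    ccos k x * tail (fun y => sin_div k y * h y) x -
    sin_div k x * tail (fun y => ccos k y * h y) x.
Proof.
move=> iS ic.
have i1 := cintegrableZ (ccos k x) (measurable_itv _) iS.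
have i2 := cintegrableZ (sin_div k x) (measurable_itv _) ic.
have E y : ccos k x * (sin_div k y * h y) - sin_div k x * (ccos k y * h y) =
  sin_div k (y - x) * h y by rewrite sin_divB; ring.
split.
  by apply: (cintegrable_ext (measurable_itv _) _
    (cintegrableB (measurable_itv _) i1 i2)) => y _; rewrite E.
rewrite /tail -!cintegralZ// -cintegralB//.
by apply: cintegral_ext => y _; rewrite E.
Qed.

Lemma volterra_cos_split k h x :
  cintegrable `]x, +oo[ (fun y => sin_div k y * h y) ->
  cintegrable `]x, +oo[ (fun y => ccos k y * h y) ->
  tail (fun y => ccos k (y - x) * h y) x =
    ccos k x * tail (fun y => ccos k y * h y) x +
    k ^+ 2 * sin_div k x * tail (fun y => sin_div k y * h y) x.
Proof.
move=> iS ic.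
have i1 := cintegrableZ (ccos k x) (measurable_itv _) ic.
have i2 := cintegrableZ (k ^+ 2 * sin_div k x) (measurable_itv _) iS.
rewrite /tail -!cintegralZ// -cintegralD//.
by apply: cintegral_ext => y _; rewrite ccosB; ring.
Qed.

Lemma volterra_exp_split k h x :
  cintegrable `]x, +oo[ (fun y => sin_div k y * h y) ->
  cintegrable `]x, +oo[ (fun y => ccos k y * h y) ->
  tail (fun y => cexp (- ('i * k * y%:C)) * h y) x =
    tail (fun y => ccos k y * h y) x -
    'i * k * tail (fun y => sin_div k y * h y) x.
Proof.
move=> iS ic.
have i2 := cintegrableZ ('i * k) (measurable_itv _) iS.
rewrite /tail -!cintegralZ// -cintegralB//.
by apply: cintegral_ext => y _; rewrite cexp_Nik; ring.
Qed.

End KernelSplit.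

(** * Existence by Picard iteration, and the differential equation *)

Section JostExistence.
Context {R : realType}.
Variables (al be A : R) (U : R -> R) (k : R[i]).
Hypotheses (al0 : 0 < al) (albe : al < be / 2) (A0 : 0 < A).
Hypotheses (cU : continuous U).
Hypothesis hU : forall x, `|U x| <= A * expR (- (be * `|x|)).
Hypothesis hk : `|complex.Im k| <= al.
Implicit Types (f g : R -> R[i]) (x y N : R).
Local Notation w := (jweight al be A).
Local Notation C0 := (jker al).
Local Notation delta := (jgap al be).

Lemma jker_ccos_le x : cabs (ccos k x) <= C0 * expR (al * `|x|).
Proof.
apply: (le_trans (cabs_ccos_le x hk)); rewrite ler_peMl ?expR_ge0// lerDl.
by rewrite invr_ge0 ltW.
Qed.

Lemma jker_sin_div_le x : cabs (sin_div k x) <= C0 * expR (al * `|x|).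
Proof.
apply: (le_trans (cabs_sin_div_le x al0 hk)); rewrite ler_wpM2r ?expR_ge0//.
by rewrite lerDr.
Qed.

Lemma exp_decay_potential (g f : R -> R[i]) N :
  (forall y, cabs (g y) <= C0 * expR (al * `|y|)) ->
  (forall y, 0 <= y -> cabs (f y) <= N * w y) ->
  exp_decay (fun y => g y * ((U y)%:C * f y)).
Proof.
move=> hg hf; have c0 := jker_gt0 al0.
have N0 : 0 <= N.
  have := hf 0 (lexx _); move/(le_trans (cabs_ge0 _)).
  by rewrite pmulr_lge0// jweight_gt0.
apply: (@exp_decay_intro _ _ (C0 * A * N * expR (jexp al be A)) delta).
  exact: jgap_gt0.
move=> y y0; rewrite !cabsM cabs_real.
have h1 := hg y; have h2 := hU y; have h3 := hf y y0.
have h4 : cabs (f y) <= N * (expR (jexp al be A) * expR (al * y)).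
  by apply: (le_trans h3); rewrite ler_wpM2l// jweight_le.
rewrite (ger0_norm y0) in h1 h2.
apply: (le_trans (ler_pM _ _ h1 (ler_pM _ _ h2 h4))); rewrite ?mulr_ge0 ?cabs_ge0//.
set e := expR (jexp _ _ _).
have -> : C0 * expR (al * y) * (A * expR (- (be * y)) * (N * (e * expR (al * y)))) =
  C0 * A * N * e * (expR (al * y) * (expR (- (be * y)) * expR (al * y))) by ring.
rewrite -!expRD; apply: eq_ler; congr (_ * expR _); rewrite /jgap; ring.
Qed.

Definition volterra f x : R[i] :=
  cexp ('i * k * x%:C) + tail (fun y => sin_div k (y - x) * ((U y)%:C * f y)) x.

(** The derivative of [volterra f]: the kernel is differentiated in x, and the boundary term
    vanishes with [sin_div k 0]. *)
Definition volterra1 f x : R[i] :=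
  'i * k * cexp ('i * k * x%:C) - tail (fun y => ccos k (y - x) * ((U y)%:C * f y)) x.

Section Bounded.
Variables (f : R -> R[i]) (N : R).
Hypotheses (cf : ccont f) (hf : forall x, cabs (f x) <= N * w x).

Lemma ccont_potential_mul : ccont (fun y => (U y)%:C * f y).
Proof. by apply: ccontM => //; exact: ccont_real. Qed.

Lemma tail_integrable_sin : tail_integrable (fun y => sin_div k y * ((U y)%:C * f y)).
Proof.
apply: exp_decay_tail_integrable.
  by apply: ccontM; [exact: ccont_sin_div|exact: ccont_potential_mul].
by apply: (@exp_decay_potential _ _ N) => y; [exact: jker_sin_div_le|move=> _; exact: hf].
Qed.

Lemma tail_integrable_cos : tail_integrable (fun y => ccos k y * ((U y)%:C * f y)).
Proof.
apply: exp_decay_tail_integrable.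
  by apply: ccontM; [exact: ccont_ccos|exact: ccont_potential_mul].
by apply: (@exp_decay_potential _ _ N) => y; [exact: jker_ccos_le|move=> _; exact: hf].
Qed.

Lemma cder_volterra x : cder (volterra f) x (volterra1 f x).
Proof.
have hs := tail_integrable_sin; have hc := tail_integrable_cos.
have cS : ccont (fun y => sin_div k y * ((U y)%:C * f y)).
  by apply: ccontM; [exact: ccont_sin_div|exact: ccont_potential_mul].
have cC : ccont (fun y => ccos k y * ((U y)%:C * f y)).
  by apply: ccontM; [exact: ccont_ccos|exact: ccont_potential_mul].
have dS := tail_der x cS hs; have dC := tail_der x cC hc.
have vE : volterra f =1 fun x => cexp ('i * k * x%:C) +
   (ccos k x * tail (fun y => sin_div k y * ((U y)%:C * f y)) x -
    sin_div k x * tail (fun y => ccos k y * ((U y)%:C * f y)) x).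
  by move=> z; rewrite /volterra; have [_ ->] := volterra_sin_split (hs z) (hc z).
apply: (cder_ext (fun z => esym (vE z))).
apply: (cder_eq (cderD (cder_cexp_ik k x) (cderB (cderM (cder_ccos k x) dS)
  (cderM (cder_sin_div k x) dC)))).
by rewrite /volterra1 volterra_cos_split//; ring.
Qed.

Lemma cder_volterra1 x :
  cder (volterra1 f) x ((U x)%:C * f x - k ^+ 2 * volterra f x).
Proof.
have hs := tail_integrable_sin; have hc := tail_integrable_cos.
have cS : ccont (fun y => sin_div k y * ((U y)%:C * f y)).
  by apply: ccontM; [exact: ccont_sin_div|exact: ccont_potential_mul].
have cC : ccont (fun y => ccos k y * ((U y)%:C * f y)).
  by apply: ccontM; [exact: ccont_ccos|exact: ccont_potential_mul].
have dS := tail_der x cS hs; have dC := tail_der x cC hc.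
have vE : volterra1 f =1 fun x => 'i * k * cexp ('i * k * x%:C) -
   (ccos k x * tail (fun y => ccos k y * ((U y)%:C * f y)) x +
    k ^+ 2 * (sin_div k x * tail (fun y => sin_div k y * ((U y)%:C * f y)) x)).
  by move=> z; rewrite /volterra1 volterra_cos_split// mulrA.
apply: (cder_ext (fun z => esym (vE z))).
apply: (cder_eq (cderB (cderZ _ (cder_cexp_ik k x)) (cderD (cderM (cder_ccos k x) dC)
  (cderZ _ (cderM (cder_sin_div k x) dS))))).
rewrite /volterra; have [_ ->] := volterra_sin_split (hs x) (hc x).
move: (tail _ _) (tail _ _) => a b.
have cs := ccos_sqr k x; move: (cexp _) => e.
transitivity ((U x)%:C * f x * (ccos k x ^+ 2 + k ^+ 2 * sin_div k x ^+ 2)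
  - k ^+ 2 * (e + (ccos k x * a - sin_div k x * b))
  + (1 + 'i * 'i) * k ^+ 2 * e); first by ring.
by rewrite cs i_sqr; ring.
Qed.

End Bounded.

Lemma volterra_contraction f N x : ccont f -> 0 <= N ->
  (forall y, cabs (f y) <= N * w y) ->
  cabs (tail (fun y => sin_div k (y - x) * ((U y)%:C * f y)) x) <= N * 2^-1 * w x /\
  cabs (tail (fun y => ccos k (y - x) * ((U y)%:C * f y)) x) <= N * 2^-1 * w x.
Proof.
move=> cf N0 hf.
have E2 : 2^-1 = A / (2 * A) by field; rewrite gt_eqF.
have cshift (g : R -> R[i]) : ccont g -> ccont (fun y => g (y - x)).
  move=> cg; apply: (ccont_comp (phi := fun y => y - x)) => // y.
  by apply: cvgB; [exact: cvg_id|exact: cvg_cst].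
have K (g : R -> R[i]) : ccont g -> (forall y, cabs (g y) <= C0 * expR (al * `|y|)) ->
  cabs (tail (fun y => g (y - x) * ((U y)%:C * f y)) x) <= N * 2^-1 * w x.
  move=> cg hg; rewrite E2; have [||//] := @volterra_bound R al be al0 albe A A N
    (fun y => g (y - x) * ((U y)%:C * f y)) x A0 (ltW A0) N0.
  - apply: ccont_cmeasurable_on => //; apply: ccontM; first exact: cshift.
    by apply: ccontM => //; exact: ccont_real.
  - apply: ae_all => y xy; rewrite !cabsM cabs_real mulrA.
    have h := hg (y - x); rewrite [`|y - x|]ger0_norm in h; last first.
      by rewrite subr_ge0 ltW.
    by apply: ler_pM; rewrite ?mulr_ge0 ?cabs_ge0//; apply: ler_pM; rewrite ?cabs_ge0.
by split; apply: K; [exact: ccont_sin_div|exact: jker_sin_div_le|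
  exact: ccont_ccos|exact: jker_ccos_le].
Qed.

Lemma volterraB f g x : ccont f -> ccont g ->
  (exists N, forall y, cabs (f y) <= N * w y) ->
  (exists N, forall y, cabs (g y) <= N * w y) ->
  volterra f x - volterra g x =
  tail (fun y => sin_div k (y - x) * ((U y)%:C * (f y - g y))) x.
Proof.
move=> cf cg [N hf] [M hg].
have [i1 _] := volterra_sin_split (tail_integrable_sin cf hf x) (tail_integrable_cos cf hf x).
have [i2 _] := volterra_sin_split (tail_integrable_sin cg hg x) (tail_integrable_cos cg hg x).
rewrite /volterra opprD addrACA subrr add0r /tail -cintegralB//.
by apply: cintegral_ext => y _; ring.
Qed.

Fixpoint picard n : R -> R[i] :=
  if n is m.+1 then volterra (picard m) else fun=> 0.

Lemma cabs_cexp_ik_weight x : cabs (cexp ('i * k * x%:C)) <= w x.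
Proof.
by apply: (le_trans (cabs_cexp_ik_le x hk)); apply: expR_le_jweight.
Qed.

(** The constant 2 is the fixed point of N -> 1 + N / 2: the exponential contributes 1, the
    contraction half of N. *)
Lemma picard_bounds n : ccont (picard n) /\ forall x, cabs (picard n x) <= 2 * w x.
Proof.
elim: n => [|n [cn hn]].
  split; first exact: ccont_cst.
  by move=> x; rewrite /= cabs0 mulr_ge0// ltW// jweight_gt0.
rewrite -[picard n.+1]/(volterra (picard n)).
split; first exact: cder_ccont (cder_volterra cn hn).
move=> x; have [h _] := volterra_contraction x cn (ler0n _ 2) hn.
rewrite /volterra (le_trans (cabsD _ _))// mulr2n mulrDl mul1r.
rewrite lerD ?cabs_cexp_ik_weight//.
by apply: (le_trans h); rewrite mulfV ?mul1r// pnatr_eq0.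
Qed.

Lemma picard_step n x : cabs (picard n.+1 x - picard n x) <= w x * 2^-1 ^+ n.
Proof.
elim: n x => [|n IH] x.
  rewrite /= subr0 expr0 mulr1 /volterra.
  rewrite (tail_ext (G := fun=> 0)); last by move=> y; rewrite !mulr0.
  by rewrite /tail cintegral0 addr0 cabs_cexp_ik_weight.
have [c1 h1] := picard_bounds n; have [c2 h2] := picard_bounds n.+1.
rewrite -[picard n.+2]/(volterra (picard n.+1)) -[in X in _ - X]/(volterra (picard n)).
rewrite volterraB//; try by exists 2.
have [|||h _] := @volterra_contraction (fun y => picard n.+1 y - picard n y) (2^-1 ^+ n) x.
- exact: ccontB.
- by rewrite exprn_ge0// invr_ge0.
- by move=> y; rewrite mulrC.
by apply: (le_trans h); rewrite exprSr mulrC.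
Qed.

Lemma jost_existence : exists f f1 : R -> R[i],
  [/\ is_jost_plus U k f,
      forall x, cder f x (f1 x),
      forall x, cder f1 x (((U x)%:C - k ^+ 2) * f x),
      forall x, cabs (f x) <= 4 * w x &
      f1 =1 volterra1 f /\ f =1 volterra f].
Proof.
have /choice[f hf] : forall x, exists l, forall n,
    cabs (l - picard n x) <= 4 * w x * 2^-1 ^+ n.
  by move=> x; apply: cgeometric_limit => n; exact: picard_step.
have cf : ccont f.
  apply: (@ccont_half_approx R picard f (fun x => 4 * w x)).
  - by move=> n; have [] := picard_bounds n.
  - move=> x; apply: cvgM; [exact: cvg_cst|exact: continuous_jweight].
  - by move=> n x; rewrite mulrC.
(* [picard 0] is zero, so the case n = 0 of the rate of convergence bounds f itself. *)
have f4 x : cabs (f x) <= 4 * w x.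
  by have := hf x 0%N; rewrite /= subr0 expr0 mulr1.
have fE x : f x = volterra f x.
  apply/eqP; rewrite -subr_eq0 -cabs_eq0 eq_le cabs_ge0 andbT.
  apply: (@cvg_half_pow _ _ (4 * w x)) => n.
  have [cn hn] := picard_bounds n.
  have -> : f x - volterra f x = (f x - picard n.+1 x) - (volterra f x - picard n.+1 x).
    by ring.
  apply: (le_trans (cabsB _ _)).
  rewrite [X in _ + cabs (_ - X)]/(volterra (picard n) x) volterraB//; [|by exists 4|by exists 2].
  have [|||h _] := @volterra_contraction (fun y => f y - picard n y) (4 * 2^-1 ^+ n) x.
  - exact: ccontB.
  - by rewrite mulr_ge0// exprn_ge0// invr_ge0.
  - by move=> y; rewrite (le_trans (hf y n))//; apply: eq_ler; ring.
  apply: (le_trans (lerD (hf x n.+1) h)); rewrite exprS; apply: eq_ler.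
  by move: (2^-1 ^+ n) => p; field.
have fv : volterra f = f by apply/funext => x; rewrite -fE.
exists f, (volterra1 f); split => //.
- move=> x F; have [i1 _] := volterra_sin_split (tail_integrable_sin cf f4 x)
    (tail_integrable_cos cf f4 x).
  have FE y : F y = sin_div k (y - x) * ((U y)%:C * f y) by rewrite /F mulrA.
  split; first by apply: (cintegrable_ext (measurable_itv _) _ i1) => y _; rewrite FE.
  rewrite fE /volterra; congr (_ + _); apply: cintegral_ext => y _; by rewrite FE.
- by move=> x; rewrite -{1}fv; exact: cder_volterra f4 x.
- move=> x; apply: (cder_eq (cder_volterra1 cf f4 x)); rewrite -fE; ring.
Qed.

End JostExistence.

(** * Uniqueness without growth assumptions, null sets and reflection *)

Section JostUniqueness.
Context {R : realType}.
Notation mu := (@lebesgue_measure R).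
Implicit Types (k : R[i]) (f g F : R -> R[i]) (U V : R -> R) (x y X : R).

Lemma Rtail_bounded (h : R -> R) X : mu.-integrable `]X, +oo[ (EFin \o h) ->
  exists M, forall x, X <= x -> `|Rintegral mu `]x, +oo[ h| <= M.
Proof.
move=> ih; exists (Rintegral mu `]X, +oo[ (fun y => `|h y|)) => x Xx.
have sub : `]x, +oo[%classic `<=` `]X, +oo[%classic.
  by move=> y /=; rewrite !in_itv /= !andbT; exact: le_lt_trans.
have ix : mu.-integrable `]x, +oo[ (EFin \o h).
  by apply: (@integrableS _ _ _ mu `]X, +oo[).
apply: (le_trans (le_normr_Rintegral _ ix)) => //.
have ihn := integrable_norm ih; have ixn := integrable_norm ix.
rewrite /Rintegral fine_le//.
- exact: integrable_fin_num ixn.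
- exact: integrable_fin_num ihn.
- apply: ge0_subset_integral => //; exact: (measurable_int mu).
Qed.

Lemma tail_bounded F X : cintegrable `]X, +oo[ F ->
  exists M, forall x, X <= x -> cabs (tail F x) <= M.
Proof.
move=> [h1 h2]; have [a ha] := Rtail_bounded h1; have [b hb] := Rtail_bounded h2.
exists (a + b) => x Xx; apply: (le_trans (cabs_le_ReIm _)).
by rewrite lerD ?ha ?hb.
Qed.

(** Otherwise the derivative at 0, which is [ccos k 0 = 1], would vanish. *)
Lemma sin_div_nonzero k : exists2 h, 0 < h & sin_div k h != 0.
Proof.
apply: contrapT => H.
have s0 h : sin_div k h = 0.
  have [->|h0] := eqVneq h 0; first exact: sin_div_at0.
  apply: contrapT => /eqP sh; apply: H; exists `|h|; rewrite ?normr_gt0//.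
  case: (leP 0 h) => hh; first by rewrite ger0_norm.
  by rewrite ltr0_norm// sin_divN oppr_eq0.
have d1 : cder (sin_div k) 0 0.
  by apply: (cder_ext (f := fun=> 0)) (cder_cst 0 0) => h; rewrite s0.
have := cder_cderive d1; rewrite (cder_cderive (cder_sin_div k 0)) ccos_at0.
by move/eqP; rewrite oner_eq0.
Qed.

(** A solution is only known to make the integrands with kernel [sin_div k (y - x)] integrable. The
    base points [X] and [X - h] give a linear system for the two components, with determinant
    [sin_div k h]. *)
Lemma kernel_components k F X :
  (forall x, cintegrable `]x, +oo[ (fun y => sin_div k (y - x) * F y)) ->
  cintegrable `]X, +oo[ (fun y => sin_div k y * F y) /\
  cintegrable `]X, +oo[ (fun y => ccos k y * F y).
Proof.
move=> hF; have [h h0 sh] := sin_div_nonzero k.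
have m := @measurable_itv R `]X, +oo[.
have i1 : cintegrable `]X, +oo[ (fun y => sin_div k (y - (X - h)) * F y).
  by apply: tail_integrable_sub (hF (X - h)); rewrite gerBl ltW.
have i2 := hF X.
have dE : sin_div k X * ccos k (X - h) - ccos k X * sin_div k (X - h) = sin_div k h.
  by rewrite -sin_divB opprB addrC subrK.
split.
- have := cintegrableB m
    (cintegrableZ (sin_div k X / sin_div k h) m i1)
    (cintegrableZ (sin_div k (X - h) / sin_div k h) m i2).
  apply: (cintegrable_ext m) => y _; rewrite [sin_div k (y - _)]sin_divB sin_divB.
  rewrite -dE in sh *.
  move: sh; move: (sin_div k X) (ccos k X) (sin_div k (X - h)) (ccos k (X - h)) => a b c d sh.
  by field.
- have := cintegrableB m
    (cintegrableZ (ccos k X / sin_div k h) m i1)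
    (cintegrableZ (ccos k (X - h) / sin_div k h) m i2).
  apply: (cintegrable_ext m) => y _; rewrite [sin_div k (y - _)]sin_divB sin_divB.
  rewrite -dE in sh *.
  move: sh; move: (sin_div k X) (ccos k X) (sin_div k (X - h)) (ccos k (X - h)) => a b c d sh.
  by field.
Qed.

(** No bound on f or g is assumed. Splitting the kernel writes their difference on [x0, oo[ as
    bounded tails times [ccos] and [sin_div], which is a first bound by the weight; iterating the
    contraction then halves it indefinitely. *)
Lemma is_jost_plus_unique (al be A : R) U k f g :
  0 < al -> al < be / 2 -> 0 < A -> `|complex.Im k| <= al ->
  {ae mu, forall y, `|U y| <= A * expR (- (be * `|y|))} ->
  is_jost_plus U k f -> is_jost_plus U k g -> f = g.
Proof.
move=> al0 albe A0 hk hU jf jg; apply/funext => x0.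
pose F y := (U y)%:C * (f y - g y).
have c0 := jker_gt0 al0.
have iF x : cintegrable `]x, +oo[ (fun y => sin_div k (y - x) * F y).
  have [i1 _] := jf x; have [i2 _] := jg x.
  by apply: (cintegrable_ext (measurable_itv _) _
    (cintegrableB (measurable_itv _) i1 i2)) => y _; rewrite /F; ring.
have DE x : f x - g x = tail (fun y => sin_div k (y - x) * F y) x.
  have [i1 e1] := jf x; have [i2 e2] := jg x.
  rewrite e1 e2 opprD addrACA subrr add0r -cintegralB//.
  by apply: cintegral_ext => y _; rewrite /F; ring.
have [is0 ic0] := kernel_components x0 iF.
have [a ha] := tail_bounded is0; have [b hb] := tail_bounded ic0.
have a0 : 0 <= a by apply: le_trans (ha x0 (lexx _)); exact: cabs_ge0.
have b0 : 0 <= b by apply: le_trans (hb x0 (lexx _)); exact: cabs_ge0.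
pose N := jker al * (a + b).
have N0 : 0 <= N by apply: mulr_ge0; [exact: ltW|exact: addr_ge0].
have bnd n x : x0 <= x -> cabs (f x - g x) <= N * 2^-1 ^+ n * jweight al be A x.
  elim: n x => [|n IH] x xx.
    rewrite expr0 mulr1 DE.
    have [isx icx] := kernel_components x iF.
    have [_ ->] := volterra_sin_split isx icx.
    apply: (le_trans (cabsB _ _)).
    rewrite (cabsM (ccos k x)) (cabsM (sin_div k x)) /N.
    apply: (@le_trans _ _ (jker al * (a + b) * expR (al * `|x|))); last first.
      by rewrite ler_wpM2l// expR_le_jweight.
    rewrite mulrDr mulrDl ![jker al * _ * expR _]mulrAC.
    apply: lerD; apply: ler_pM; try exact: cabs_ge0.
    - exact: jker_ccos_le.
    - exact: ha.
    - exact: jker_sin_div_le.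
    - exact: hb.
  have -> : N * 2^-1 ^+ n.+1 = N * 2^-1 ^+ n * (A / (2 * A)).
    by rewrite exprSr; field; rewrite gt_eqF.
  rewrite DE.
  have [|||//] := @volterra_bound R al be al0 albe A A (N * 2^-1 ^+ n)
    (fun y => sin_div k (y - x) * F y) x A0 (ltW A0).
  - by rewrite mulr_ge0// exprn_ge0// invr_ge0.
  - exact: cintegrable_measurable (iF x).
  - apply: (ae_imp hU) => y hy xy; rewrite /F !cabsM cabs_real mulrA.
    have h := jker_sin_div_le al0 hk (y - x); rewrite [`|y - x|]ger0_norm in h; last first.
      by rewrite subr_ge0 ltW.
    apply: ler_pM; rewrite ?mulr_ge0 ?cabs_ge0//; first by apply: ler_pM; rewrite ?cabs_ge0.
    by apply: IH; rewrite (le_trans xx)// ltW.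
apply/eqP; rewrite -subr_eq0 -cabs_eq0 eq_le cabs_ge0 andbT.
apply: (@cvg_half_pow _ _ (N * jweight al be A x0)) => n.
by rewrite mulrAC; exact: bnd.
Qed.

Lemma cintegral_ae_eq (D : set R) F G : measurable D ->
  cintegrable D F -> cmeasurable_on D G ->
  {ae mu, forall y, F y = G y} ->
  cintegrable D G /\ cintegral D F = cintegral D G.
Proof.
move=> mD [i1 i2] [m1 m2] FG.
have K (a b : R -> R) : mu.-integrable D (EFin \o a) -> measurable_fun D b ->
    {ae mu, forall y, a y = b y} ->
    mu.-integrable D (EFin \o b) /\ Rintegral mu D a = Rintegral mu D b.
  move=> ia mb ab; split.
    apply: (ae_le_integrable mD mb (integrable_norm ia)).
    by apply: (ae_imp ab) => y /= ->.
  rewrite /Rintegral; congr fine; apply: ae_eq_integral => //.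
  - exact: (measurable_int mu).
  - exact/measurable_EFinP.
  - by apply: (ae_imp ab) => y /= -> _.
have [|i3 e1] := K _ _ i1 m1; first by apply: (ae_imp FG) => y ->.
have [|i4 e2] := K _ _ i2 m2; first by apply: (ae_imp FG) => y ->.
by split => //; rewrite /cintegral e1 e2.
Qed.

Lemma cmeasurable_onM (D : set R) F G : cmeasurable_on D F -> cmeasurable_on D G ->
  cmeasurable_on D (fun y => F y * G y).
Proof.
move=> [f1 f2] [g1 g2]; split; under eq_fun do rewrite !ReImE.
- by apply: measurable_funB; apply: measurable_funM.
- by apply: measurable_funD; apply: measurable_funM.
Qed.

(** Integrals ignore null sets, so the equation passes to U at every x, with the same f. *)
Lemma is_jost_plus_ae U V k f : measurable_fun setT U ->
  {ae mu, forall y, V y = U y} -> ccont f ->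
  is_jost_plus V k f -> is_jost_plus U k f.
Proof.
move=> mU VU cf jf x F; have [i1 e1] := jf x.
have m := @measurable_itv R `]x, +oo[.
have [||i2 <-] := cintegral_ae_eq m i1 (G := F) => //.
- apply: cmeasurable_onM; last exact: ccont_cmeasurable_on.
  apply: cmeasurable_onM.
    apply: ccont_cmeasurable_on => //.
    apply: (ccont_comp (phi := fun y => y - x)); last exact: ccont_sin_div.
    by move=> y; apply: cvgB; [exact: cvg_id|exact: cvg_cst].
  by split => /=; [apply: measurable_funTS|exact: measurable_cst].
- by apply: (ae_imp VU) => y; rewrite /F => ->.
Qed.

Lemma is_jost_plus_reflect U k f :
  is_jost_plus U k f -> is_jost_minus (fun y => U (- y)) k (fun y => f (- y)).
Proof.
move=> jf x F; have [i1 e1] := jf (- x).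
have [i2 e2] := cintegral_reflect (measurable_itv _) i1.
have rE : reflect `]- x, +oo[ = `]-oo, x[%classic.
  by apply/seteqP; split => y; rewrite /reflect /= !in_itv /= !andbT ltrN2.
rewrite rE in i2 e2; have m := @measurable_itv R `]-oo, x[.
have FE y : F y = - (sin_div k (- y - - x) * (U (- y))%:C * f (- y)).
  by rewrite /F -opprD sin_divN !mulNr opprK.
split.
  by apply: (cintegrable_ext m _ (cintegrableN m i2)) => y _; rewrite FE.
have E : cintegral `]-oo, x[ F =
    - cintegral `]-oo, x[ (fun y => sin_div k (- y - - x) * (U (- y))%:C * f (- y)).
  by rewrite -cintegralN//; apply: cintegral_ext => y _; rewrite FE.
by rewrite e1 e2 E rmorphN mulrN; congr (_ + _); rewrite [RHS]opprK.
Qed.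

Lemma is_jost_minus_reflect U k f :
  is_jost_minus U k f -> is_jost_plus (fun y => U (- y)) k (fun y => f (- y)).
Proof.
move=> jf x F; have [i1 e1] := jf (- x).
have [i2 e2] := cintegral_reflect (measurable_itv _) i1.
have rE : reflect `]-oo, - x[ = `]x, +oo[%classic.
  by apply/seteqP; split => y; rewrite /reflect /= !in_itv /= !andbT ltrN2.
rewrite rE in i2 e2; have m := @measurable_itv R `]x, +oo[.
have FE y : F y = - (sin_div k (- y - - x) * (U (- y))%:C * f (- y)).
  by rewrite /F -opprD sin_divN !mulNr opprK.
split.
  by apply: (cintegrable_ext m _ (cintegrableN m i2)) => y _; rewrite FE.
have E : cintegral `]x, +oo[ F =
    - cintegral `]x, +oo[ (fun y => sin_div k (- y - - x) * (U (- y))%:C * f (- y)).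
  by rewrite -cintegralN//; apply: cintegral_ext => y _; rewrite FE.
rewrite e1 e2 E rmorphN mulrN; congr (cexp _ + _); exact: opprK.
Qed.

End JostUniqueness.

(** * Expansion on a half-line *)

Section Growth.
Context {R : realType}.
Implicit Types (F G : R -> R[i]) (a b x y : R).

(** Tracks exponents only. It justifies the integrations by parts, while the bounds with explicit
    constants are proved separately. *)
Definition growth a F : Prop := exists M,
  forall y, 0 <= y -> cabs (F y) <= M * expR (a * y).

Lemma growthM a b F G : growth a F -> growth b G -> growth (a + b) (fun y => F y * G y).
Proof.
move=> [M hM] [N hN]; exists (M * N) => y y0.
rewrite cabsM mulrDl expRD mulrACA.
by apply: ler_pM; rewrite ?cabs_ge0 ?hM ?hN.
Qed.

Lemma growthD a F G : growth a F -> growth a G -> growth a (fun y => F y + G y).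
Proof.
move=> [M hM] [N hN]; exists (M + N) => y y0.
by rewrite (le_trans (cabsD _ _))// mulrDl lerD ?hM ?hN.
Qed.

Lemma growthN a F : growth a F -> growth a (fun y => - F y).
Proof. by move=> [M hM]; exists M => y y0; rewrite cabsN hM. Qed.

Lemma growthB a F G : growth a F -> growth a G -> growth a (fun y => F y - G y).
Proof. by move=> ? ?; apply: growthD => //; apply: growthN. Qed.

Lemma growthZ a F (z : R[i]) : growth a F -> growth a (fun y => z * F y).
Proof.
move=> [M hM]; exists (cabs z * M) => y y0.
by rewrite cabsM -mulrA ler_wpM2l ?cabs_ge0 ?hM.
Qed.

Lemma growthW a b F : a <= b -> growth a F -> growth b F.
Proof.
move=> ab [M hM]; exists M => y y0.
have M0 : 0 <= M.
  by have := le_trans (cabs_ge0 _) (hM 0 (lexx _)); rewrite mulr0 expR0 mulr1.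
by rewrite (le_trans (hM y y0))// ler_wpM2l// ler_expR ler_wpM2r.
Qed.

Lemma growth_exp_decay a F : a < 0 -> growth a F -> exp_decay F.
Proof.
move=> a0 [M hM]; apply: (@exp_decay_intro _ _ M (- a)); first by rewrite oppr_gt0.
by move=> y y0; rewrite mulNr opprK hM.
Qed.

End Growth.

Section HalfLine.
Context {R : realType}.
Variables (al be A K0 c eps : R) (V : R -> R) (k : R[i]) (f f1 : R -> R[i]).
Hypotheses (al0 : 0 < al) (albe : al < be / 2) (A0 : 0 < A) (K00 : 0 <= K0).
Hypotheses (cV : continuous V).
Hypothesis hV : forall x, `|V x| <= A * expR (- (be * `|x|)).
Hypothesis hk : `|complex.Im k| <= al.
Hypothesis hkK : cabs k <= K0.
Hypothesis df : forall x, cder f x (f1 x).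
Hypothesis df1 : forall x, cder f1 x (((V x)%:C - k ^+ 2) * f x).
Hypothesis hf : forall x, cabs (f x) <= 4 * jweight al be A x.
Hypothesis f1E : f1 =1 volterra1 V k f.
Hypothesis fE : f =1 volterra V k f.
Implicit Types (x y : R).
Local Notation C0 := (jker al).
Local Notation delta := (jgap al be).

Let Vc y : R[i] := (V y)%:C.
Let e y : R[i] := cexp (- ('i * k * y%:C)).

(** One constant for both functions: f needs the factor 4 and f1 the factor [K0 + 2], the 2 being
    half of that 4. *)
Definition jconst : R := (6 + K0) * expR (jexp al be A).

Lemma jconst_ge0 : 0 <= jconst.
Proof. by rewrite mulr_ge0 ?expR_ge0// addr_ge0. Qed.

Lemma hl_f_le x : 0 <= x -> cabs (f x) <= jconst * expR (al * x).
Proof.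
move=> x0; apply: (le_trans (hf x)).
apply: (le_trans (ler_wpM2l _ (jweight_le al0 albe A0 x0))) => //.
rewrite mulrA ler_wpM2r ?expR_ge0// ler_wpM2r ?expR_ge0//.
by move: K00; lra.
Qed.

Lemma hl_cf : ccont f.
Proof. exact: cder_ccont df. Qed.

Lemma hl_cf1 : ccont f1.
Proof. exact: cder_ccont df1. Qed.

Lemma hl_f1_le x : 0 <= x -> cabs (f1 x) <= jconst * expR (al * x).
Proof.
move=> x0; rewrite f1E /volterra1.
have [_ h] := volterra_contraction al0 albe A0 cV hV hk x hl_cf (ler0n _ 4) hf.
apply: (le_trans (cabsB _ _)); rewrite cabsM cabsM cabs_i mul1r.
have hw := jweight_le al0 albe A0 x0.
have he := cabs_cexp_ik_weight al0 albe A0 hk x.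
have w0 := ltW (jweight_gt0 al be A x).
apply: (@le_trans _ _ ((6 + K0) * jweight al be A x)).
  apply: (@le_trans _ _ (K0 * jweight al be A x + 2 * jweight al be A x)).
    apply: lerD; first by apply: ler_pM; rewrite ?cabs_ge0.
    by apply: (le_trans h); rewrite ler_wpM2r//; lra.
  by rewrite -mulrDl ler_wpM2r//; lra.
rewrite /jconst -mulrA ler_wpM2l//; first by rewrite addr_ge0.
Qed.

Lemma hl_V_le x : 0 <= x -> cabs (Vc x) <= A * expR (- (be * x)).
Proof. by move=> x0; rewrite cabs_real; have := hV x; rewrite (ger0_norm x0). Qed.

Lemma hl_e_le x : 0 <= x -> cabs (e x) <= expR (al * x).
Proof. by move=> x0; have := cabs_cexp_Nik_le x hk; rewrite (ger0_norm x0). Qed.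

Lemma hl_be_gt0 : 0 < be.
Proof. by move: al0 albe; lra. Qed.

Lemma hl_exp_le1 x : 0 <= x -> expR (- (be * x)) <= 1.
Proof.
move=> x0; rewrite -expR0 ler_expR oppr_le0 mulr_ge0//; exact: ltW hl_be_gt0.
Qed.

Lemma ccont_e : ccont e.
Proof. exact: cder_ccont (fun x => cder_cexp_Nik k x). Qed.

Lemma ccont_Vc : ccont Vc.
Proof. exact: ccont_real. Qed.

Lemma growth_f : growth al f.
Proof. by exists jconst => y; exact: hl_f_le. Qed.

Lemma growth_f1 : growth al f1.
Proof. by exists jconst => y; exact: hl_f1_le. Qed.

Lemma growth_e : growth al e.
Proof. by exists 1 => y y0; rewrite mul1r hl_e_le. Qed.

Lemma growth_Vc : growth (- be) Vc.
Proof. by exists A => y y0; rewrite mulNr hl_V_le. Qed.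

Lemma growth_shift (g : R -> R[i]) x :
  (forall y, cabs (g y) <= C0 * expR (al * `|y|)) -> growth al (fun y => g (y - x)).
Proof.
move=> hg; exists (C0 * expR (al * `|x|)) => y y0.
apply: (le_trans (hg _)); rewrite -mulrA ler_wpM2l// ?(ltW (jker_gt0 al0))//.
rewrite -expRD ler_expR -mulrDr; apply: ler_wpM2l; first exact: ltW.
by rewrite (le_trans (ler_normB _ _))// addrC (ger0_norm y0).
Qed.

Lemma hl_exp_decay : tail_integrable (fun y => sin_div k y * (Vc y * f y)) /\
  tail_integrable (fun y => ccos k y * (Vc y * f y)).
Proof.
split.
- exact: (tail_integrable_sin al0 albe A0 cV hV hk hl_cf hf).
- exact: (tail_integrable_cos al0 albe A0 cV hV hk hl_cf hf).
Qed.

(** In the combination f' + i k f the kernels [ccos] and [sin_div] merge into the single exponential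
    exp(- i k y). *)
Lemma hl_E : f1 0 + 'i * k * f 0 = 2 * 'i * k - tail (fun y => Vc y * (e y * f y)) 0.
Proof.
have [iS ic] := hl_exp_decay.
rewrite f1E fE /volterra1 /volterra mulr0 cexp0 mulr1.
have -> : tail (fun y => Vc y * (e y * f y)) 0 =
   tail (fun y => cexp (- ('i * k * y%:C)) * (Vc y * f y)) 0.
  by apply: tail_ext => y; rewrite /e; ring.
rewrite volterra_exp_split//.
have -> : tail (fun y => ccos k (y - 0) * (Vc y * f y)) 0 =
  tail (fun y => ccos k y * (Vc y * f y)) 0 by apply: tail_ext => y; rewrite subr0.
have -> : tail (fun y => sin_div k (y - 0) * (Vc y * f y)) 0 =
  tail (fun y => sin_div k y * (Vc y * f y)) 0 by apply: tail_ext => y; rewrite subr0.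
ring.
Qed.

(** * Potentials with small iterated tails *)

Section Oscillation.
Hypotheses (c0 : 0 <= c) (eps0 : 0 < eps) (eps1 : eps <= 1).
Let T1 := tail Vc.
Let T2 := tail T1.
Let T3 := tail T2.
Hypothesis hT1 : forall y, 0 <= y -> cabs (T1 y) <= c * eps * expR (- (be * y)).
Hypothesis hT2 : forall y, 0 <= y -> cabs (T2 y) <= c * eps ^+ 2 * expR (- (be * y)).
Hypothesis hT3 : forall y, 0 <= y -> cabs (T3 y) <= c * eps ^+ 3 * expR (- (be * y)).

Let growth_decay (F : R -> R[i]) M :
  (forall y, 0 <= y -> cabs (F y) <= M * expR (- (be * y))) -> growth (- be) F.
Proof. by move=> h; exists M => y y0; rewrite mulNr h. Qed.

Let gT1 : growth (- be) T1 := growth_decay hT1.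
Let gT2 : growth (- be) T2 := growth_decay hT2.
Let gT3 : growth (- be) T3 := growth_decay hT3.

Let be_lt0 : - be < 0.
Proof. by rewrite oppr_lt0 hl_be_gt0. Qed.

Let al2be : - be + (al + al) < 0.
Proof. by move: albe; lra. Qed.

Let dT1 x : cder T1 x (- Vc x).
Proof.
apply: tail_der; first exact: ccont_Vc.
by apply: (exp_decay_tail_integrable ccont_Vc); exact: growth_exp_decay be_lt0 growth_Vc.
Qed.

Let cT1 : ccont T1 := cder_ccont dT1.

Let dT2 x : cder T2 x (- T1 x).
Proof.
by apply: tail_der => //; apply: (exp_decay_tail_integrable cT1); exact: growth_exp_decay be_lt0 gT1.
Qed.

Let cT2 : ccont T2 := cder_ccont dT2.

Let dT3 x : cder T3 x (- T2 x).
Proof.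
by apply: tail_der => //; apply: (exp_decay_tail_integrable cT2); exact: growth_exp_decay be_lt0 gT2.
Qed.

(** Each use replaces S by its tail T, one order smaller in eps, at the cost of a derivative of
    g. *)
Let ibp (T S : R -> R[i]) (g dg : R -> R[i]) x :
  (forall y, cder T y (- S y)) -> ccont S -> growth (- be) T -> growth (- be) S ->
  (forall y, cder g y (dg y)) -> ccont dg -> growth (al + al) g -> growth (al + al) dg ->
  tail (fun y => S y * g y) x = T x * g x + tail (fun y => T y * dg y) x.
Proof.
move=> hT cS gT gS hg cdg gg gdg.
have cT := cder_ccont hT; have cg := cder_ccont hg.
have := @tail_by_parts R (fun y => - T y) S g dg x.
rewrite mulNr opprK => ->//.
- congr (_ + _); rewrite -tailN; first by apply: tail_ext => y; rewrite mulNr opprK.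
  apply: exp_decay_tail_integrable; first by apply: ccontM => //; exact: ccontN.
  by apply: (growth_exp_decay al2be); apply: growthM => //; exact: growthN.
- by move=> y; apply: (cder_eq (cderN (hT y))); rewrite opprK.
- by apply: (growth_exp_decay al2be); apply: growthM => //; exact: growthN.
- by apply: (growth_exp_decay al2be); exact: growthM.
- by apply: (growth_exp_decay al2be); apply: growthM => //; exact: growthN.
Qed.

(** The 1 comes from the boundary term with [T2 x * f x]; the rest bounds the integral of T2 against
    the second derivative of kernel times solution. *)
Definition hlD : R := c * jconst * (1 + C0 * (2 * K0 ^+ 2 + 2 + A) / delta).

(** The kernel vanishes on the diagonal, so the boundary term with T1 drops out. The first one that
    survives carries T2, which is of order eps^2. *)
Lemma hl_f_exp x : 0 <= x ->
  cabs (f x - cexp ('i * k * x%:C)) <= hlD * eps ^+ 2 * expR (al * x).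
Proof.
move=> x0; pose s y := sin_div k (y - x); pose co y := ccos k (y - x).
have dshift (y : R) : is_derive y (1 : R) (fun z => z - x) 1.
  by have := is_deriveB (is_derive_id y (1 : R)) (is_derive_cst x y (1 : R)); rewrite subr0.
have ds y : cder s y (co y).
  by apply: (cder_eq (cder_comp (dshift y) (cder_sin_div k (y - x)))); rewrite mul1r.
have dco y : cder co y (- k ^+ 2 * s y).
  by apply: (cder_eq (cder_comp (dshift y) (cder_ccos k (y - x)))); rewrite mul1r.
have gs : growth al s by apply: growth_shift; exact: jker_sin_div_le.
have gco : growth al co by apply: growth_shift; exact: jker_ccos_le.
pose g y := s y * f y.
pose dg y := co y * f y + s y * f1 y.
pose ddg y := (- k ^+ 2 * s y * f y + co y * f1 y) +
  (co y * f1 y + s y * (((V y)%:C - k ^+ 2) * f y)).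
have hg y : cder g y (dg y) by apply: cderM.
have hdg y : cder dg y (ddg y) by apply: cderD; apply: cderM.
have cdg : ccont dg by exact: cder_ccont hdg.
have cs := cder_ccont ds; have cco := cder_ccont dco.
have cddg : ccont ddg.
  have c1 := hl_cf; have c2 := hl_cf1; have c3 := ccont_Vc.
  have h1 := ccontM (ccontM (ccont_cst (- k ^+ 2)) cs) c1.
  have h2 := ccontM cco c2.
  have h3 := ccontM cs (ccontM (ccontB c3 (ccont_cst (k ^+ 2))) c1).
  exact: (ccontD (ccontD h1 h2) (ccontD h2 h3)).
have gVf : growth al (fun y => ((V y)%:C - k ^+ 2) * f y).
  apply: (@growthW _ (0 + al)); first by rewrite add0r.
  apply: growthM growth_f; apply: growthB; first exact: growthW (ltW be_lt0) growth_Vc.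
  by exists (cabs (k ^+ 2)) => y _; rewrite mul0r expR0 mulr1.
have gg : growth (al + al) g by exact: growthM gs growth_f.
have gdg : growth (al + al) dg.
  by apply: growthD; [exact: growthM gco growth_f|exact: growthM gs growth_f1].
have gddg : growth (al + al) ddg.
  apply: growthD; apply: growthD.
  - by apply: growthM growth_f; exact: growthZ.
  - exact: growthM gco growth_f1.
  - exact: growthM gco growth_f1.
  - exact: growthM gs gVf.
have -> : f x - cexp ('i * k * x%:C) = tail (fun y => Vc y * g y) x.
  rewrite fE /volterra addrC addKr; apply: tail_ext => y; rewrite /g /s; ring.
rewrite (ibp x dT1 ccont_Vc gT1 growth_Vc hg cdg gg gdg).
rewrite {1}/g /s subrr sin_div_at0 mul0r mulr0 add0r.
rewrite (ibp x dT2 cT1 gT2 gT1 hdg cddg gdg gddg).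
rewrite {1}/dg /s /co subrr sin_div_at0 ccos_at0 mul0r addr0 mul1r.
have Mf0 := jconst_ge0; have C00 := ltW (jker_gt0 al0); have d0 := jgap_gt0 albe.
have bound : cabs (tail (fun y => T2 y * ddg y) x) <=
   (c * eps ^+ 2 * C0 * jconst * (2 * K0 ^+ 2 + 2 + A) * expR (- (al * x))) / delta *
   expR (- (delta * x)).
  apply: tail_bound => // [|y xy]; first exact: ccontM.
  have y0 : 0 <= y by rewrite (le_trans x0) ?ltW.
  have hyx : `|y - x| = y - x by rewrite ger0_norm// subr_ge0 ltW.
  have b1 : cabs (s y) <= C0 * expR (al * (y - x)).
    by rewrite -hyx; exact: jker_sin_div_le.
  have b2 : cabs (co y) <= C0 * expR (al * (y - x)).
    by rewrite -hyx; exact: jker_ccos_le.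
  have b3 := hl_f_le y0; have b4 := hl_f1_le y0.
  have b5 : cabs (k ^+ 2) <= K0 ^+ 2 by rewrite cabsX lerXn2r ?nnegrE ?cabs_ge0.
  have b6 : cabs ((V y)%:C - k ^+ 2) <= A + K0 ^+ 2.
    apply: (le_trans (cabsB _ _)); apply: lerD => //.
    by apply: (le_trans (hl_V_le y0)); apply: (ler_piMr (ltW A0)); exact: hl_exp_le1.
  pose B := C0 * expR (al * (y - x)) * (jconst * expR (al * y)).
  have p (u v : R[i]) : cabs u <= C0 * expR (al * (y - x)) ->
     cabs v <= jconst * expR (al * y) -> cabs (u * v) <= B.
    by move=> hu hv; rewrite cabsM; apply: ler_pM; rewrite ?cabs_ge0.
  have b7 : cabs (ddg y) <= (2 * K0 ^+ 2 + 2 + A) * B.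
    have -> : ddg y = - (k ^+ 2 * (s y * f y)) + 2 * (co y * f1 y) +
       ((V y)%:C - k ^+ 2) * (s y * f y) by rewrite /ddg; ring.
    apply: (le_trans (cabsD _ _)).
    have -> : (2 * K0 ^+ 2 + 2 + A) * B = (K0 ^+ 2 * B + 2 * B) + (A + K0 ^+ 2) * B by ring.
    apply: lerD; last first.
      by rewrite cabsM; apply: ler_pM; rewrite ?cabs_ge0 ?p.
    apply: (le_trans (cabsD _ _)); rewrite cabsN.
    rewrite (cabsM (k ^+ 2)) (cabsM 2) cabs_nat; apply: lerD.
      by apply: ler_pM; rewrite ?cabs_ge0 ?p.
    by rewrite ler_wpM2l// p.
  rewrite cabsM.
  apply: (le_trans (ler_pM (cabs_ge0 _) (cabs_ge0 _) (hT2 y0) b7)).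
  rewrite /B; apply: eq_ler.
  have -> : c * eps ^+ 2 * C0 * jconst * (2 * K0 ^+ 2 + 2 + A) * expR (- (al * x)) * expR (- (delta * y)) =
    c * eps ^+ 2 * C0 * jconst * (2 * K0 ^+ 2 + 2 + A) * (expR (- (al * x)) * expR (- (delta * y))) by ring.
  rewrite -expRD.
  have -> : c * eps ^+ 2 * expR (- (be * y)) * ((2 * K0 ^+ 2 + 2 + A) *
     (C0 * expR (al * (y - x)) * (jconst * expR (al * y)))) =
    c * eps ^+ 2 * C0 * jconst * (2 * K0 ^+ 2 + 2 + A) *
     (expR (- (be * y)) * (expR (al * (y - x)) * expR (al * y))) by ring.
  by rewrite -!expRD; congr (_ * expR _); rewrite /jgap; ring.
apply: (le_trans (cabsD _ _)); rewrite /hlD.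
have -> : c * jconst * (1 + C0 * (2 * K0 ^+ 2 + 2 + A) / delta) * eps ^+ 2 * expR (al * x) =
  c * eps ^+ 2 * jconst * expR (al * x) +
  c * eps ^+ 2 * C0 * jconst * (2 * K0 ^+ 2 + 2 + A) / delta * expR (al * x) by ring.
have e20 : 0 <= eps ^+ 2 by rewrite exprn_ge0// ltW.
apply: lerD.
  rewrite cabsM; apply: (le_trans (ler_pM (cabs_ge0 _) (cabs_ge0 _) (hT2 x0) (hl_f_le x0))).
  rewrite mulrA ler_wpM2r ?expR_ge0// ler_wpM2r//.
  by apply: ler_piMr; [exact: mulr_ge0|exact: hl_exp_le1].
apply: (le_trans bound).
have -> : c * eps ^+ 2 * C0 * jconst * (2 * K0 ^+ 2 + 2 + A) * expR (- (al * x)) / delta *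
   expR (- (delta * x)) =
  c * eps ^+ 2 * C0 * jconst * (2 * K0 ^+ 2 + 2 + A) / delta *
   (expR (- (al * x)) * expR (- (delta * x))) by ring.
rewrite -expRD ler_wpM2l//.
  apply: mulr_ge0; last by rewrite invr_ge0 ltW.
  apply: mulr_ge0; first by do 3 apply: mulr_ge0 => //.
  apply: addr_ge0; last exact: ltW.
  by rewrite addr_ge0// mulr_ge0// exprn_ge0.
rewrite ler_expR; have := mulr_ge0 (ltW al0) x0; have := mulr_ge0 (ltW d0) x0; lra.
Qed.

(** With [chi = e * f] one has [chi'' = Vc * chi - om]. Since [om] does not contain V, it is
    differentiable and admits a third integration by parts; the term with V has to be treated on its
    own. *)
Let om y : R[i] := e y * (2 * k ^+ 2 * f y + 2 * 'i * k * f1 y).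
Let dom y : R[i] := e y * (- (2 * 'i * k ^+ 3 * f y) + 4 * k ^+ 2 * f1 y +
  2 * 'i * k * (((V y)%:C - k ^+ 2) * f y)).
Let chi y : R[i] := e y * f y.
Let dchi y : R[i] := e y * (f1 y - 'i * k * f y).
Let ddchi y : R[i] := Vc y * chi y - om y.

Let de y : cder e y (- ('i * k) * e y).
Proof. exact: cder_cexp_Nik. Qed.

Let dchiP y : cder chi y (dchi y).
Proof. by apply: (cder_eq (cderM (de y) (df y))); rewrite /dchi; ring. Qed.

Let ddchiP y : cder dchi y (ddchi y).
Proof.
apply: (cder_eq (cderM (de y) (cderB (df1 y) (cderZ ('i * k) (df y))))).
rewrite /ddchi /om /chi /Vc.
transitivity (((V y)%:C * (e y * f y) - e y * (2 * k ^+ 2 * f y + 2 * 'i * k * f1 y)) +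
  ('i * 'i + 1) * k ^+ 2 * (e y * f y)); first by ring.
by rewrite i_sqr addNr !mul0r addr0.
Qed.

Let domP y : cder om y (dom y).
Proof.
apply: (cder_eq (cderM (de y) (cderD (cderZ (2 * k ^+ 2) (df y))
  (cderZ (2 * 'i * k) (df1 y))))).
rewrite /dom.
transitivity (e y * (- (2 * 'i * k ^+ 3 * f y) + (2 - 2 * ('i * 'i)) * k ^+ 2 * f1 y +
  2 * 'i * k * (((V y)%:C - k ^+ 2) * f y))); first by ring.
by rewrite i_sqr; ring.
Qed.

Let ce : ccont e := ccont_e.
Let cchi : ccont chi := cder_ccont dchiP.
Let cdchi : ccont dchi := cder_ccont ddchiP.
Let com : ccont om := cder_ccont domP.
Let cddchi : ccont ddchi := ccontB (ccontM ccont_Vc cchi) com.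

Let cdom : ccont dom.
Proof.
have c1 := hl_cf; have c2 := hl_cf1; have c3 := ccont_Vc.
have h1 := ccontN (ccontM (ccont_cst (2 * 'i * k ^+ 3)) c1).
have h2 := ccontM (ccont_cst (4 * k ^+ 2)) c2.
have h3 := ccontM (ccont_cst (2 * 'i * k)) (ccontM (ccontB c3 (ccont_cst (k ^+ 2))) c1).
exact: (ccontM ce (ccontD (ccontD h1 h2) h3)).
Qed.

Let gVf : growth al (fun y => ((V y)%:C - k ^+ 2) * f y).
Proof.
apply: (@growthW _ (0 + al)); first by rewrite add0r.
apply: growthM growth_f; apply: growthB; first exact: growthW (ltW be_lt0) growth_Vc.
by exists (cabs (k ^+ 2)) => y _; rewrite mul0r expR0 mulr1.
Qed.

Let gchi : growth (al + al) chi := growthM growth_e growth_f.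

Let gdchi : growth (al + al) dchi.
Proof. exact: (growthM growth_e (growthB growth_f1 (growthZ ('i * k) growth_f))). Qed.

Let gom : growth (al + al) om.
Proof.
exact: (growthM growth_e (growthD (growthZ (2 * k ^+ 2) growth_f)
  (growthZ (2 * 'i * k) growth_f1))).
Qed.

Let gdom : growth (al + al) dom.
Proof.
exact: (growthM growth_e (growthD (growthD (growthN (growthZ (2 * 'i * k ^+ 3) growth_f))
  (growthZ (4 * k ^+ 2) growth_f1)) (growthZ (2 * 'i * k) gVf))).
Qed.

Let gddchi : growth (al + al) ddchi.
Proof.
apply: growthB gom; apply: (@growthW _ (- be + (al + al))); last exact: growthM growth_Vc gchi.
by rewrite gerDr ltW.
Qed.

Let hlI1 : tail (fun y => Vc y * chi y) 0 = T1 0 * chi 0 + tail (fun y => T1 y * dchi y) 0.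
Proof. exact: (ibp 0 dT1 ccont_Vc gT1 growth_Vc dchiP cdchi gchi gdchi). Qed.

Let hlI2 : tail (fun y => T1 y * dchi y) 0 = T2 0 * dchi 0 + tail (fun y => T2 y * ddchi y) 0.
Proof. exact: (ibp 0 dT2 cT1 gT2 gT1 ddchiP cddchi gdchi gddchi). Qed.

Let hlI3 : tail (fun y => T2 y * om y) 0 = T3 0 * om 0 + tail (fun y => T3 y * dom y) 0.
Proof. exact: (ibp 0 dT3 cT2 gT3 gT2 domP cdom gom gdom). Qed.

Let ti (F : R -> R[i]) b : ccont F -> b < 0 -> growth b F -> tail_integrable F.
Proof. by move=> cF b0 gF; apply: exp_decay_tail_integrable cF _; exact: growth_exp_decay gF. Qed.

Let be_al : - be <= al + al.
Proof. by move: be_lt0 al0; lra. Qed.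

(** The source of the effective potential. As T2' = - T1, moving a tail from V onto T2 produces the
    square of T1, which does not oscillate away. *)
Let hlI4 : tail (fun y => Vc y * T2 y) 0 = T1 0 * T2 0 - tail (fun y => T1 y ^+ 2) 0.
Proof.
have dN y : cder T2 y (- T1 y) by [].
rewrite (ibp 0 dT1 ccont_Vc gT1 growth_Vc dN (ccontN cT1) (growthW be_al gT2)
  (growthW be_al (growthN gT1))); congr (_ + _).
rewrite -tailN; first by apply: tail_ext => y; rewrite expr2 mulrN.
apply: (@ti _ (- be + - be)); [exact: ccontM|by move: be_lt0; lra|exact: growthM].
Qed.

Let b2 : - be + (- be + (al + al)) < 0.
Proof. by move: al2be be_lt0; lra. Qed.

(** In the term with V, [chi] is replaced by 1. The remainder carries both T2 and [chi - 1], each of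
    order eps^2. *)
Let hlI5 : tail (fun y => T2 y * ddchi y) 0 =
  tail (fun y => Vc y * T2 y) 0 + tail (fun y => T2 y * (Vc y * (chi y - 1))) 0 -
  tail (fun y => T2 y * om y) 0.
Proof.
have g1 : growth 0 (fun=> 1 : R[i]).
  by exists 1 => y _; rewrite cabs1 mul0r expR0 mul1r.
have gc1 : growth (al + al) (fun y => chi y - 1).
  by apply: growthB gchi _; apply: growthW g1; rewrite addr_ge0// ltW.
have c1 : ccont (fun y => chi y - 1) by apply: ccontB cchi _; exact: ccont_cst.
have i1 : tail_integrable (fun y => Vc y * T2 y).
  apply: (@ti _ (- be + - be)); [exact: ccontM ccont_Vc cT2|by move: be_lt0; lra|].
  exact: growthM growth_Vc gT2.
have i2 : tail_integrable (fun y => T2 y * (Vc y * (chi y - 1))).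
  apply: (ti (ccontM cT2 (ccontM ccont_Vc c1)) b2).
  exact: (growthM gT2 (growthM growth_Vc gc1)).
have i3 : tail_integrable (fun y => T2 y * om y).
  exact: (ti (ccontM cT2 com) al2be (growthM gT2 gom)).
rewrite -tailD// -tailB//; last first.
  by move=> y; apply: cintegrableD.
by apply: tail_ext => y; rewrite /ddchi; ring.
Qed.

Lemma hl_J : tail (fun y => Vc y * (e y * f y)) 0 =
  T1 0 * f 0 + T2 0 * (f1 0 - 'i * k * f 0) + T1 0 * T2 0 - tail (fun y => T1 y ^+ 2) 0 +
  tail (fun y => T2 y * (Vc y * (e y * f y - 1))) 0 -
  T3 0 * (2 * k ^+ 2 * f 0 + 2 * 'i * k * f1 0) - tail (fun y => T3 y * dom y) 0.
Proof.
rewrite -/chi hlI1 hlI2 hlI5 hlI3 hlI4 /dchi /om /chi.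
have -> : e 0 = 1 by rewrite /e mulr0 oppr0 cexp0.
ring.
Qed.

Let tail0_le (F G : R -> R[i]) (p q : R) : ccont F -> ccont G ->
  (forall y, 0 <= y -> cabs (F y) <= p * expR (- (be * y))) ->
  (forall y, 0 <= y -> cabs (G y) <= q * expR ((al + al) * y)) ->
  cabs (tail (fun y => F y * G y) 0) <= p * q / delta.
Proof.
move=> cF cG hF hG.
have -> : p * q / delta = p * q / delta * expR (- (delta * 0)).
  by rewrite mulr0 oppr0 expR0 mulr1.
apply: tail_bound; [exact: jgap_gt0|exact: ccontM|move=> y /ltW y0].
rewrite cabsM; apply: (le_trans (ler_pM (cabs_ge0 _) (cabs_ge0 _) (hF y y0) (hG y y0))).
by rewrite mulrACA -expRD; apply: eq_ler; congr (_ * expR _); rewrite /jgap; ring.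
Qed.

Let b_ef y : 0 <= y -> cabs (chi y) <= jconst * expR ((al + al) * y).
Proof.
move=> y0; rewrite cabsM mulrDl expRD mulrCA.
by apply: ler_pM; rewrite ?cabs_ge0 ?hl_e_le ?hl_f_le.
Qed.

Let b_ef1 y : 0 <= y -> cabs (e y * f1 y) <= jconst * expR ((al + al) * y).
Proof.
move=> y0; rewrite cabsM mulrDl expRD mulrCA.
by apply: ler_pM; rewrite ?cabs_ge0 ?hl_e_le ?hl_f1_le.
Qed.

Let b_V y : 0 <= y -> cabs ((V y)%:C - k ^+ 2) <= A + K0 ^+ 2.
Proof.
move=> y0; apply: (le_trans (cabsB _ _)); apply: lerD; last first.
  by rewrite cabsX lerXn2r ?nnegrE ?cabs_ge0.
by apply: (le_trans (hl_V_le y0)); apply: (ler_piMr (ltW A0)); exact: hl_exp_le1.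
Qed.

Let kX n : cabs (k ^+ n) <= K0 ^+ n.
Proof. by rewrite cabsX lerXn2r ?nnegrE ?cabs_ge0. Qed.

Let b_dchi y : 0 <= y -> cabs (dchi y) <= jconst * (1 + K0) * expR ((al + al) * y).
Proof.
move=> y0; have -> : dchi y = e y * f1 y - 'i * k * chi y by rewrite /dchi /chi; ring.
apply: (le_trans (cabsB _ _)).
have -> : jconst * (1 + K0) * expR ((al + al) * y) =
  jconst * expR ((al + al) * y) + K0 * (jconst * expR ((al + al) * y)) by ring.
apply: lerD; first exact: b_ef1.
rewrite (cabsM ('i * k)) (cabsM 'i) cabs_i mul1r.
by apply: ler_pM; rewrite ?cabs_ge0 ?b_ef.
Qed.

Let b_om y : 0 <= y ->
  cabs (om y) <= jconst * (2 * K0 ^+ 2 + 2 * K0) * expR ((al + al) * y).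
Proof.
move=> y0; have -> : om y = 2 * (k ^+ 2 * chi y) + 2 * ('i * (k * (e y * f1 y))).
  by rewrite /om /chi; ring.
apply: (le_trans (cabsD _ _)).
set B := jconst * expR ((al + al) * y).
have -> : jconst * (2 * K0 ^+ 2 + 2 * K0) * expR ((al + al) * y) =
  2 * (K0 ^+ 2 * B) + 2 * (K0 * B) by rewrite /B; ring.
rewrite (cabsM 2) (cabsM 2) (cabsM 'i) cabs_i mul1r cabs_nat (cabsM (k ^+ 2)) (cabsM k).
apply: lerD; apply: ler_wpM2l => //; apply: ler_pM => //; try exact: cabs_ge0.
- exact: b_ef.
- exact: b_ef1.
Qed.

Definition hldom : R :=
  jconst * (2 * K0 ^+ 3 + 4 * K0 ^+ 2 + 2 * K0 * (A + K0 ^+ 2)).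

Let b_dom y : 0 <= y -> cabs (dom y) <= hldom * expR ((al + al) * y).
Proof.
move=> y0; have -> : dom y = - (2 * ('i * (k ^+ 3 * chi y))) + 4 * (k ^+ 2 * (e y * f1 y)) +
   2 * ('i * (k * (((V y)%:C - k ^+ 2) * chi y))).
  by rewrite /dom /chi; ring.
set B := jconst * expR ((al + al) * y).
have -> : hldom * expR ((al + al) * y) =
  (2 * (K0 ^+ 3 * B) + 4 * (K0 ^+ 2 * B)) + 2 * (K0 * ((A + K0 ^+ 2) * B)).
  by rewrite /hldom /B; ring.
have h1 := b_ef y0; have h2 := b_ef1 y0.
apply: (le_trans (cabsD _ _)); apply: lerD; last first.
  rewrite (cabsM 2) cabs_nat (cabsM 'i) cabs_i mul1r (cabsM k) (cabsM (_ - _)).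
  apply: ler_wpM2l => //; apply: ler_pM => //; try exact: cabs_ge0.
    by apply: mulr_ge0; exact: cabs_ge0.
  by apply: ler_pM => //; [exact: cabs_ge0|exact: cabs_ge0|exact: b_V].
apply: (le_trans (cabsD _ _)); rewrite cabsN.
rewrite (cabsM 2) (cabsM 4) !cabs_nat (cabsM 'i) cabs_i mul1r (cabsM (k ^+ 3)) (cabsM (k ^+ 2)).
by apply: lerD; apply: ler_wpM2l => //; apply: ler_pM => //; exact: cabs_ge0.
Qed.

Let b_chi1 y : 0 <= y ->
  cabs (chi y - 1) <= hlD * eps ^+ 2 * expR ((al + al) * y).
Proof.
move=> y0; have -> : chi y - 1 = e y * (f y - cexp ('i * k * y%:C)).
  by rewrite mulrBr [e y * cexp _]mulrC /e cexpN.
rewrite cabsM mulrDl expRD mulrCA.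
by apply: ler_pM; rewrite ?cabs_ge0 ?hl_e_le ?hl_f_exp.
Qed.

Lemma hl_f0 : cabs (f 0 - 1) <= hlD * eps ^+ 2.
Proof.
have := hl_f_exp (lexx 0); rewrite !mulr0 expR0 mulr1.
by rewrite cexp0.
Qed.

Definition hlA : R := c * jconst + c * (jconst * (1 + K0)) / delta + 2 * K0 * hlD.

Let at0 (F : R -> R[i]) p : (forall y, 0 <= y -> cabs (F y) <= p * expR (- (be * y))) ->
  cabs (F 0) <= p.
Proof. by move=> /(_ 0 (lexx _)); rewrite mulr0 oppr0 expR0 mulr1. Qed.

Let at0' (F : R -> R[i]) p a : (forall y, 0 <= y -> cabs (F y) <= p * expR (a * y)) ->
  cabs (F 0) <= p.
Proof. by move=> /(_ 0 (lexx _)); rewrite mulr0 expR0 mulr1. Qed.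

Lemma hlD_ge0 : 0 <= hlD.
Proof.
have := hl_f0; move/(le_trans (cabs_ge0 _)); rewrite pmulr_lge0//.
by rewrite exprn_gt0.
Qed.

(** This difference will multiply [T2 0], so order eps is enough; one integration by parts in [hl_E]
    provides it. *)
Lemma hl_f10 : cabs (f1 0 - 'i * k * f 0) <= hlA * eps.
Proof.
have -> : f1 0 - 'i * k * f 0 = (f1 0 + 'i * k * f 0) - 2 * 'i * k * f 0 by ring.
rewrite hl_E -/chi hlI1.
have -> : chi 0 = f 0 by rewrite /chi /e mulr0 oppr0 cexp0 mul1r.
have -> : 2 * 'i * k - (T1 0 * f 0 + tail (fun y => T1 y * dchi y) 0) - 2 * 'i * k * f 0 =
  - (T1 0 * f 0 + tail (fun y => T1 y * dchi y) 0) - 2 * ('i * (k * (f 0 - 1))) by ring.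
apply: (le_trans (cabsB _ _)); rewrite cabsN.
have -> : hlA * eps = (c * eps * jconst + c * eps * (jconst * (1 + K0)) / delta) +
  2 * (K0 * (hlD * eps)) by rewrite /hlA; ring.
apply: lerD.
  apply: (le_trans (cabsD _ _)); apply: lerD.
    by rewrite cabsM; apply: ler_pM; rewrite ?cabs_ge0//; [exact: at0|exact: at0' hl_f_le].
  exact: tail0_le cT1 cdchi hT1 b_dchi.
rewrite (cabsM 2) cabs_nat (cabsM 'i) cabs_i mul1r (cabsM k); apply: ler_wpM2l => //.
apply: ler_pM => //; try exact: cabs_ge0.
apply: (le_trans hl_f0); rewrite ler_wpM2l ?hlD_ge0// expr2 ler_piMr// ltW//.
Qed.

Definition hlM : R := c * hlA + c * c + c * (A * hlD) / delta +
  c * (jconst * (2 * K0 ^+ 2 + 2 * K0)) + c * hldom / delta.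

Lemma hl_expansion :
  cabs (f1 0 + 'i * k * f 0 -
    (2 * 'i * k - T1 0 * f 0 + tail (fun y => T1 y ^+ 2) 0)) <= hlM * eps ^+ 3.
Proof.
have om0 : om 0 = 2 * k ^+ 2 * f 0 + 2 * 'i * k * f1 0.
  by rewrite /om /e mulr0 oppr0 cexp0 mul1r.
rewrite hl_E hl_J -om0.
set t1 := tail (fun y => T1 y ^+ 2) 0; set t2 := tail _ 0; set t3 := tail _ 0.
have -> : 2 * 'i * k - (T1 0 * f 0 + T2 0 * (f1 0 - 'i * k * f 0) + T1 0 * T2 0 - t1 + t2 -
    T3 0 * om 0 - t3) - (2 * 'i * k - T1 0 * f 0 + t1) =
  - (T2 0 * (f1 0 - 'i * k * f 0)) - T1 0 * T2 0 - t2 + T3 0 * om 0 + t3 by ring.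
have -> : hlM * eps ^+ 3 = c * eps ^+ 2 * (hlA * eps) + (c * eps) * (c * eps ^+ 2) +
   c * eps ^+ 2 * (A * hlD * eps) / delta +
   c * eps ^+ 3 * (jconst * (2 * K0 ^+ 2 + 2 * K0)) + c * eps ^+ 3 * hldom / delta.
  by rewrite /hlM; ring.
apply: (le_trans (cabsD _ _)); apply: lerD; last exact: tail0_le (cder_ccont dT3) cdom hT3 b_dom.
apply: (le_trans (cabsD _ _)); apply: lerD; last first.
  by rewrite cabsM; apply: ler_pM; rewrite ?cabs_ge0//; [exact: at0|exact: at0' b_om].
apply: (le_trans (cabsB _ _)); apply: lerD; last first.
  apply: tail0_le cT2 _ hT2 _.
    by apply: ccontM ccont_Vc _; apply: ccontB cchi _; exact: ccont_cst.
  move=> y y0; rewrite cabsM.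
  apply: (@le_trans _ _ (A * (hlD * eps ^+ 2 * expR ((al + al) * y)))).
    apply: ler_pM; rewrite ?cabs_ge0 ?b_chi1//.
    by apply: (le_trans (hl_V_le y0)); apply: (ler_piMr (ltW A0)); exact: hl_exp_le1.
  have -> : A * (hlD * eps ^+ 2 * expR ((al + al) * y)) =
    A * hlD * expR ((al + al) * y) * eps ^+ 2 by ring.
  rewrite [leRHS]mulrAC; apply: ler_wpM2l.
    by apply: mulr_ge0; [apply: mulr_ge0; [exact: ltW|exact: hlD_ge0]|exact: expR_ge0].
  by rewrite expr2 ler_piMr// ltW.
apply: (le_trans (cabsB _ _)); apply: lerD; last first.
  by rewrite cabsM; apply: ler_pM; rewrite ?cabs_ge0//; exact: at0.
by rewrite cabsN cabsM; apply: ler_pM; rewrite ?cabs_ge0 ?hl_f10//; exact: at0.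
Qed.

End Oscillation.

(** * Potentials of size eps^2: the Born approximation *)

Section SmallPotential.
Hypotheses (eps0 : 0 < eps) (eps1 : eps <= 1).
Hypothesis hVs : forall x, `|V x| <= A * eps ^+ 2 * expR (- (be * `|x|)).

(** The 2 is the constant 4 of the bound on f times the factor 1/2 of the contraction; the
    exponential bounds the weight on the right half-line. *)
Definition hlS : R := 2 * expR (jexp al be A).

Lemma hl_small_f_exp x : 0 <= x ->
  cabs (f x - cexp ('i * k * x%:C)) <= hlS * eps ^+ 2 * expR (al * x).
Proof.
move=> x0; have -> : f x - cexp ('i * k * x%:C) =
   tail (fun y => sin_div k (y - x) * (Vc y * f y)) x.
  by rewrite fE /volterra addrC addKr.
have e20 : 0 <= eps ^+ 2 by rewrite exprn_ge0// ltW.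
have cs : ccont (fun y => sin_div k (y - x)).
  apply: (ccont_comp (phi := fun y => y - x)); last exact: ccont_sin_div.
  by move=> y; apply: cvgB; [exact: cvg_id|exact: cvg_cst].
have [||h] := @volterra_bound R al be al0 albe A (A * eps ^+ 2) 4
    (fun y => sin_div k (y - x) * (Vc y * f y)) x A0 (mulr_ge0 (ltW A0) e20) (ler0n _ 4).
- apply: ccont_cmeasurable_on => //.
  exact: ccontM cs (ccontM ccont_Vc hl_cf).
- apply: ae_all => y xy; rewrite !cabsM cabs_real mulrA.
  have h := jker_sin_div_le al0 hk (y - x); rewrite [`|y - x|]ger0_norm in h; last first.
    by rewrite subr_ge0 ltW.
  apply: ler_pM => //; first by rewrite mulr_ge0 ?cabs_ge0.
  - exact: cabs_ge0.
  - by apply: ler_pM => //; exact: cabs_ge0.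
move/le_trans; apply.
have -> : 4 * (A * eps ^+ 2 / (2 * A)) * jweight al be A x = 2 * eps ^+ 2 * jweight al be A x.
  by field; rewrite gt_eqF.
have -> : hlS * eps ^+ 2 * expR (al * x) =
  2 * eps ^+ 2 * (expR (jexp al be A) * expR (al * x)) by rewrite /hlS; ring.
by rewrite ler_wpM2l ?jweight_le// mulr_ge0.
Qed.

Lemma hl_small_f0 : cabs (f 0 - 1) <= hlS * eps ^+ 2.
Proof.
by have := hl_small_f_exp (lexx 0); rewrite !mulr0 expR0 mulr1 cexp0.
Qed.

Definition hlSM : R := A * hlS / delta.

(** The error integrates V against the deviation of f from the free exponential; both are of order
    eps^2. *)
Lemma hl_small_expansion :
  cabs (f1 0 + 'i * k * f 0 - (2 * 'i * k - tail Vc 0)) <= hlSM * eps ^+ 4.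
Proof.
have cchi : ccont (fun y => e y * f y) := ccontM ccont_e hl_cf.
have be_lt0 : - be < 0 by rewrite oppr_lt0 hl_be_gt0.
have al2be : - be + (al + al) < 0 by move: albe; lra.
have i1 : tail_integrable Vc.
  by apply: (exp_decay_tail_integrable ccont_Vc); exact: growth_exp_decay be_lt0 growth_Vc.
have i2 : tail_integrable (fun y => Vc y * (e y * f y)).
  apply: (exp_decay_tail_integrable (ccontM ccont_Vc cchi)).
  exact: (growth_exp_decay al2be (growthM growth_Vc (growthM growth_e growth_f))).
rewrite hl_E.
have -> : 2 * 'i * k - tail (fun y => Vc y * (e y * f y)) 0 - (2 * 'i * k - tail Vc 0) =
  - (tail (fun y => Vc y * (e y * f y)) 0 - tail Vc 0) by ring.
rewrite cabsN -tailB//.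
have -> : hlSM * eps ^+ 4 = A * eps ^+ 2 * (hlS * eps ^+ 2) / delta * expR (- (delta * 0)).
  by rewrite mulr0 oppr0 expR0 mulr1 /hlSM; ring.
apply: tail_bound; [exact: jgap_gt0|exact: ccontB (ccontM ccont_Vc cchi) ccont_Vc|].
move=> y /ltW y0.
have -> : Vc y * (e y * f y) - Vc y = Vc y * (e y * (f y - cexp ('i * k * y%:C))).
  by rewrite mulrBr [e y * cexp _]mulrC /e cexpN mulrBr mulr1.
have h1 := hVs y; rewrite (ger0_norm y0) in h1.
rewrite (cabsM (Vc y)) (cabsM (e y)) cabs_real.
apply: (le_trans (ler_pM _ _ h1 (ler_pM _ _ (hl_e_le y0) (hl_small_f_exp y0)))) => //;
  try exact: cabs_ge0.
  by apply: mulr_ge0; exact: cabs_ge0.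
have -> : A * eps ^+ 2 * expR (- (be * y)) * (expR (al * y) * (hlS * eps ^+ 2 * expR (al * y))) =
  A * eps ^+ 2 * (hlS * eps ^+ 2) * (expR (- (be * y)) * (expR (al * y) * expR (al * y))) by ring.
by rewrite -!expRD; apply: eq_ler; congr (_ * expR _); rewrite /jgap; ring.
Qed.

End SmallPotential.
End HalfLine.

(** * From the half-lines to the Wronskian *)

Section WronskianFromHalfLines.
Context {R : realType}.
Notation mu := (@lebesgue_measure R).
Implicit Types (al be A : R) (U V : R -> R) (k : R[i]) (f : R -> R[i]).

Definition half_jost al be A V k f (f1 : R -> R[i]) : Prop :=
  [/\ forall x, cder f x (f1 x),
      forall x, cder f1 x (((V x)%:C - k ^+ 2) * f x),
      forall x, cabs (f x) <= 4 * jweight al be A x,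
      f1 =1 volterra1 V k f & f =1 volterra V k f].

(** The left Jost solution is the reflection of the right one for the reflected potential, which
    turns its derivative at 0 into [- g1 0]. The work is done for the continuous V and transferred
    to U. *)
Lemma jost_wronskian_half_lines al be A U V k : 0 < al -> al < be / 2 -> 0 < A ->
  continuous V -> (forall x, `|V x| <= A * expR (- (be * `|x|))) ->
  measurable_fun setT U -> {ae mu, forall y, V y = U y} ->
  `|complex.Im k| <= al ->
  exists f f1 g g1, [/\ half_jost al be A V k f f1,
    half_jost al be A (fun x => V (- x)) k g g1 &
    jost_wronskian U k = - (f 0 * g1 0 + g 0 * f1 0)].
Proof.
move=> al0 albe A0 cV hV mU VU hk.
have cVr : continuous (fun x => V (- x)).
  by move=> x; apply: (@continuous_comp _ _ _ (fun y : R => - y) V);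
    [apply: cvgN; exact: cvg_id|exact: cV].
have hVr x : `|V (- x)| <= A * expR (- (be * `|x|)) by have := hV (- x); rewrite [`|- x|]normrN.
have mUr : measurable_fun setT (fun x : R => U (- x)).
  have := @measurable_fun_reflect R setT U measurableT mU.
  by rewrite /reflect (_ : [set y | setT (- y)] = setT)//; apply/seteqP; split.
have VUr := ae_reflect VU.
have [f [f1 [jf df df1 hf [f1E fE]]]] := jost_existence al0 albe A0 cV hV hk.
have [g [g1 [jg dg dg1 hg [g1E gE]]]] := jost_existence al0 albe A0 cVr hVr hk.
exists f, f1, g, g1; split; [by split|by split|].
have hU : {ae mu, forall y, `|U y| <= A * expR (- (be * `|y|))}.
  by apply: (ae_imp VU) => y <-.
have hUr : {ae mu, forall y, `|U (- y)| <= A * expR (- (be * `|y|))}.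
  by apply: (ae_imp VUr) => y <-.
have jfU := is_jost_plus_ae mU VU (cder_ccont df) jf.
have jgU := is_jost_plus_ae mUr VUr (cder_ccont dg) jg.
(* [xget] returns some solution, since f is one; uniqueness then identifies it with f. *)
have E1 : jost_plus U k = f.
  apply: (is_jost_plus_unique al0 albe A0 hk hU) => //.
  by rewrite /jost_plus; case: xgetP => [h _ //|/(_ f)].
have E2 : jost_minus U k = fun x => g (- x).
  have jm : is_jost_minus U k (jost_minus U k).
    have := is_jost_plus_reflect jgU.
    have -> : (fun y => U (- - y)) = U by apply/funext => y; rewrite opprK.
    by rewrite /jost_minus; case: xgetP => [h _ //|/(_ (fun y => g (- y)))].
  have E := is_jost_plus_unique al0 albe A0 hk hUr (is_jost_minus_reflect jm) jgU.
  by apply/funext => x; rewrite -E opprK.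
rewrite /jost_wronskian E1 E2 /wronskian (cder_cderive (df 0)).
have dr : is_derive (0 : R) (1 : R) (fun y : R => - y) (-1).
  exact: (is_deriveN (is_derive_id (0 : R) (1 : R))).
rewrite (cder_cderive (cder_comp dr (dg (- 0)))) oppr0.
by rewrite rmorphN1; ring.
Qed.

End WronskianFromHalfLines.

(** * Oscillating modes *)

Section SingleMode.
Context {R : realType}.
Variables (be : R).
Hypothesis be0 : 0 < be.
Implicit Types (g p : R -> R[i]) (x y z B om : R).

Definition osc om y : R[i] := cexp ('i * om%:C * y%:C).

Definition half_lipschitz B g : Prop := forall y z, 0 <= y -> y <= z ->
  cabs (g z - g y) <= B * (z - y) * expR (- (be * y)).

(** Half of the shift [pi / |om|], stripped of the frequency, times 1 + 1/be: the integrated first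
    difference contributes 1/be and the interval between x and the shifted point contributes 1. *)
Definition osc_const : R := pi * (1 + be^-1) / 2.

Lemma osc_const_ge0 : 0 <= osc_const.
Proof. by rewrite /osc_const !mulr_ge0 ?pi_ge0 ?addr_ge0 ?invr_ge0 ?ltW. Qed.

Lemma cabs_osc om y : cabs (osc om y) = 1.
Proof. by rewrite /osc cabs_cexp Re_ik /= oppr0 mul0r expR0. Qed.

Lemma cder_osc om y : cder (osc om) y ('i * om%:C * osc om y).
Proof. exact: cder_cexp_ik. Qed.

Lemma ccont_osc om : ccont (osc om).
Proof. exact: cder_ccont (cder_osc om). Qed.

Lemma osc_shift om y : om != 0 -> osc om (y + pi / `|om|) = - osc om y.
Proof.
move=> om0; rewrite /osc rmorphD mulrDr cexpD -[RHS]mulrN1; congr (_ * _).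
have [om_gt0|om_le0] := ltP 0 om.
- rewrite (gtr0_norm om_gt0).
  have -> : 'i * om%:C * (pi / om)%:C = 0 +i* pi.
    by apply: complex_ext; rewrite !ReImE /=; field.
  by rewrite /cexp /= expR0 mul1r cospi sinpi; apply: complex_ext => /=; rewrite ?oppr0.
- rewrite (ler0_norm om_le0).
  have -> : 'i * om%:C * (pi / - om)%:C = 0 +i* (- pi).
    by apply: complex_ext; rewrite !ReImE /=; field.
  rewrite /cexp /= expR0 mul1r cosN sinN cospi sinpi.
  by apply: complex_ext => /=; rewrite ?oppr0.
Qed.

Lemma expR_decay_mono x y : x <= y -> expR (- (be * y)) <= expR (- (be * x)).
Proof. by move=> xy; rewrite ler_expR lerN2 ler_wpM2l// ltW. Qed.

(* A half-period shift changes the sign of the exponential, so that the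
   integral is half the integral of a first difference of the amplitude. *)
Lemma tail_osc_le om g B x : om != 0 -> 0 <= x -> ccont g ->
  (forall y, 0 <= y -> cabs (g y) <= B * expR (- (be * y))) ->
  half_lipschitz B g ->
  cabs (tail (fun y => g y * osc om y) x) <=
  osc_const * B * `|om|^-1 * expR (- (be * x)).
Proof.
move=> om0 x0 cg hg lg.
have aom : 0 < `|om| by rewrite normr_gt0.
pose s := pi / `|om|; have s0 : 0 < s by rewrite divr_gt0 ?pi_gt0.
pose F y := g y * osc om y.
have cF : ccont F by exact: ccontM cg (ccont_osc om).
have hF y : 0 <= y -> cabs (F y) <= B * expR (- (be * y)).
  by move=> y0; rewrite cabsM cabs_osc mulr1 hg.
have eF : exp_decay F := exp_decay_intro be0 hF.
have iF := exp_decay_tail_integrable cF eF.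
have dT y := tail_der y cF iF.
have dshift y : is_derive y (1 : R) (fun z => z + s) 1.
  by have := is_deriveD (is_derive_id y (1 : R)) (is_derive_cst s y (1 : R)); rewrite addr0.
have cshift : ccont (fun y => g (y + s)).
  by apply: (ccont_comp (phi := fun y => y + s)) => // y; apply: cvgD; [exact: cvg_id|exact: cvg_cst].
pose D y := (g y - g (y + s)) * osc om y.
have cD : ccont D := ccontM (ccontB cg cshift) (ccont_osc om).
have hD y : 0 <= y -> cabs (D y) <= B * s * expR (- (be * y)).
  move=> y0; rewrite cabsM cabs_osc mulr1 cabsBC.
  have ys : y + s - y = s by ring.
  by have := lg y (y + s) y0; rewrite ys; apply; rewrite lerDl ltW.
have E1 : tail F x + tail F (x + s) = tail D x.
  rewrite (@tail_primitive R D (fun y => - (tail F y + tail F (y + s)))) ?opprK//.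
  - exact: exp_decay_intro be0 hD.
  - move=> y; apply: (cder_eq (cderN (cderD (dT y) (cder_comp (dshift y) (dT (y + s)))))).
    by rewrite mul1r /F /D osc_shift//; ring.
  - apply: exp_decayN; apply: exp_decayD; first exact: exp_decay_tail.
    apply: (@exp_decay_intro _ _ (B / be) be be0) => y y0.
    apply: (@le_trans _ _ (B / be * expR (- (be * (y + s))))).
      apply: tail_bound => // z yz; apply: hF; rewrite ltW// (le_lt_trans _ yz)//.
      by rewrite addr_ge0// ltW.
    have B0 : 0 <= B.
      by have := le_trans (cabs_ge0 _) (hF 0 (lexx _)); rewrite mulr0 oppr0 expR0 mulr1.
    apply: ler_wpM2l; first by rewrite divr_ge0// ltW.
    by apply: expR_decay_mono; rewrite lerDl ltW.
have b1 : cabs (tail D x) <= B * s / be * expR (- (be * x)).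
  by apply: tail_bound => // y xy; apply: hD; rewrite (le_trans x0)// ltW.
have b2 : cabs (tail F (x + s) - tail F x) <= B * s * expR (- (be * x)).
  have B0 : 0 <= B.
    by have := le_trans (cabs_ge0 _) (hF 0 (lexx _)); rewrite mulr0 oppr0 expR0 mulr1.
  pose c := B * expR (- (be * x)).
  have -> : B * s * expR (- (be * x)) = c * (x + s) - c * x by rewrite /c; ring.
  apply: (@cder_le R (tail F) (fun y => - F y) (fun y => c * y) (fun=> c)).
  - by rewrite lerDl ltW.
  - by move=> t _.
  - by move=> t _; exact: is_derive_mulr.
  - move=> t /andP[xt _]; rewrite cabsN; apply: (le_trans (hF t (le_trans x0 xt))).
    by rewrite /c ler_wpM2l// expR_decay_mono.
have -> : tail (fun y => g y * osc om y) x =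
    2^-1 * (tail D x - (tail F (x + s) - tail F x)).
  by rewrite -E1 -/F; field.
rewrite cabsM cabsV cabs_nat.
have -> : osc_const * B * `|om|^-1 * expR (- (be * x)) =
   2^-1 * (B * s / be * expR (- (be * x)) + B * s * expR (- (be * x))).
  by rewrite /osc_const /s; field; rewrite !gt_eqF.
rewrite ler_wpM2l ?invr_ge0//; apply: (le_trans (cabsB _ _)); exact: lerD.
Qed.

(** The Lipschitz bound on [p2] stands for a bounded third derivative. [half_lipschitz] speaks of
    the right half-line only, so it is required of the reflection too, which makes the notion
    invariant under reflection. *)
Definition is_mode B p0 p1 p2 : Prop :=
  [/\ forall x, cder p0 x (p1 x), forall x, cder p1 x (p2 x), ccont p2,
      [/\ forall x, cabs (p0 x) <= B * expR (- (be * `|x|)),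
          forall x, cabs (p1 x) <= B * expR (- (be * `|x|)) &
          forall x, cabs (p2 x) <= B * expR (- (be * `|x|))] &
      half_lipschitz B p2 /\ half_lipschitz B (fun x => p2 (- x))].

Lemma is_mode_reflect B p0 p1 p2 : is_mode B p0 p1 p2 ->
  is_mode B (fun x => p0 (- x)) (fun x => - p1 (- x)) (fun x => p2 (- x)).
Proof.
move=> [d0 d1 c2 [h0 h1 h2] [l1 l2]].
have dr x : is_derive x (1 : R) (fun y : R => - y) (-1).
  exact: (is_deriveN (is_derive_id x (1 : R))).
split.
- by move=> x; apply: (cder_eq (cder_comp (dr x) (d0 (- x)))); rewrite rmorphN1 mulN1r.
- move=> x; apply: (cder_eq (cderN (cder_comp (dr x) (d1 (- x))))).
  by rewrite rmorphN1 mulN1r opprK.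
- apply: (ccont_comp (phi := fun y => - y)) => // y; apply: cvgN; exact: cvg_id.
- by split => x; rewrite ?cabsN -normrN.
- by split => //; under eq_fun do rewrite opprK.
Qed.

Lemma half_lipschitz_der B p dp : (forall x, cder p x (dp x)) ->
  (forall x, 0 <= x -> cabs (dp x) <= B * expR (- (be * x))) -> half_lipschitz B p.
Proof.
move=> hp hdp y z y0 yz; pose c := B * expR (- (be * y)).
have B0 : 0 <= B.
  by have := le_trans (cabs_ge0 _) (hdp 0 (lexx _)); rewrite mulr0 oppr0 expR0 mulr1.
have -> : B * (z - y) * expR (- (be * y)) = c * z - c * y by rewrite /c; ring.
apply: (@cder_le R p dp (fun y => c * y) (fun=> c)) => //.
- by move=> t _; exact: is_derive_mulr.
- move=> t /andP[yt _]; apply: (le_trans (hdp t (le_trans y0 yt))).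
  by rewrite /c ler_wpM2l// expR_decay_mono.
Qed.

Section Mode.
Variables (B om : R) (p0 p1 p2 : R -> R[i]).
Hypotheses (om0 : om != 0) (hp : is_mode B p0 p1 p2).
Local Notation ka := (('i * om%:C)^-1 : R[i]).
Local Notation eta := (`|om|^-1).

Let S (p : R -> R[i]) := tail (fun y => p y * osc om y).

Let d0 x : cder p0 x (p1 x). Proof. by case: hp. Qed.
Let d1 x : cder p1 x (p2 x). Proof. by case: hp. Qed.
Let c0 : ccont p0 := cder_ccont d0.
Let c1 : ccont p1 := cder_ccont d1.
Let c2 : ccont p2. Proof. by case: hp. Qed.

Let h0 x : 0 <= x -> cabs (p0 x) <= B * expR (- (be * x)).
Proof. by case: hp => _ _ _ [h _ _] _ x0; have := h x; rewrite (ger0_norm x0). Qed.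
Let h1 x : 0 <= x -> cabs (p1 x) <= B * expR (- (be * x)).
Proof. by case: hp => _ _ _ [_ h _] _ x0; have := h x; rewrite (ger0_norm x0). Qed.
Let h2 x : 0 <= x -> cabs (p2 x) <= B * expR (- (be * x)).
Proof. by case: hp => _ _ _ [_ _ h] _ x0; have := h x; rewrite (ger0_norm x0). Qed.

Lemma mode_B_ge0 : 0 <= B.
Proof.
by have := le_trans (cabs_ge0 _) (h0 (lexx 0)); rewrite mulr0 oppr0 expR0 mulr1.
Qed.

Lemma cabs_ka : cabs ka = eta.
Proof. by rewrite cabsV cabsM cabs_i mul1r cabs_real. Qed.

Let cO (p : R -> R[i]) : ccont p -> ccont (fun y => p y * osc om y).
Proof. by move=> cp; apply: ccontM cp (ccont_osc om). Qed.

Let eO (p : R -> R[i]) : (forall x, 0 <= x -> cabs (p x) <= B * expR (- (be * x))) ->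
  exp_decay (fun y => p y * osc om y).
Proof.
by move=> h; apply: (exp_decay_intro be0 (M := B)) => y y0; rewrite cabsM cabs_osc mulr1 h.
Qed.

(** One integration by parts: the exponential has the primitive [ka * osc], whence a factor of size
    1 / |om| for one derivative of the amplitude. *)
Let Sstep (p dp : R -> R[i]) x : (forall x, cder p x (dp x)) -> ccont dp ->
  (forall x, 0 <= x -> cabs (p x) <= B * expR (- (be * x))) ->
  (forall x, 0 <= x -> cabs (dp x) <= B * expR (- (be * x))) ->
  S p x = - ka * (p x * osc om x + S dp x).
Proof.
move=> dp' cdp hp0 hdp; have cp := cder_ccont dp'.
have k0 : 'i * om%:C != 0 :> R[i].
  by rewrite mulf_neq0 ?i_neq0// -cabs_eq0 cabs_real normr_eq0.
have du y : cder (fun z => ka * osc om z) y (osc om y).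
  by apply: (cder_eq (cderZ ka (cder_osc om y))); rewrite mulrA mulVf// mul1r.
have e1 : exp_decay (fun y => ka * osc om y * p y).
  by apply: exp_decay_ext (exp_decayZ ka (eO hp0)) => y; ring.
have e2 : exp_decay (fun y => osc om y * p y).
  by apply: exp_decay_ext (eO hp0) => y; ring.
have e3 : exp_decay (fun y => ka * osc om y * dp y).
  by apply: exp_decay_ext (exp_decayZ ka (eO hdp)) => y; ring.
have := tail_by_parts x du dp' (ccont_osc om) cdp e1 e2 e3.
rewrite /S (tail_ext (F := fun y => p y * osc om y) (G := fun y => osc om y * p y)).
  move=> ->; rewrite (tail_ext (F := fun y => ka * osc om y * dp y)
    (G := fun y => ka * (dp y * osc om y))); last by move=> y; ring.
  rewrite tailZ; first by ring.
  exact: exp_decay_tail_integrable (cO cdp) (eO hdp).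
by move=> y; rewrite mulrC.
Qed.

Let S01 x : S p0 x = - ka * (p0 x * osc om x + S p1 x).
Proof. exact: Sstep d0 c1 h0 h1. Qed.
Let S12 x : S p1 x = - ka * (p1 x * osc om x + S p2 x).
Proof. exact: Sstep d1 c2 h1 h2. Qed.

Local Notation a1 := osc_const.
Local Notation b1 := (1 + be^-1).

Let bS (p : R -> R[i]) : ccont p ->
  (forall x, 0 <= x -> cabs (p x) <= B * expR (- (be * x))) -> half_lipschitz B p ->
  forall x, 0 <= x -> cabs (S p x) <= a1 * B * eta * expR (- (be * x)).
Proof. by move=> cp hb lp x x0; apply: tail_osc_le. Qed.

Let bS0 := bS c0 h0 (half_lipschitz_der d0 h1).
Let bS1 := bS c1 h1 (half_lipschitz_der d1 h2).
Let bS2 x : 0 <= x -> cabs (S p2 x) <= a1 * B * eta * expR (- (be * x)).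
Proof. by apply: bS; [exact: c2|exact: h2|case: hp => _ _ _ _ []]. Qed.

Let iS (p : R -> R[i]) : ccont p ->
  (forall x, 0 <= x -> cabs (p x) <= B * expR (- (be * x))) ->
  forall x, cder (S p) x (- (p x * osc om x)).
Proof.
move=> cp hb x; apply: (tail_der x (cO cp)).
exact: exp_decay_tail_integrable (cO cp) (eO hb).
Qed.

Let cS0 : ccont (S p0) := cder_ccont (iS c0 h0).
Let cS1 : ccont (S p1) := cder_ccont (iS c1 h1).
Let cS2 : ccont (S p2) := cder_ccont (iS c2 h2).

Lemma mode_T1 x : 0 <= x -> cabs (S p0 x) <= a1 * B * eta * expR (- (be * x)).
Proof. exact: bS0. Qed.

Lemma mode_T1_first x : 0 <= x ->
  cabs (S p0 x + ka * (p0 x * osc om x)) <= a1 * B * eta ^+ 2 * expR (- (be * x)).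
Proof.
move=> x0; rewrite S01 mulrDr !mulNr addrAC addNr add0r cabsN cabsM cabs_ka.
have -> : a1 * B * eta ^+ 2 * expR (- (be * x)) =
   eta * (a1 * B * eta * expR (- (be * x))) by ring.
by rewrite ler_wpM2l ?invr_ge0 ?bS1.
Qed.

(** Two integrations by parts leave exactly these two boundary terms. The third power comes from the
    half-period shift applied to [S p2], which needs no derivative of [p2]. *)
Lemma mode_T1_at0 :
  cabs (S p0 0 + ka * p0 0 - ka ^+ 2 * p1 0) <= a1 * B * eta ^+ 3.
Proof.
have o0 : osc om 0 = 1 by rewrite /osc mulr0 cexp0.
have -> : S p0 0 + ka * p0 0 - ka ^+ 2 * p1 0 = ka ^+ 2 * S p2 0.
  by rewrite S01 S12 o0; ring.
rewrite cabsM cabsX cabs_ka.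
have := bS2 (lexx 0); rewrite mulr0 oppr0 expR0 mulr1 => h.
have -> : a1 * B * eta ^+ 3 = eta ^+ 2 * (a1 * B * eta) by ring.
by rewrite ler_wpM2l// exprn_ge0// invr_ge0.
Qed.

Let tl (F : R -> R[i]) M x : ccont F -> 0 <= x ->
  (forall y, 0 <= y -> cabs (F y) <= M * expR (- (be * y))) ->
  cabs (tail F x) <= M / be * expR (- (be * x)).
Proof.
by move=> cF x0 hF; apply: tail_bound => // y xy; apply: hF; rewrite (le_trans x0)// ltW.
Qed.

Let til (F : R -> R[i]) M : ccont F ->
  (forall y, 0 <= y -> cabs (F y) <= M * expR (- (be * y))) -> tail_integrable F.
Proof. by move=> cF hF; apply: exp_decay_tail_integrable cF (exp_decay_intro be0 hF). Qed.

(** Taking the tail of the recursion for [S p] again exhibits the factor [ka]; this is how each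
    further tail gains a power of 1 / |om|. *)
Let S2step (p dp : R -> R[i]) x : ccont p -> ccont dp ->
  (forall x, 0 <= x -> cabs (p x) <= B * expR (- (be * x))) ->
  (forall x, 0 <= x -> cabs (dp x) <= B * expR (- (be * x))) ->
  half_lipschitz B dp ->
  (forall x, S p x = - ka * (p x * osc om x + S dp x)) ->
  tail (S p) x = - ka * (S p x + tail (S dp) x).
Proof.
move=> cp cdp hp0 hdp ldp E; rewrite (tail_ext _ E).
have i1 := exp_decay_tail_integrable (cO cp) (eO hp0).
have i2 := til (cder_ccont (iS cdp hdp)) (bS cdp hdp ldp).
by rewrite tailZ ?tailD// => y; apply: cintegrableD.
Qed.

Let S2_01 x : tail (S p0) x = - ka * (S p0 x + tail (S p1) x).
Proof. exact: S2step c0 c1 h0 h1 (half_lipschitz_der d1 h2) S01. Qed.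

Let S2_12 x : tail (S p1) x = - ka * (S p1 x + tail (S p2) x).
Proof. by apply: S2step c1 c2 h1 h2 _ S12; case: hp => _ _ _ _ []. Qed.

Let bT2 (F G : R -> R[i]) M : (forall x, 0 <= x -> cabs (F x) <= M * expR (- (be * x))) ->
  (forall x, 0 <= x -> cabs (G x) <= M / be * expR (- (be * x))) ->
  forall x, 0 <= x -> cabs (- ka * (F x + G x)) <= b1 * M * eta * expR (- (be * x)).
Proof.
move=> hF hG x x0; rewrite cabsM cabsN cabs_ka.
have -> : b1 * M * eta * expR (- (be * x)) =
  eta * (M * expR (- (be * x)) + M / be * expR (- (be * x))) by ring.
rewrite ler_wpM2l ?invr_ge0//; apply: (le_trans (cabsD _ _)).
by apply: lerD; [exact: hF|exact: hG].
Qed.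

Let bS2_0 x : 0 <= x -> cabs (tail (S p0) x) <= b1 * (a1 * B * eta) * eta * expR (- (be * x)).
Proof. by move=> x0; rewrite S2_01; apply: bT2 => // y y0; apply: tl. Qed.

Let bS2_1 x : 0 <= x -> cabs (tail (S p1) x) <= b1 * (a1 * B * eta) * eta * expR (- (be * x)).
Proof. by move=> x0; rewrite S2_12; apply: bT2 => // y y0; apply: tl. Qed.

Lemma mode_T2 x : 0 <= x ->
  cabs (tail (S p0) x) <= a1 * b1 * B * eta ^+ 2 * expR (- (be * x)).
Proof.
by move=> x0; apply: (le_trans (bS2_0 x0)); apply: eq_ler; ring.
Qed.

Let cTS0 : ccont (tail (S p0)).
Proof. exact: cder_ccont (fun x => tail_der x cS0 (til cS0 bS0)). Qed.
Let cTS1 : ccont (tail (S p1)).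
Proof. exact: cder_ccont (fun x => tail_der x cS1 (til cS1 bS1)). Qed.

Lemma mode_T3 x : 0 <= x ->
  cabs (tail (tail (S p0)) x) <= a1 * b1 ^+ 2 * B * eta ^+ 3 * expR (- (be * x)).
Proof.
move=> x0; rewrite (tail_ext _ S2_01) tailZ; last first.
  by move=> y; apply: cintegrableD => //; [exact: (til cS0 bS0)|exact: (til cTS1 bS2_1)].
rewrite tailD; [|exact: (til cS0 bS0)|exact: (til cTS1 bS2_1)].
have h y : 0 <= y -> cabs (tail (tail (S p1)) y) <=
    b1 * (a1 * B * eta) * eta / be * expR (- (be * y)) by move=> y0; apply: tl.
apply: (le_trans (bT2 bS2_0 h x0)).
by apply: eq_ler; ring.
Qed.

End Mode.
End SingleMode.

Lemma sqr_inv_freq (R : realType) (e p r : R) : e != 0 -> p != 0 -> r != 0 ->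
  (2 * p * r / e) ^- 2 * r ^+ 2 = e ^+ 2 / (4 * p ^+ 2).
Proof. by move=> e0 p0 r0; field; rewrite e0 p0 r0. Qed.

Lemma ccont_conj (R : realType) (f : R -> R[i]) :
  ccont f -> ccont (fun x => conjc (f x)).
Proof.
move=> [c1 c2]; split => x.
- have -> : (fun y => complex.Re (conjc (f y))) = fun y => complex.Re (f y).
    by apply/funext => y; case: (f y).
  exact: c1.
- have -> : (fun y => complex.Im (conjc (f y))) = fun y => - complex.Im (f y).
    by apply/funext => y; case: (f y).
  by apply: cvgN; exact: c2.
Qed.

(** * Summation over finitely many modes; resonant and nonresonant pairs *)

Section ModeSum.
Context {R : realType}.
Variables (be theta Btot eps : R) (p0 p1 p2 : int -> R -> R[i]) (B : int -> R).
Variables (lam : int -> R) (J : seq int) (V La : R -> R).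
Hypotheses (be0 : 0 < be) (theta0 : 0 < theta) (eps0 : 0 < eps) (eps1 : eps <= 1).
Hypothesis hp : forall j, is_mode be (B j) (p0 j) (p1 j) (p2 j).
Hypothesis hB : \sum_(j <- J) B j <= Btot.
Hypothesis Juniq : uniq J.
Hypothesis JN : forall j, j \in J -> - j \in J.
Hypothesis lam_ge : forall j, j \in J -> theta <= `|lam j|.
Hypothesis lam_opp : forall j, j \in J -> lam (- j) = - lam j.
Hypothesis lam_sep : forall j l, j \in J -> l \in J -> j != l -> theta <= `|lam j - lam l|.
Hypothesis p0_conj : forall j x, j \in J -> p0 (- j) x = conjc (p0 j x).
Hypotheses (cV : continuous V) (cLa : continuous La).

Definition freq j : R := 2 * pi * lam j / eps.

(** The finite list J may depend on eps. Its length never enters the constants, only [Btot] does, so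
    the truncation error can be made as small as eps^3. *)
Hypothesis hV : forall x, cabs ((V x)%:C - \sum_(j <- J) p0 j x * osc (freq j) x) <=
  eps ^+ 3 * expR (- (be * `|x|)).
Hypothesis hLa : forall x, `|4 * pi ^+ 2 * La x -
  \sum_(j <- J) cabs (p0 j x) ^+ 2 / lam j ^+ 2| <= eps ^+ 3 * expR (- (be * `|x|)).

Let eta : R := (2 * pi * theta)^-1 * eps.
Let e30 : 0 <= eps ^+ 3 := exprn_ge0 3 (ltW eps0).
Let eta0 : 0 < eta.
Proof. by rewrite /eta mulr_gt0// invr_gt0 !mulr_gt0// pi_gt0. Qed.

(** Stated for any r because it serves the single frequencies [lam j] and also the sums
    [lam j + lam l]. *)
Let freq_ge r : theta <= `|r| -> `|2 * pi * r / eps|^-1 <= eta /\ 2 * pi * r / eps != 0.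
Proof.
move=> h; have r0 : 0 < `|r| by exact: lt_le_trans h.
have p20 : 0 < 2 * pi :> R by rewrite mulr_gt0// pi_gt0.
have E : `|2 * pi * r / eps| = 2 * pi * `|r| / eps.
  by rewrite !normrM normfV (ger0_norm (ltW eps0)) (ger0_norm (ltW (pi_gt0 R))) ger0_norm.
have F0 : 0 < 2 * pi * `|r| / eps by rewrite !mulr_gt0// ?pi_gt0// invr_gt0.
split; last by rewrite -normr_gt0 E.
rewrite E invfM invrK /eta; apply: ler_wpM2r; first exact: ltW.
rewrite lef_pV2 ?posrE; [|exact: mulr_gt0|exact: mulr_gt0].
by apply: ler_wpM2l => //; exact: ltW.
Qed.

Let fr j : j \in J -> `|freq j|^-1 <= eta /\ freq j != 0.
Proof. by move=> /lam_ge; exact: freq_ge. Qed.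

Let B0 j : 0 <= B j. Proof. exact: mode_B_ge0 (hp j). Qed.
Let Btot0 : 0 <= Btot.
Proof. by apply: le_trans hB; apply: sumr_ge0 => j _. Qed.

Let sum_le (F : int -> R[i]) c : 0 <= c -> (forall j, j \in J -> cabs (F j) <= c * B j) ->
  cabs (\sum_(j <- J) F j) <= c * Btot.
Proof.
move=> c0 hF; apply: (le_trans (cabs_sum _ _ _)).
apply: (@le_trans _ _ (\sum_(j <- J) c * B j)); last by rewrite -mulr_sumr ler_wpM2l.
by rewrite big_seq [leRHS]big_seq; apply: ler_sum => j; exact: hF.
Qed.

Let a1 : R := osc_const be.
Let b1 : R := 1 + be^-1.
Let a10 : 0 <= a1 := osc_const_ge0 be0.
Let b10 : 0 <= b1. Proof. by rewrite addr_ge0// invr_ge0 ltW. Qed.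

Let m j y : R[i] := p0 j y * osc (freq j) y.
Let S j := tail (m j).
Let Vc y : R[i] := (V y)%:C.
Let W y : R[i] := Vc y - \sum_(j <- J) m j y.

Let cp0 j : ccont (p0 j). Proof. by have [d _ _ _ _] := hp j; exact: cder_ccont d. Qed.
Let cm j : ccont (m j). Proof. by apply: ccontM => //; exact: ccont_osc. Qed.
Let cW : ccont W. Proof. by apply: ccontB; [exact: ccont_real|exact: ccont_sum]. Qed.

Let hW y : 0 <= y -> cabs (W y) <= eps ^+ 3 * expR (- (be * y)).
Proof. by move=> y0; have := hV y; rewrite (ger0_norm y0). Qed.

Let hp0 j y : 0 <= y -> cabs (p0 j y) <= B j * expR (- (be * y)).
Proof. by move=> y0; have [_ _ _ [h _ _] _] := hp j; have := h y; rewrite (ger0_norm y0). Qed.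

Let hm j y : 0 <= y -> cabs (m j y) <= B j * expR (- (be * y)).
Proof. by move=> y0; rewrite cabsM cabs_osc mulr1 hp0. Qed.

Let til (F : R -> R[i]) M : ccont F ->
  (forall y, 0 <= y -> cabs (F y) <= M * expR (- (be * y))) -> tail_integrable F.
Proof. by move=> cF hF; apply: exp_decay_tail_integrable cF (exp_decay_intro be0 hF). Qed.

Let tl (F : R -> R[i]) M x : ccont F ->
  (forall y, 0 <= y -> cabs (F y) <= M * expR (- (be * y))) -> 0 <= x ->
  cabs (tail F x) <= M / be * expR (- (be * x)).
Proof.
by move=> cF hF x0; apply: tail_bound => // y xy; apply: hF; rewrite (le_trans x0)// ltW.
Qed.

Let ct (F : R -> R[i]) M : ccont F ->
  (forall y, 0 <= y -> cabs (F y) <= M * expR (- (be * y))) -> ccont (tail F).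
Proof. by move=> cF hF; apply: cder_ccont (fun x => tail_der x cF (til cF hF)). Qed.

Let tail_sum (F : int -> R -> R[i]) (G : R -> R[i]) x :
  (forall j, tail_integrable (F j)) -> tail_integrable G ->
  tail (fun y => \sum_(j <- J) F j y + G y) x = \sum_(j <- J) tail (F j) x + tail G x.
Proof.
move=> iF iG; have K y : cintegrable `]y, +oo[ (fun z => \sum_(j <- J) F j z) /\
   tail (fun z => \sum_(j <- J) F j z) y = \sum_(j <- J) tail (F j) y.
  by apply: cintegrable_sum => // j; exact: iF.
by rewrite tailD// => [|y]; [rewrite (K x).2|exact: (K y).1].
Qed.

Let T1 := tail Vc.
Let T2 := tail T1.
Let T3 := tail T2.

Let T1E x : T1 x = \sum_(j <- J) S j x + tail W x.
Proof.
rewrite -tail_sum; [|by move=> j; exact: til (cm j) (hm j)|exact: til cW hW].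
by apply: tail_ext => y; rewrite /W addrC subrK.
Qed.

Let cS j : ccont (S j) := ct (cm j) (hm j).
Let hS' j y : 0 <= y -> cabs (S j y) <= B j / be * expR (- (be * y)).
Proof. exact: tl (cm j) (hm j). Qed.
Let cTW : ccont (tail W) := ct cW hW.
Let hTW y := tl (x := y) cW hW.

Let T2E x : T2 x = \sum_(j <- J) tail (S j) x + tail (tail W) x.
Proof.
rewrite -tail_sum; [|by move=> j; exact: til (cS j) (hS' j)|exact: til cTW hTW].
by apply: tail_ext => y; exact: T1E.
Qed.

Let cTS j : ccont (tail (S j)) := ct (cS j) (hS' j).
Let hTS' j y : 0 <= y -> cabs (tail (S j) y) <= B j / be / be * expR (- (be * y)).
Proof. exact: tl (cS j) (hS' j). Qed.
Let cTTW : ccont (tail (tail W)) := ct cTW hTW.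
Let hTTW y := tl (x := y) cTW hTW.

Let T3E x : T3 x = \sum_(j <- J) tail (tail (S j)) x + tail (tail (tail W)) x.
Proof.
rewrite -tail_sum; [|by move=> j; exact: til (cTS j) (hTS' j)|exact: til cTTW hTTW].
by apply: tail_ext => y; exact: T2E.
Qed.

Let t : R := (2 * pi * theta)^-1.
Let t0 : 0 <= t. Proof. by rewrite /t invr_ge0 !mulr_ge0 ?pi_ge0// ltW. Qed.
Let bi0 : 0 <= be^-1. Proof. by rewrite invr_ge0 ltW. Qed.

Let e31 : eps ^+ 3 <= eps.
Proof. by rewrite exprS; apply: (ler_piMr (ltW eps0)); apply: exprn_ile1 => //; exact: ltW. Qed.
Let e32 : eps ^+ 3 <= eps ^+ 2.
Proof. by rewrite exprS; apply: ler_piMl => //; apply: exprn_ge0; exact: ltW. Qed.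

Let etaX n j : j \in J -> `|freq j|^-1 ^+ n <= eta ^+ n.
Proof. by move=> /fr[h _]; rewrite lerXn2r ?nnegrE ?invr_ge0// ltW. Qed.

Let mode_sum (F : int -> R -> R[i]) (c : R) n y : 0 <= c -> 0 <= y ->
  (forall j, j \in J -> cabs (F j y) <= c * B j * `|freq j|^-1 ^+ n * expR (- (be * y))) ->
  cabs (\sum_(j <- J) F j y) <= c * Btot * t ^+ n * eps ^+ n * expR (- (be * y)).
Proof.
move=> c0 y0 hF.
have -> : c * Btot * t ^+ n * eps ^+ n * expR (- (be * y)) =
  c * eta ^+ n * expR (- (be * y)) * Btot by rewrite /eta exprMn -/t; ring.
apply: sum_le => [|j jJ]; first by rewrite !mulr_ge0 ?expR_ge0 ?exprn_ge0// ltW.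
apply: (le_trans (hF j jJ)).
have -> : c * eta ^+ n * expR (- (be * y)) * B j = c * B j * eta ^+ n * expR (- (be * y)) by ring.
by rewrite ler_wpM2r ?expR_ge0// ler_wpM2l ?etaX// mulr_ge0.
Qed.

Definition sum_c1 : R := a1 * Btot * t + be^-1.
Definition sum_c2 : R := a1 * b1 * Btot * t ^+ 2 + be^-1 * be^-1.
Definition sum_c3 : R := a1 * b1 ^+ 2 * Btot * t ^+ 3 + be^-1 * be^-1 * be^-1.

Lemma sum_T1 y : 0 <= y -> cabs (T1 y) <= sum_c1 * eps * expR (- (be * y)).
Proof.
move=> y0; rewrite T1E; apply: (le_trans (cabsD _ _)).
have -> : sum_c1 * eps * expR (- (be * y)) =
  a1 * Btot * t ^+ 1 * eps ^+ 1 * expR (- (be * y)) + be^-1 * eps * expR (- (be * y)).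
  by rewrite /sum_c1 !expr1; ring.
apply: lerD.
  by apply: mode_sum => // j jJ; rewrite expr1; apply: (mode_T1 be0 _ (hp j)) => //; case: (fr jJ).
apply: (le_trans (hTW y0)); rewrite ler_wpM2r ?expR_ge0// mulrC ler_wpM2l//.
Qed.

Lemma sum_T2 y : 0 <= y -> cabs (T2 y) <= sum_c2 * eps ^+ 2 * expR (- (be * y)).
Proof.
move=> y0; rewrite T2E; apply: (le_trans (cabsD _ _)).
have -> : sum_c2 * eps ^+ 2 * expR (- (be * y)) =
  a1 * b1 * Btot * t ^+ 2 * eps ^+ 2 * expR (- (be * y)) +
  eps ^+ 2 / be / be * expR (- (be * y)) by rewrite /sum_c2; ring.
apply: lerD.
  apply: (mode_sum (F := fun j => tail (S j))) => // [|j jJ]; first exact: mulr_ge0.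
  by apply: (mode_T2 be0 _ (hp j)) => //; case: (fr jJ).
by apply: (le_trans (hTTW y0)); rewrite ler_wpM2r ?expR_ge0// !ler_wpM2r.
Qed.

Lemma sum_T3 y : 0 <= y -> cabs (T3 y) <= sum_c3 * eps ^+ 3 * expR (- (be * y)).
Proof.
move=> y0; rewrite T3E; apply: (le_trans (cabsD _ _)).
have -> : sum_c3 * eps ^+ 3 * expR (- (be * y)) =
  a1 * b1 ^+ 2 * Btot * t ^+ 3 * eps ^+ 3 * expR (- (be * y)) +
  eps ^+ 3 / be / be / be * expR (- (be * y)) by rewrite /sum_c3; ring.
apply: lerD.
  apply: (mode_sum (F := fun j => tail (tail (S j)))) => // [|j jJ].
    by apply: mulr_ge0 => //; exact: exprn_ge0.
  by apply: (mode_T3 be0 _ (hp j)) => //; case: (fr jJ).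
exact: tl cTTW hTTW y0.
Qed.

Let ka j : R[i] := ('i * (freq j)%:C)^-1.

(** Every term is odd under reflection: [ka j] changes sign with the frequency, and [ka j ^+ 2] does
    not, but [p1 j] does. *)
Definition sum_Z : R[i] := \sum_(j <- J) (ka j * p0 j 0 - ka j ^+ 2 * p1 j 0).
Definition sum_c4 : R := a1 * Btot * t ^+ 3 + be^-1.

Lemma sum_T1_at0 : cabs (T1 0 + sum_Z) <= sum_c4 * eps ^+ 3.
Proof.
rewrite T1E addrAC /sum_Z -big_split /=; apply: (le_trans (cabsD _ _)).
have -> : sum_c4 * eps ^+ 3 = a1 * Btot * t ^+ 3 * eps ^+ 3 * expR (- (be * 0)) +
  eps ^+ 3 / be * expR (- (be * 0)).
  by rewrite /sum_c4 mulr0 oppr0 expR0; ring.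
apply: lerD; last exact: hTW.
apply: (mode_sum (F := fun j _ => S j 0 + (ka j * p0 j 0 - ka j ^+ 2 * p1 j 0))) => // j jJ.
rewrite mulr0 oppr0 expR0 mulr1 addrA.
by apply: (mode_T1_at0 be0 _ (hp j)); case: (fr jJ).
Qed.

(** Only the first boundary term of each mode. This is coarser than [sum_Z], but T1 gets squared, so
    an error of order eps^2 meets a factor of order eps. *)
Let Y y : R[i] := - \sum_(j <- J) ka j * m j y.

Let cY : ccont Y.
Proof. by apply: ccontN; apply: ccont_sum => j; apply: ccontM => //; exact: ccont_cst. Qed.

Let hY y : 0 <= y -> cabs (Y y) <= Btot * t * eps * expR (- (be * y)).
Proof.
move=> y0; rewrite /Y cabsN.
have -> : Btot * t * eps * expR (- (be * y)) = 1 * Btot * t ^+ 1 * eps ^+ 1 * expR (- (be * y)).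
  by rewrite !expr1 mul1r.
apply: (mode_sum (F := fun j y => ka j * m j y)) => // j jJ.
rewrite mul1r expr1 cabsM cabs_ka mulrAC [leRHS]mulrC.
by rewrite ler_wpM2l ?invr_ge0// hm.
Qed.

Definition sum_c5 : R := a1 * Btot * t ^+ 2 + be^-1.

Let hT1Y y : 0 <= y -> cabs (T1 y - Y y) <= sum_c5 * eps ^+ 2 * expR (- (be * y)).
Proof.
move=> y0; rewrite T1E /Y opprK addrAC -big_split /=; apply: (le_trans (cabsD _ _)).
have -> : sum_c5 * eps ^+ 2 * expR (- (be * y)) =
  a1 * Btot * t ^+ 2 * eps ^+ 2 * expR (- (be * y)) + eps ^+ 2 / be * expR (- (be * y)).
  by rewrite /sum_c5; ring.
apply: lerD; last by apply: (le_trans (hTW y0)); rewrite ler_wpM2r ?expR_ge0// ler_wpM2r.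
apply: (mode_sum (F := fun j y => S j y + ka j * m j y)) => // j jJ.
by apply: (mode_T1_first be0 _ (hp j)) => //; case: (fr jJ).
Qed.

Let cT1 : ccont T1.
Proof.
have iV : tail_integrable Vc.
  have -> : Vc = fun y => \sum_(j <- J) m j y + W y.
    by apply/funext => y; rewrite /W addrC subrK.
  move=> y; apply: cintegrableD => //; last exact: til cW hW y.
  by apply: (cintegrable_sum _ _ _).1 => // j; exact: til (cm j) (hm j) y.
exact: cder_ccont (fun x => tail_der x (ccont_real cV) iV).
Qed.

Let E2 y : 0 <= y -> expR (- (be * y)) * expR (- (be * y)) <= expR (- (be * y)).
Proof.
move=> y0; apply: ler_piMr; first exact: expR_ge0.
by rewrite -expR0 ler_expR oppr_le0; apply: mulr_ge0 => //; exact: ltW.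
Qed.

Let sq_le (F G : R -> R[i]) c d y : 0 <= c -> 0 <= d -> 0 <= y ->
  cabs (F y) <= c * expR (- (be * y)) -> cabs (G y) <= d * expR (- (be * y)) ->
  cabs (F y * G y) <= c * d * expR (- (be * y)).
Proof.
move=> c0 d0 y0 hF hG; rewrite cabsM.
apply: (le_trans (ler_pM (cabs_ge0 _) (cabs_ge0 _) hF hG)).
by rewrite mulrACA ler_wpM2l ?mulr_ge0 ?E2.
Qed.

Let c1_ge0 : 0 <= sum_c1. Proof. by apply: addr_ge0 => //; do 2 apply: mulr_ge0 => //. Qed.
Let c5_ge0 : 0 <= sum_c5. Proof.
apply: addr_ge0 => //; apply: mulr_ge0; [exact: mulr_ge0|exact: exprn_ge0].
Qed.

Let hsq1 : cabs (tail (fun y => T1 y ^+ 2) 0 - tail (fun y => Y y * Y y) 0) <=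
  sum_c5 * (sum_c1 + Btot * t) / be * eps ^+ 3.
Proof.
have b1' y : 0 <= y -> cabs (T1 y ^+ 2) <= (sum_c1 * eps) * (sum_c1 * eps) * expR (- (be * y)).
  by move=> y0; rewrite expr2; apply: sq_le; rewrite ?sum_T1// mulr_ge0// ltW.
have c0 : 0 <= Btot * t * eps by rewrite !mulr_ge0// ltW.
have b2' y : 0 <= y -> cabs (Y y * Y y) <= (Btot * t * eps) * (Btot * t * eps) * expR (- (be * y)).
  by move=> y0; apply: sq_le; rewrite ?hY.
have cT12 : ccont (fun y => T1 y ^+ 2) by exact: ccontM.
have cY2 := ccontM cY cY.
rewrite -tailB; [|exact: til cT12 b1'|exact: til cY2 b2'].
have -> : sum_c5 * (sum_c1 + Btot * t) / be * eps ^+ 3 =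
  (sum_c5 * eps ^+ 2) * ((sum_c1 + Btot * t) * eps) / be * expR (- (be * 0)).
  by rewrite mulr0 oppr0 expR0; ring.
apply: tail_bound => //; first exact: ccontB.
move=> y /ltW y0; rewrite expr2.
have -> : T1 y * T1 y - Y y * Y y = (T1 y - Y y) * (T1 y + Y y) by ring.
apply: (@sq_le (fun y => T1 y - Y y) (fun y => T1 y + Y y)) => //.
- by rewrite mulr_ge0// exprn_ge0// ltW.
- by apply: mulr_ge0; [apply: addr_ge0 => //; exact: mulr_ge0|exact: ltW].
- exact: hT1Y.
- apply: (le_trans (cabsD _ _)).
  have -> : (sum_c1 + Btot * t) * eps * expR (- (be * y)) =
    sum_c1 * eps * expR (- (be * y)) + Btot * t * eps * expR (- (be * y)) by ring.
  by apply: lerD; [exact: sum_T1|exact: hY].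
Qed.

Let mm j l y : R[i] := (p0 j y * p0 l y) * osc (freq j + freq l) y.

Let mmE j l y : m j y * m l y = mm j l y.
Proof.
rewrite /mm /m /osc; have -> : 'i * (freq j + freq l)%:C * y%:C =
  'i * (freq j)%:C * y%:C + 'i * (freq l)%:C * y%:C by rewrite rmorphD; ring.
by rewrite cexpD; ring.
Qed.

Let hpp j l y : 0 <= y -> cabs (p0 j y * p0 l y) <= B j * B l * expR (- (be * y)).
Proof. by move=> y0; apply: sq_le; rewrite ?hp0. Qed.

Let cpp j l : ccont (fun y => p0 j y * p0 l y) := ccontM (cp0 j) (cp0 l).

Let hmm j l y : 0 <= y -> cabs (mm j l y) <= B j * B l * expR (- (be * y)).
Proof. by move=> y0; rewrite /mm cabsM cabs_osc mulr1 hpp. Qed.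

Let cmm j l : ccont (mm j l).
Proof. by apply: ccontM (cpp j l) _; exact: ccont_osc. Qed.

Let lpp j l : half_lipschitz be (2 * (B j * B l)) (fun y => p0 j y * p0 l y).
Proof.
have h1 i y : 0 <= y -> cabs (p1 i y) <= B i * expR (- (be * y)).
  by move=> y0; have [_ _ _ [_ h _] _] := hp i; have := h y; rewrite (ger0_norm y0).
apply: (half_lipschitz_der be0 (dp := fun y => p1 j y * p0 l y + p0 j y * p1 l y)).
  move=> x; have [dj _ _ _ _] := hp j; have [dl _ _ _ _] := hp l.
  exact: cderM.
move=> y y0; apply: (le_trans (cabsD _ _)); rewrite mulr2n !mulrDl mul1r.
by apply: lerD; apply: sq_le; rewrite ?hp0 ?h1.
Qed.

Let res0 : 0 <= 2 * a1 * t ^+ 3 * eps ^+ 3.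
Proof.
apply: mulr_ge0 => //; apply: mulr_ge0; [exact: mulr_ge0|exact: exprn_ge0].
Qed.

(* The resonant pairs are those with l = - j. *)
Let D j l : R[i] := if l == - j then
  (eps ^+ 2 / (4 * pi ^+ 2))%:C * tail (fun y => (cabs (p0 j y) ^+ 2 / lam j ^+ 2)%:C) 0 else 0.

Let hD j l : j \in J -> l \in J ->
  cabs (ka j * ka l * tail (mm j l) 0 - D j l) <= 2 * a1 * t ^+ 3 * eps ^+ 3 * B j * B l.
Proof.
move=> jJ lJ; have rhs0 : 0 <= 2 * a1 * t ^+ 3 * eps ^+ 3 * B j * B l.
  by apply: mulr_ge0 => //; apply: mulr_ge0.
have [hj j0] := fr jJ; have [hl l0] := fr lJ.
rewrite /D; case: eqP => [lE|/eqP lj].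
  have fE : freq l = - freq j by rewrite /freq lE lam_opp// mulrN mulNr.
  have lam0 : lam j != 0.
    by rewrite -normr_gt0 (lt_le_trans theta0)// lam_ge.
  have conjE z : z * conjc z = (cabs z ^+ 2)%:C.
    by rewrite cabs_sqr; case: z => a b; apply: complex_ext => /=; ring.
  have E y : mm j l y = (lam j ^+ 2)%:C * (cabs (p0 j y) ^+ 2 / lam j ^+ 2)%:C.
    rewrite /mm fE subrr /osc mulr0 mul0r cexp0 mulr1 lE p0_conj// conjE -rmorphM.
    by congr (_%:C); field.
  rewrite (tail_ext _ E) tailZ; last first.
    have E' y : mm j l y * (lam j ^+ 2)^-1%:C = (cabs (p0 j y) ^+ 2 / lam j ^+ 2)%:C.
      rewrite E -mulrA mulrCA -rmorphM mulfV ?mulr1// expf_neq0//.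
    move=> y; apply: (cintegrable_ext (measurable_itv _) (fun z _ => E' z)).
    have := cintegrableZ ((lam j ^+ 2)^-1%:C) (measurable_itv _) (til (cmm j l) (hmm j l) y).
    by apply: (cintegrable_ext (measurable_itv _)) => z _; rewrite mulrC.
  have -> : ka j * ka l * ((lam j ^+ 2)%:C * tail (fun y => (cabs (p0 j y) ^+ 2 / lam j ^+ 2)%:C) 0) =
    (eps ^+ 2 / (4 * pi ^+ 2))%:C * tail (fun y => (cabs (p0 j y) ^+ 2 / lam j ^+ 2)%:C) 0.
    rewrite mulrA; congr (_ * _).
    rewrite /ka fE -invfM.
    have -> : 'i * (freq j)%:C * ('i * (- freq j)%:C) = (freq j ^+ 2)%:C :> R[i].
      rewrite rmorphN mulrACA i_sqr mulN1r mulrN opprK -rmorphM.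
      by congr (_%:C); rewrite expr2.
    rewrite -fmorphV -rmorphM; congr (_%:C).
    by apply: sqr_inv_freq => //; rewrite gt_eqF// pi_gt0.
  by rewrite subrr cabs0.
rewrite subr0.
(* As [lam] is odd, [lam j + lam l] is the difference of the frequencies of j and - l, which are
   distinct indices; the separation hypothesis bounds it from below. *)
have lJ' : - l \in J := JN lJ.
have jl : j != - l by apply: contra_neq lj => ->; rewrite opprK.
have hO : theta <= `|lam j + lam l|.
  by have := lam_sep jJ lJ' jl; rewrite lam_opp// opprK.
have [hom om0] := freq_ge hO.
have fE : freq j + freq l = 2 * pi * (lam j + lam l) / eps by rewrite /freq; ring.
have := tail_osc_le be0 (x := 0) (om := freq j + freq l) _ (lexx _) (cpp j l) _ (lpp j l).
rewrite fE => /(_ om0) K.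
have {}K : cabs (tail (mm j l) 0) <= a1 * (2 * (B j * B l)) * eta.
  rewrite /mm fE; apply: le_trans (K _) _.
    move=> y y0; apply: (le_trans (hpp j l y0)); rewrite ler_wpM2r ?expR_ge0//.
    by rewrite mulr2n mulrDl mul1r lerDl mulr_ge0.
  rewrite mulr0 oppr0 expR0 mulr1; apply: ler_wpM2l => //.
  by apply: mulr_ge0 => //; apply: mulr_ge0 => //; apply: mulr_ge0.
rewrite cabsM cabsM !cabs_ka.
have -> : 2 * a1 * t ^+ 3 * eps ^+ 3 * B j * B l = eta * eta * (a1 * (2 * (B j * B l)) * eta).
  by rewrite /eta -/t; ring.
apply: ler_pM => //; rewrite ?mulr_ge0 ?invr_ge0 ?cabs_ge0//.
by apply: ler_pM; rewrite ?invr_ge0.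
Qed.

Let tailY2 : tail (fun y => Y y * Y y) 0 =
  \sum_(j <- J) \sum_(l <- J) ka j * ka l * tail (mm j l) 0.
Proof.
have E y : Y y * Y y = \sum_(j <- J) \sum_(l <- J) ka j * ka l * mm j l y.
  rewrite /Y mulrNN big_distrl /=; apply: eq_bigr => j _.
  rewrite big_distrr /=; apply: eq_bigr => l _.
  by rewrite -mmE; ring.
rewrite (tail_ext _ E) /tail.
have m0 := @measurable_itv R `]0, +oo[.
have i j l : cintegrable `]0, +oo[ (fun y => ka j * ka l * mm j l y).
  by apply: cintegrableZ => //; exact: til (cmm j l) (hmm j l) 0.
have K j := cintegrable_sum J m0 (i j).
rewrite (cintegrable_sum J m0 (fun j => (K j).1)).2.
apply: eq_bigr => j _; rewrite (K j).2; apply: eq_bigr => l _.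
by rewrite cintegralZ//; exact: til (cmm j l) (hmm j l) 0.
Qed.

Let hY2 : cabs (tail (fun y => Y y * Y y) 0 -
   (eps ^+ 2 / (4 * pi ^+ 2))%:C *
   \sum_(j <- J) tail (fun y => (cabs (p0 j y) ^+ 2 / lam j ^+ 2)%:C) 0) <=
  2 * a1 * t ^+ 3 * Btot ^+ 2 * eps ^+ 3.
Proof.
have -> : (eps ^+ 2 / (4 * pi ^+ 2))%:C *
   \sum_(j <- J) tail (fun y => (cabs (p0 j y) ^+ 2 / lam j ^+ 2)%:C) 0 =
   \sum_(j <- J) \sum_(l <- J) D j l.
  rewrite mulr_sumr big_seq [RHS]big_seq; apply: eq_bigr => j jJ.
  rewrite (bigD1_seq (- j)) ?JN//= {1}/D eqxx big1 ?addr0// => l lj.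
  by rewrite /D (negbTE lj).
rewrite tailY2 -sumrB.
have -> : 2 * a1 * t ^+ 3 * Btot ^+ 2 * eps ^+ 3 =
   (2 * a1 * t ^+ 3 * eps ^+ 3 * Btot) * Btot by ring.
have c0 := res0.
apply: sum_le => [|j jJ]; first by rewrite mulr_ge0.
rewrite -sumrB mulrAC; apply: sum_le => [|l lJ]; first by rewrite mulr_ge0.
exact: hD.
Qed.

Definition sum_c6 : R := sum_c5 * (sum_c1 + Btot * t) / be +
  2 * a1 * t ^+ 3 * Btot ^+ 2 + be^-1.

Lemma sum_T1_sqr : cabs (tail (fun y => T1 y ^+ 2) 0 -
  (eps ^+ 2)%:C * tail (fun y => (La y)%:C) 0) <= sum_c6 * eps ^+ 3.
Proof.
pose G j y : R[i] := (cabs (p0 j y) ^+ 2 / lam j ^+ 2)%:C.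
have cG j : ccont (G j).
  have E y : (lam j ^- 2)%:C * (p0 j y * conjc (p0 j y)) = G j y.
    rewrite /G cabs_sqr; case: (p0 j y) => a b.
    by apply: complex_ext; rewrite !ReImE /=; ring.
  apply: (ccont_ext E); apply: ccontM; first exact: ccont_cst.
  by apply: ccontM => //; exact: ccont_conj.
have hG j y : 0 <= y -> cabs (G j y) <= (B j * B j) / lam j ^+ 2 * expR (- (be * y)).
  move=> y0; rewrite /G cabs_real ger0_norm; last by rewrite divr_ge0// sqr_ge0.
  rewrite [leRHS]mulrAC; apply: ler_wpM2r; first by rewrite invr_ge0 sqr_ge0.
  by have := sq_le (B0 j) (B0 j) y0 (hp0 j y0) (hp0 j y0); rewrite cabsM expr2.
pose X y : R[i] := (4 * pi ^+ 2)%:C * (La y)%:C - \sum_(j <- J) G j y.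
have cX : ccont X.
  apply: ccontB; last exact: ccont_sum.
  by apply: ccontM; [exact: ccont_cst|exact: ccont_real].
have XE y : X y = (4 * pi ^+ 2 * La y - \sum_(j <- J) cabs (p0 j y) ^+ 2 / lam j ^+ 2)%:C.
  by rewrite /X -rmorphM rmorphB rmorph_sum.
have hX y : 0 <= y -> cabs (X y) <= eps ^+ 3 * expR (- (be * y)).
  by move=> y0; rewrite XE cabs_real; have := hLa y; rewrite (ger0_norm y0).
have pi2 : 4 * pi ^+ 2 != 0 :> R by rewrite gt_eqF// mulr_gt0// exprn_gt0// pi_gt0.
have LaE y : (La y)%:C = (4 * pi ^+ 2)^-1%:C * (\sum_(j <- J) G j y + X y).
  by rewrite /X addrC subrK mulrA -rmorphM mulVf// mul1r.
have iG j := til (cG j) (hG j); have iX := til cX hX.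
have iS : tail_integrable (fun y => \sum_(j <- J) G j y + X y).
  move=> y; apply: (@cintegrableD _ _ (fun y => \sum_(j <- J) G j y) X) => //.
  by apply: (cintegrable_sum _ _ _).1 => // j; exact: iG.
rewrite (tail_ext 0 LaE) tailZ// tail_sum//.
set s1 := tail _ 0; set s2 := \sum_(j <- J) _.
have -> : s1 - (eps ^+ 2)%:C * ((4 * pi ^+ 2)^-1%:C * (s2 + tail X 0)) =
  (s1 - tail (fun y => Y y * Y y) 0) +
  (tail (fun y => Y y * Y y) 0 - (eps ^+ 2 / (4 * pi ^+ 2))%:C * s2) -
  (eps ^+ 2 / (4 * pi ^+ 2))%:C * tail X 0.
  by rewrite (rmorphM _ (eps ^+ 2)); ring.
apply: (le_trans (cabsB _ _)).
have -> : sum_c6 * eps ^+ 3 = (sum_c5 * (sum_c1 + Btot * t) / be * eps ^+ 3 +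
  2 * a1 * t ^+ 3 * Btot ^+ 2 * eps ^+ 3) + 1 * (eps ^+ 3 / be) by rewrite /sum_c6; ring.
apply: lerD.
  by apply: (le_trans (cabsD _ _)); apply: lerD.
rewrite cabsM; apply: ler_pM; rewrite ?cabs_ge0//; last first.
  by have := tl cX hX (lexx 0); rewrite mulr0 oppr0 expR0 mulr1.
rewrite cabs_real ger0_norm; last by rewrite divr_ge0 ?exprn_ge0 ?mulr_ge0 ?exprn_ge0 ?pi_ge0// ltW.
rewrite ler_pdivrMr ?mulr_gt0 ?exprn_gt0 ?pi_gt0// mul1r.
apply: (@le_trans _ _ 1); first by rewrite exprn_ile1// ltW.
have := pi_ge2 R; nra.
Qed.

End ModeSum.

(** * The Wronskian *)

Section Wronskian.
Context {R : realType}.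
Implicit Types (k : R[i]) (V La U : R -> R).

Definition wr_const (K0 D s l m : R) : R :=
  2 * K0 * D * D + s * (1 + D) * (1 + D) + 2 * (D * l) + 2 * ((1 + D) * m).

(** F and G are the values and derivatives at 0 on the two half-lines, S the integrals of the
    potential and L the quadratic terms. S1 and S2 need not be small separately: each is multiplied
    by the other solution's value, so that only [(S1 + S2) * F1 * F2] remains. *)
Lemma wronskian_expansion (K0 D s l m eps : R) (k F1 G1 F2 G2 S1 S2 L1 L2 : R[i]) :
  0 < eps -> eps <= 1 -> cabs k <= K0 ->
  cabs (F1 - 1) <= D * eps ^+ 2 -> cabs (F2 - 1) <= D * eps ^+ 2 ->
  cabs (S1 + S2) <= s * eps ^+ 3 -> cabs L1 <= l * eps ^+ 2 -> cabs L2 <= l * eps ^+ 2 ->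
  cabs (G1 + 'i * k * F1 - (2 * 'i * k - S1 * F1 + L1)) <= m * eps ^+ 3 ->
  cabs (G2 + 'i * k * F2 - (2 * 'i * k - S2 * F2 + L2)) <= m * eps ^+ 3 ->
  cabs (- (F1 * G2 + F2 * G1) + 2 * 'i * k + (L1 + L2)) <= wr_const K0 D s l m * eps ^+ 3.
Proof.
move=> e0 e1 hk hF1 hF2 hS hL1 hL2; set r1 := (X in cabs X <= m * _ -> _) => h1.
set r2 := (X in cabs X <= _) => h2.
have e2 : 0 < eps ^+ 2 by exact: exprn_gt0.
have e3 : 0 < eps ^+ 3 by exact: exprn_gt0.
have D0 : 0 <= D by rewrite -(pmulr_lge0 _ e2) (le_trans (cabs_ge0 _) hF1).
have l0 : 0 <= l by rewrite -(pmulr_lge0 _ e2) (le_trans (cabs_ge0 _) hL1).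
have m0 : 0 <= m by rewrite -(pmulr_lge0 _ e3) (le_trans (cabs_ge0 _) h1).
have s0 : 0 <= s by rewrite -(pmulr_lge0 _ e3) (le_trans (cabs_ge0 _) hS).
have K00 : 0 <= K0 := le_trans (cabs_ge0 _) hk.
have e21 : eps ^+ 2 <= 1 by apply: exprn_ile1 => //; exact: ltW.
have e43 : eps ^+ 2 * eps ^+ 2 <= eps ^+ 3.
  by rewrite -exprD (exprS _ 3); apply: ler_piMl => //; exact: ltW.
have bF F : cabs (F - 1) <= D * eps ^+ 2 -> cabs F <= 1 + D.
  move=> h; have -> : F = 1 + (F - 1) by ring.
  apply: (le_trans (cabsD _ _)); rewrite (cabs_nat 1); apply: lerD => //.
  by apply: (le_trans h); exact: ler_piMr.
have -> : - (F1 * G2 + F2 * G1) + 2 * 'i * k + (L1 + L2) =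
  2 * ('i * k * (F1 - 1) * (F2 - 1)) + (S1 + S2) * F1 * F2 -
  ((F1 - 1) * L2 + (F2 - 1) * L1) - (F1 * r2 + F2 * r1) by rewrite /r1 /r2; ring.
have -> : wr_const K0 D s l m * eps ^+ 3 = 2 * (K0 * D * D * eps ^+ 3) +
   s * eps ^+ 3 * (1 + D) * (1 + D) + (D * l * eps ^+ 3 + D * l * eps ^+ 3) +
   ((1 + D) * (m * eps ^+ 3) + (1 + D) * (m * eps ^+ 3)).
  by rewrite /wr_const; ring.
have hFL F L : cabs (F - 1) <= D * eps ^+ 2 -> cabs L <= l * eps ^+ 2 ->
    cabs ((F - 1) * L) <= D * l * eps ^+ 3.
  move=> hF hL; rewrite cabsM.
  apply: (@le_trans _ _ (D * eps ^+ 2 * (l * eps ^+ 2))); first by apply: ler_pM; rewrite ?cabs_ge0.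
  by rewrite mulrACA ler_wpM2l// mulr_ge0.
have hFr F r : cabs (F - 1) <= D * eps ^+ 2 -> cabs r <= m * eps ^+ 3 ->
    cabs (F * r) <= (1 + D) * (m * eps ^+ 3).
  by move=> hF hr; rewrite cabsM; apply: ler_pM; rewrite ?cabs_ge0 ?bF.
apply: (le_trans (cabsB _ _)); apply: lerD; last first.
  by apply: (le_trans (cabsD _ _)); apply: lerD; exact: hFr.
apply: (le_trans (cabsB _ _)); apply: lerD; last first.
  by apply: (le_trans (cabsD _ _)); apply: lerD; exact: hFL.
apply: (le_trans (cabsD _ _)); apply: lerD.
  rewrite cabsM (cabs_nat 2); apply: ler_wpM2l => //.
  rewrite !cabsM cabs_i mul1r.
  apply: (@le_trans _ _ (K0 * (D * eps ^+ 2) * (D * eps ^+ 2))).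
    by apply: ler_pM => //; rewrite ?mulr_ge0 ?cabs_ge0//; apply: ler_pM; rewrite ?cabs_ge0.
  have -> : K0 * (D * eps ^+ 2) * (D * eps ^+ 2) = K0 * D * D * (eps ^+ 2 * eps ^+ 2) by ring.
  by rewrite ler_wpM2l// !mulr_ge0.
rewrite !cabsM; apply: ler_pM; rewrite ?mulr_ge0 ?cabs_ge0 ?bF//.
by apply: ler_pM; rewrite ?cabs_ge0 ?bF.
Qed.


Definition is_mode_family be theta Btot (p0 p1 p2 : int -> R -> R[i]) (B lam : int -> R)
    (J : seq int) : Prop :=
  [/\ (forall j, is_mode be (B j) (p0 j) (p1 j) (p2 j)), \sum_(j <- J) B j <= Btot, uniq J &
   [/\ {in J, forall j, - j \in J}, {in J, forall j, theta <= `|lam j|},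
     {in J, forall j, lam (- j) = - lam j},
     {in J &, forall j l, j != l -> theta <= `|lam j - lam l|} &
     {in J, forall j x, p0 (- j) x = conjc (p0 j x)}]].

Definition mode_approx be eps p0 lam J V La : Prop :=
  (forall x, cabs ((V x)%:C - \sum_(j <- J) p0 j x * osc (freq eps lam j) x) <=
    eps ^+ 3 * expR (- (be * `|x|))) /\
  (forall x, `|4 * pi ^+ 2 * La x - \sum_(j <- J) cabs (p0 j x) ^+ 2 / lam j ^+ 2| <=
    eps ^+ 3 * expR (- (be * `|x|))).

Lemma is_mode_family_reflect be theta Btot p0 p1 p2 B lam J :
  is_mode_family be theta Btot p0 p1 p2 B lam J ->
  is_mode_family be theta Btot (fun j x => p0 j (- x)) (fun j x => - p1 j (- x))
    (fun j x => p2 j (- x)) B (fun j => - lam j) J.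
Proof.
move=> [hp hB uJ [JN lg lo ls pc]]; split => //.
  by move=> j; exact: is_mode_reflect.
split => //.
- by move=> j /lg; rewrite normrN.
- by move=> j /lo ->.
- by move=> j l jJ lJ jl; rewrite -opprD normrN; exact: ls.
- by move=> j jJ x; exact: pc.
Qed.

Lemma mode_approx_reflect be eps p0 lam J V La : mode_approx be eps p0 lam J V La ->
  mode_approx be eps (fun j x => p0 j (- x)) (fun j => - lam j) J
    (fun x => V (- x)) (fun x => La (- x)).
Proof.
move=> [hV hLa]; split => x; rewrite -(normrN x).
- have -> : \sum_(j <- J) p0 j (- x) * osc (freq eps (fun j => - lam j) j) x =
    \sum_(j <- J) p0 j (- x) * osc (freq eps lam j) (- x).
    apply: eq_bigr => j _; congr (_ * _); rewrite /osc /freq; congr cexp.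
    by rewrite mulrN mulNr !rmorphN mulrN !mulNr mulrN.
  exact: hV.
- have -> : \sum_(j <- J) cabs (p0 j (- x)) ^+ 2 / (- lam j) ^+ 2 =
    \sum_(j <- J) cabs (p0 j (- x)) ^+ 2 / lam j ^+ 2.
    by apply: eq_bigr => j _; rewrite sqrrN.
  exact: hLa.
Qed.


(** The half-line lemmas take a single constant for the three tails; the sum dominates each of
    them. *)
Definition mode_const be theta Btot : R :=
  sum_c1 be theta Btot + sum_c2 be theta Btot + sum_c3 be theta Btot.

Lemma tail_cst_bound be A La : 0 < be -> continuous La ->
  (forall x, `|La x| <= A * expR (- (be * `|x|))) -> cabs (tail (fun y => (La y)%:C) 0) <= A / be.
Proof.
move=> be0 cLa hLa; have := @tail_bound _ (fun y => (La y)%:C) A be 0 be0 (ccont_real cLa).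
rewrite mulr0 oppr0 expR0 mulr1; apply => y y0; rewrite cabs_real.
by have := hLa y; rewrite (gtr0_norm y0).
Qed.

Section HalfLineSum.
Variables (al be theta Btot A K0 eps : R) (V La : R -> R) (k : R[i]).
Hypotheses (al0 : 0 < al) (albe : al < be / 2) (A0 : 0 < A) (theta0 : 0 < theta).
Hypotheses (eps0 : 0 < eps) (eps1 : eps <= 1).
Hypotheses (cLa : continuous La).
Hypotheses (hk : `|complex.Im k| <= al) (hkK : cabs k <= K0).

Let be0 : 0 < be. Proof. by move: al0 albe; lra. Qed.
Let K00 : 0 <= K0 := le_trans (cabs_ge0 _) hkK.

Lemma half_line_oscillating p0 p1 p2 B lam J f f1 :
  continuous V -> (forall x, `|V x| <= A * expR (- (be * `|x|))) ->
  is_mode_family be theta Btot p0 p1 p2 B lam J -> mode_approx be eps p0 lam J V La ->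
  half_jost al be A V k f f1 ->
  let c := mode_const be theta Btot in
  cabs (f 0 - 1) <= hlD al be A K0 c * eps ^+ 2 /\
  cabs (f1 0 + 'i * k * f 0 - (2 * 'i * k - tail (fun y => (V y)%:C) 0 * f 0 +
     (eps ^+ 2)%:C * tail (fun y => (La y)%:C) 0)) <=
  (hlM al be A K0 c + sum_c6 be theta Btot) * eps ^+ 3.
Proof.
move=> cV hVA [hp hB uJ [JN lg lo ls pc]] [hV hLa'] [df df1 hf f1E fE] c.
have Bt0 : 0 <= Btot.
  by apply: le_trans hB; apply: sumr_ge0 => j _; exact: mode_B_ge0 (hp j).
have t0 : 0 <= (2 * pi * theta)^-1 by rewrite invr_ge0 !mulr_ge0 ?pi_ge0// ltW.
have a0 : 0 <= osc_const be := osc_const_ge0 be0.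
have bi0 : 0 <= be^-1 by rewrite invr_ge0 ltW.
have [c1 c2 c3] : [/\ 0 <= sum_c1 be theta Btot, 0 <= sum_c2 be theta Btot &
    0 <= sum_c3 be theta Btot].
  rewrite /sum_c1 /sum_c2 /sum_c3.
  move: (osc_const be) (2 * pi * theta)^-1 be^-1 a0 t0 bi0 => a t b a0 t0 bi0.
  by split; rewrite addr_ge0 ?mulr_ge0 ?exprn_ge0 ?addr_ge0.
have c0 : 0 <= c by rewrite /c /mode_const; lra.
have mono d n y (F : R -> R[i]) : d <= c ->
    cabs (F y) <= d * eps ^+ n * expR (- (be * y)) ->
    cabs (F y) <= c * eps ^+ n * expR (- (be * y)).
  move=> dc h; apply: (le_trans h); rewrite ler_wpM2r ?expR_ge0// ler_wpM2r// exprn_ge0// ltW//.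
have hT1 y : 0 <= y -> cabs (tail (fun y => (V y)%:C) y) <= c * eps * expR (- (be * y)).
  move=> y0; apply: (mono (sum_c1 be theta Btot) 1%N).
    by rewrite /c /mode_const; lra.
  exact: (sum_T1 be0 theta0 eps0 eps1 hp hB lg cV hV).
have hT2 y : 0 <= y -> cabs (tail (tail (fun y => (V y)%:C)) y) <= c * eps ^+ 2 * expR (- (be * y)).
  move=> y0; apply: (mono (sum_c2 be theta Btot) 2%N).
    by rewrite /c /mode_const; lra.
  exact: (sum_T2 be0 theta0 eps0 eps1 hp hB lg cV hV).
have hT3 y : 0 <= y -> cabs (tail (tail (tail (fun y => (V y)%:C))) y) <=
    c * eps ^+ 3 * expR (- (be * y)).
  move=> y0; apply: (mono (sum_c3 be theta Btot) 3%N).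
    by rewrite /c /mode_const; lra.
  exact: (sum_T3 be0 theta0 eps0 hp hB lg cV hV).
split.
  exact: (hl_f0 al0 albe A0 K00 cV hVA hk hkK df df1 hf f1E fE c0 eps0 hT1 hT2).
have := hl_expansion al0 albe A0 K00 cV hVA hk hkK df df1 hf f1E fE c0 eps0 eps1 hT1 hT2 hT3.
have := sum_T1_sqr be0 theta0 eps0 eps1 hp hB uJ JN lg lo ls (fun j x jJ => pc j jJ x) cV cLa hV hLa'.
set X := tail _ 0 => hX; set E := f1 0 + _ => hE.
set T := tail _ 0 in hE *.
have -> : E - (2 * 'i * k - T * f 0 + (eps ^+ 2)%:C * tail (fun y => (La y)%:C) 0) =
  (E - (2 * 'i * k - T * f 0 + X)) + (X - (eps ^+ 2)%:C * tail (fun y => (La y)%:C) 0) by ring.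
by rewrite [leRHS]mulrDl; apply: (le_trans (cabsD _ _)); exact: lerD.
Qed.

End HalfLineSum.

Section Potential.
Variables (al be theta Btot A K0 eps : R) (V La : R -> R) (k : R[i]).
Hypotheses (al0 : 0 < al) (albe : al < be / 2) (A0 : 0 < A) (theta0 : 0 < theta).
Hypotheses (eps0 : 0 < eps) (eps1 : eps <= 1).
Hypotheses (cLa : continuous La) (hLa : forall x, `|La x| <= A * expR (- (be * `|x|))).
Hypotheses (hk : `|complex.Im k| <= al) (hkK : cabs k <= K0).

Let be0 : 0 < be. Proof. by move: al0 albe; lra. Qed.
Let K00 : 0 <= K0 := le_trans (cabs_ge0 _) hkK.

Definition osc_wr_const : R :=
  let c := mode_const be theta Btot in
  wr_const K0 (hlD al be A K0 c) (2 * sum_c4 be theta Btot) (A / be)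
    (hlM al be A K0 c + sum_c6 be theta Btot).

Let hL (L : R -> R) : continuous L -> (forall x, `|L x| <= A * expR (- (be * `|x|))) ->
  cabs ((eps ^+ 2)%:C * tail (fun y => (L y)%:C) 0) <= A / be * eps ^+ 2.
Proof.
move=> cL hL; rewrite cabsM cabs_real ger0_norm ?exprn_ge0// ?(ltW eps0)// mulrC.
by rewrite ler_wpM2r ?exprn_ge0 ?(ltW eps0)// tail_cst_bound.
Qed.

Let opp_cont (F : R -> R) : continuous F -> continuous (fun x => F (- x)).
Proof. by move=> cF x; apply: (continuous_comp (f := fun y => - y)); [apply: cvgN; exact: cvg_id|exact: cF]. Qed.

Lemma wronskian_oscillating p0 p1 p2 B lam J U :
  continuous V -> (forall x, `|V x| <= A * expR (- (be * `|x|))) ->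
  is_mode_family be theta Btot p0 p1 p2 B lam J -> mode_approx be eps p0 lam J V La ->
  measurable_fun setT U -> {ae lebesgue_measure, forall y, V y = U y} ->
  cabs (jost_wronskian U k + 2 * 'i * k + (eps ^+ 2)%:C *
    (tail (fun y => (La y)%:C) 0 + tail (fun y => (La (- y))%:C) 0)) <= osc_wr_const * eps ^+ 3.
Proof.
move=> cV hVA fam apx mU VU.
have [f [f1 [g [g1 [hf hg ->]]]]] :=
  jost_wronskian_half_lines al0 albe A0 cV hVA mU VU hk.
have fam' := is_mode_family_reflect fam; have apx' := mode_approx_reflect apx.
have cV' := opp_cont cV; have cLa' := opp_cont cLa.
have hVA' x : `|V (- x)| <= A * expR (- (be * `|x|)) by have := hVA (- x); rewrite normrN.
have hLa' x : `|La (- x)| <= A * expR (- (be * `|x|)) by have := hLa (- x); rewrite normrN.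
rewrite mulrDr; apply: (@wronskian_expansion _ _ _ _ _ eps k _ _ _ _
  (tail (fun y => (V y)%:C) 0) (tail (fun y => (V (- y))%:C) 0)) => //.
- exact: (half_line_oscillating al0 albe A0 theta0 eps0 eps1 cLa hk hkK cV hVA fam apx hf).1.
- exact: (half_line_oscillating al0 albe A0 theta0 eps0 eps1 cLa' hk hkK cV' hVA' fam' apx' hg).1.
- have [hp hB uJ [JN lg lo ls pc]] := fam.
  have [hp' hB' uJ' [JN' lg' lo' ls' pc']] := fam'.
  have h := sum_T1_at0 be0 theta0 eps0 hp hB lg cV apx.1.
  have h' := sum_T1_at0 be0 theta0 eps0 hp' hB' lg' cV' apx'.1.
  have E : sum_Z eps (fun j x => p0 j (- x)) (fun j x => - p1 j (- x)) (fun j => - lam j) J =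
     - sum_Z eps p0 p1 lam J.
    rewrite /sum_Z -sumrN; apply: eq_bigr => j _.
    have -> : ('i * (freq eps (fun j => - lam j) j)%:C)^-1 = - ('i * (freq eps lam j)%:C)^-1.
      by rewrite /freq mulrN mulNr rmorphN mulrN invrN.
    by rewrite oppr0; ring.
  set t1 := tail _ 0 in h *; set t2 := tail _ 0 in h' *.
  have -> : t1 + t2 = (t1 + sum_Z eps p0 p1 lam J) + (t2 + - sum_Z eps p0 p1 lam J) by ring.
  rewrite -E mulr2n !mulrDl mul1r; apply: (le_trans (cabsD _ _)); exact: lerD.
- exact: hL.
- exact: hL.
- exact: (half_line_oscillating al0 albe A0 theta0 eps0 eps1 cLa hk hkK cV hVA fam apx hf).2.
- exact: (half_line_oscillating al0 albe A0 theta0 eps0 eps1 cLa' hk hkK cV' hVA' fam' apx' hg).2.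
Qed.

Definition small_wr_const : R :=
  wr_const K0 (hlS al be A) 0 (A / be) (hlSM al be A).

(** The integral of V is itself the leading part here, so it takes the place of L in
    [wronskian_expansion], with S1 = S2 = 0. *)
Lemma wronskian_small U : V = (fun x => - (eps ^+ 2 * La x)) ->
  measurable_fun setT U -> {ae lebesgue_measure, forall y, V y = U y} ->
  cabs (jost_wronskian U k + 2 * 'i * k + (eps ^+ 2)%:C *
    (tail (fun y => (La y)%:C) 0 + tail (fun y => (La (- y))%:C) 0)) <= small_wr_const * eps ^+ 3.
Proof.
move=> VE mU VU.
have e20 : 0 <= eps ^+ 2 by rewrite exprn_ge0// ltW.
have e21 : eps ^+ 2 <= 1 by apply: exprn_ile1 => //; exact: ltW.
have hcont (L : R -> R) : continuous L -> continuous (fun x => - (eps ^+ 2 * L x)).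
  by move=> cL x; apply: cvgN; apply: cvgM; [exact: cvg_cst|exact: cL].
have hs (L : R -> R) : (forall x, `|L x| <= A * expR (- (be * `|x|))) ->
    forall x, `|- (eps ^+ 2 * L x)| <= A * eps ^+ 2 * expR (- (be * `|x|)).
  move=> h x; rewrite normrN normrM (ger0_norm e20).
  have -> : A * eps ^+ 2 * expR (- (be * `|x|)) = eps ^+ 2 * (A * expR (- (be * `|x|))) by ring.
  by rewrite ler_wpM2l.
have hb (L : R -> R) : (forall x, `|L x| <= A * expR (- (be * `|x|))) ->
    forall x, `|- (eps ^+ 2 * L x)| <= A * expR (- (be * `|x|)).
  move=> h x; apply: (le_trans (hs L h x)); rewrite ler_wpM2r ?expR_ge0//.
  by rewrite ler_piMr// ltW.
have cLa' := opp_cont cLa.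
have hLa' x : `|La (- x)| <= A * expR (- (be * `|x|)) by have := hLa (- x); rewrite normrN.
move: VU; rewrite VE => VU.
have [f [f1 [g [g1 [hf hg ->]]]]] :=
  jost_wronskian_half_lines al0 albe A0 (hcont _ cLa) (hb _ hLa) mU VU hk.
have tE (L : R -> R) : continuous L -> (forall x, `|L x| <= A * expR (- (be * `|x|))) ->
   tail (fun y => (- (eps ^+ 2 * L y))%:C) 0 = - ((eps ^+ 2)%:C * tail (fun y => (L y)%:C) 0).
  move=> cL bL; rewrite -mulNr -tailZ; last first.
    apply: (exp_decay_tail_integrable (ccont_real cL)); apply: (exp_decay_intro be0 (M := A)).
    by move=> y y0; rewrite cabs_real; have := bL y; rewrite (ger0_norm y0).
  by apply: tail_ext => y; rewrite rmorphN rmorphM mulNr.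
have step (L : R -> R) h h1 : continuous L -> (forall x, `|L x| <= A * expR (- (be * `|x|))) ->
    half_jost al be A (fun x => - (eps ^+ 2 * L x)) k h h1 ->
    cabs (h 0 - 1) <= hlS al be A * eps ^+ 2 /\
    cabs (h1 0 + 'i * k * h 0 - (2 * 'i * k - 0 * h 0 +
      (eps ^+ 2)%:C * tail (fun y => (L y)%:C) 0)) <= hlSM al be A * eps ^+ 3.
  move=> cL bL [dh dh1 hh h1E hE]; split.
    exact: (hl_small_f0 al0 albe A0 (hcont _ cL) hk dh hh hE eps0 (hs _ bL)).
  have := hl_small_expansion al0 albe A0 K00 (hcont _ cL) (hb _ bL) hk dh hh h1E hE eps0 (hs _ bL).
  rewrite tE// opprK mul0r subr0 => K; apply: (le_trans K).
  rewrite ler_wpM2l//; last by rewrite exprS ler_piMl// exprn_ge0// ltW.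
  have d := jgap_gt0 albe; rewrite /hlSM /hlS.
  by rewrite !mulr_ge0 ?expR_ge0// ?invr_ge0 ltW.
rewrite mulrDr; apply: (@wronskian_expansion _ _ _ _ _ eps k _ _ _ _ 0 0) => //.
- exact: (step _ _ _ cLa hLa hf).1.
- exact: (step _ _ _ cLa' hLa' hg).1.
- by rewrite addr0 cabs0 mul0r.
- exact: hL.
- exact: hL.
- exact: (step _ _ _ cLa hLa hf).2.
- exact: (step _ _ _ cLa' hLa' hg).2.
Qed.

End Potential.

End Wronskian.

(** * The du Bois-Reymond lemma *)

Section Bump.
Context {R : realType}.
Implicit Types (x y : R) (m n : nat).

Lemma is_derive_sqr_bound (f : R -> R) x (C : R) :
  (forall h, `|f (h + x) - f x| <= C * h ^+ 2) -> is_derive x 1 f 0.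
Proof.
move=> hf.
have C0 : 0 <= C by have := le_trans (normr_ge0 _) (hf 1); rewrite expr1n mulr1.
have K : h^-1 *: ((f \o shift x) (h *: (1 : R)) - f x) @[h --> 0^'] --> (0 : R).
  apply/cvgrPdist_le => e e0; rewrite near_withinE; near=> h => h0.
  rewrite sub0r normrN normrM normfV mulrC ler_pdivrMr ?normr_gt0//.
  have hE : (f \o shift x) (h *: (1 : R)) = f (h + x) by rewrite /= /GRing.scale /= mulr1.
  rewrite hE; apply: (le_trans (hf h)).
  rewrite -real_normK ?num_real// expr2 mulrA ler_wpM2r//.
  have hd : `|h| <= e / (C + 1).
    by near: h; apply: (@nbhs0_le _ R^o); rewrite divr_gt0// ltr_wpDl.
  apply: (@le_trans _ _ ((C + 1) * `|h|)); first by rewrite ler_wpM2r// lerDl.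
  by rewrite mulrC -ler_pdivlMr// ltr_wpDl.
split; last exact: cvg_lim K.
by apply/cvg_ex; exists 0.
Unshelve. all: by end_near. Qed.

(** The classical exp(- 1/x), extended by 0; the negative powers make the family closed under
    derivation. *)
Definition flat m x : R := if 0 < x then x^-1 ^+ m * expR (- x^-1) else 0.

Lemma flat_le0 m x : x <= 0 -> flat m x = 0.
Proof. by move=> x0; rewrite /flat ltNge x0. Qed.

Lemma flat_ge0 m x : 0 <= flat m x.
Proof.
rewrite /flat; case: ifP => // x0; rewrite mulr_ge0 ?expR_ge0// exprn_ge0//.
by rewrite invr_ge0 ltW.
Qed.

(** The term of order m + 2 of the exponential series beats the power x^(-m) with two powers to
    spare, which makes the derivative at 0 vanish. *)
Lemma flat_sqr m x : 0 < x -> flat m x <= (m.+2)`!%:R * x ^+ 2.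
Proof.
move=> x0; rewrite /flat x0 expRN.
have xi : 0 <= x^-1 by rewrite invr_ge0 ltW.
have f0 : 0 < (m.+2)`!%:R :> R by rewrite ltr0n fact_gt0.
have h : x^-1 ^+ m.+2 / (m.+2)`!%:R <= expR x^-1.
  by apply: le_trans (expR_ge1Dxn m.+1 xi); rewrite lerDr.
rewrite ler_pdivrMr ?expR_gt0//.
have -> : x^-1 ^+ m = (m.+2)`!%:R * x ^+ 2 * (x^-1 ^+ m.+2 / (m.+2)`!%:R).
  by rewrite !exprS expr0; field; rewrite gt_eqF//= gt_eqF.
by apply: ler_wpM2l => //; rewrite mulr_ge0// ?exprn_ge0// ltW.
Qed.

Lemma is_derive_flat m x : is_derive x 1 (flat m) (flat m.+2 x - m%:R * flat m.+1 x).
Proof.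
have [x0|x0] := leP x 0.
  rewrite !flat_le0// mulr0 subr0; apply: (@is_derive_sqr_bound _ _ (m.+2)`!%:R) => h.
  rewrite (flat_le0 _ x0) subr0 ger0_norm ?flat_ge0//.
  have [hx|hx] := leP (h + x) 0; first by rewrite flat_le0// mulr_ge0// sqr_ge0.
  apply: (le_trans (flat_sqr m hx)); apply: ler_wpM2l => //.
  by rewrite lerXn2r ?nnegrE ?(ltW hx)//; [move: x0 hx; lra|move: x0; lra].
have xn0 : x != 0 by rewrite gt_eqF.
apply: (@near_eq_is_derive _ _ _ (fun y => y^-1 ^+ m * expR (- y^-1))).
  near=> y; rewrite /flat ifT//; near: y; exact: lt_nbhsr.
have dV := is_deriveV xn0 (is_derive_id x (1 : R)).
have dE := is_derive_comp1 (is_deriveN dV) (is_derive_expR (- x^-1)).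
have dX : is_derive x^-1 1 (fun z : R => z ^+ m) (m%:R * x^-1 ^+ m.-1).
  by split; [exact: exprn_derivable|rewrite -derive1E exp_derive1].
apply: (is_derive_eq (is_deriveM (is_derive_comp1 dV dX) dE)).
rewrite /flat x0 /GRing.scale /=.
rewrite opprfctE; move: (expR _) => E; case: m {dX} => [|m] /=.
  by rewrite !exprS expr0; field.
by rewrite !exprS; field.
Unshelve. all: by end_near. Qed.

(** A class stable under derivation. The iterated derivatives never leave it, so differentiability
    of all orders follows from the first order. *)
Inductive smooth_class : (R -> R) -> Prop :=
| SmoothBase m n (s t : R) : smooth_class (fun x => flat m (s * x + t) * flat n (1 - (s * x + t)))
| SmoothScale (a : R) f : smooth_class f -> smooth_class (fun x => a * f x)
| SmoothAdd f g : smooth_class f -> smooth_class g -> smooth_class (fun x => f x + g x).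

Lemma smooth_class_derive f : smooth_class f ->
  exists2 g, smooth_class g & forall x, is_derive x 1 f (g x).
Proof.
elim => {f} [m n s t|a f _ [g sg dg]|f1 f2 _ [g1 s1 d1] _ [g2 s2 d2]].
- pose F i j x := flat i (s * x + t) * flat j (1 - (s * x + t)).
  exists (fun x => s * ((F m.+2 n x + - m%:R * F m.+1 n x) +
     ((-1) * F m n.+2 x + n%:R * F m n.+1 x))).
    by repeat constructor.
  move=> x.
  have d1 : is_derive x 1 (fun x => s * x + t) s.
    apply: (is_derive_eq (is_deriveD (is_derive_mulr s x) (is_derive_cst t x 1))).
    by rewrite addr0.
  have d2 : is_derive x 1 (fun x => 1 - (s * x + t)) (- s).
    apply: (is_derive_eq (is_deriveB (is_derive_cst (1 : R) x 1) d1)).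
    by rewrite sub0r.
  apply: (is_derive_eq (is_deriveM (is_derive_comp1 d1 (is_derive_flat m _))
    (is_derive_comp1 d2 (is_derive_flat n _)))).
  by rewrite /F /GRing.scale /=; ring.
- exists (fun x => a * g x); first by constructor.
  by move=> x; exact: (is_deriveZ a (dg x)).
- exists (fun x => g1 x + g2 x); first by constructor.
  by move=> x; exact: (is_deriveD (d1 x) (d2 x)).
Qed.

Lemma smooth_class_derivable f n x : smooth_class f -> derivable (derive1n n f) x 1.
Proof.
move=> sf; suff [g sg ->] : exists2 g, smooth_class g & derive1n n f = g.
  by have [h _ dh] := smooth_class_derive sg; have [] := dh x.
elim: n => [|n [g sg E]]; first by exists f.
have [h sh dh] := smooth_class_derive sg; exists h => //.
by rewrite derive1nS E; apply/funext => y; rewrite derive1E; exact: (dh y).(derive_val).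
Qed.

Definition bump x : R := flat 0 x * flat 0 (1 - x).

Lemma bump_ge0 x : 0 <= bump x. Proof. by rewrite mulr_ge0 ?flat_ge0. Qed.

Lemma bump_le1 x : bump x <= 1.
Proof.
have h y : flat 0 y <= 1.
  rewrite /flat; case: ifP => // y0; rewrite expr0 mul1r -expR0 ler_expR oppr_le0.
  by rewrite invr_ge0 ltW.
by rewrite -[leRHS]mulr1 ler_pM ?flat_ge0.
Qed.

Lemma bump_out x : (x <= 0) || (1 <= x) -> bump x = 0.
Proof.
move=> /orP[h|h]; rewrite /bump; first by rewrite (flat_le0 _ h) mul0r.
by rewrite [X in _ * X]flat_le0 ?mulr0// subr_le0.
Qed.

Lemma bump_gt0 x : 0 < x -> x < 1 -> 0 < bump x.
Proof.
by move=> x0 x1; rewrite /bump /flat x0 subr_gt0 x1 !expr0 !mul1r mulr_gt0 ?expR_gt0.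
Qed.

Lemma continuous_bump : continuous bump.
Proof.
have sb : smooth_class (fun x => flat 0 (1 * x + 0) * flat 0 (1 - (1 * x + 0))) by constructor.
have E : (fun x => flat 0 (1 * x + 0) * flat 0 (1 - (1 * x + 0))) = bump.
  by apply/funext => x; rewrite mul1r addr0.
move: sb; rewrite E => sb x; have [g _ dg] := smooth_class_derive sb.
by apply: differentiable_continuous; apply/derivable1_diffP; have [] := dg x.
Qed.

End Bump.

Section WholeLine.
Context {R : realType}.
Implicit Types (f : R -> R) (F G : R -> R[i]).
Let mu := @lebesgue_measure R.

Lemma integrable_setT_halves f : measurable_fun setT f ->
  mu.-integrable `]0, +oo[ (EFin \o f) ->
  mu.-integrable `]0, +oo[ (EFin \o (fun y => f (- y))) ->
  mu.-integrable setT (EFin \o f) /\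
  Rintegral mu setT f = Rintegral mu `]0, +oo[ f + Rintegral mu `]0, +oo[ (fun y => f (- y)).
Proof.
move=> mf i1 i2.
have [] := integrable_reflect (measurable_itv _) i2.
have -> : reflect `]0, +oo[ = `]-oo, (0 : R)[%classic.
  by apply/seteqP; split => x; rewrite /reflect /= !in_itv /= ?andbT oppr_gt0.
have -> : (fun y => f (- - y)) = f by apply/funext => y; rewrite opprK.
move=> i3 E2.
have mE D : measurable D -> measurable_fun D (EFin \o f).
  by move=> mD; apply/measurable_EFinP; exact: measurable_funTS.
have U : `]-oo, 0]%classic `|` `]0, +oo[%classic = [set: R].
  by apply/seteqP; split => // x _; rewrite /= !in_itv /= andbT; case: leP; [left|right].
have dU : [disjoint `]-oo, (0 : R)]%classic & `]0, +oo[%classic].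
  apply/disj_setPS => x []; rewrite /= !in_itv /= andbT => h1 h2.
  by move: (le_lt_trans h1 h2); rewrite ltxx.
have iT : mu.-integrable setT (EFin \o f).
  apply/integrableP; split; first exact: mE.
  rewrite -U ge0_integral_setU//; last by rewrite U; apply: measurableT_comp => //; exact: mE.
  rewrite -integral_itv_bndo_bndc; last by apply: measurableT_comp => //; exact: mE.
  by move/integrableP: i1 => [_ h1]; move/integrableP: i3 => [_ h3]; exact: lte_add_pinfty.
split => //; rewrite -U Rintegral_setU// ?U//.
by rewrite -Rintegral_itv_bndo_bndc// E2 addrC.
Qed.

Lemma cintegral_setT_halves F (be B : R) : 0 < be -> cmeasurable F ->
  {ae mu, forall x, cabs (F x) <= B * expR (- (be * `|x|))} ->
  cintegrable setT F /\ cintegral setT F = tail F 0 + tail (fun y => F (- y)) 0.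
Proof.
move=> be0 [m1 m2] hF.
have hF' : {ae mu, forall x, cabs (F (- x)) <= B * expR (- (be * `|x|))}.
  by apply: (ae_imp (ae_reflect hF)) => x; rewrite normrN.
have i1 : cintegrable `]0, +oo[ F.
  apply: (@tail_le _ F B be 0 be0 _ _).1; first by split; exact: measurable_funTS.
  by apply: (ae_imp hF) => y + y0; rewrite (gtr0_norm y0).
have i2 : cintegrable `]0, +oo[ (fun y => F (- y)).
  apply: (@tail_le _ (fun y => F (- y)) B be 0 be0 _ _).1.
    by split; apply: measurable_funTS; apply: (@measurableT_comp _ _ _ _ _ _ (_ \o F)) => //;
      exact: oppr_measurable.
  by apply: (ae_imp hF') => y + y0; rewrite (gtr0_norm y0).
have [j1 E1] := integrable_setT_halves m1 i1.1 i2.1.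
have [j2 E2] := integrable_setT_halves m2 i1.2 i2.2.
by split => //; rewrite /tail /cintegral E1 E2; apply: complex_ext.
Qed.

Lemma cintegral_restrict (D E : set R) F : measurable D -> measurable E -> E `<=` D ->
  (forall x, D x -> ~ E x -> F x = 0) -> cintegral D F = cintegral E F.
Proof.
move=> mD mE ED h.
have K (a : R -> R) : (forall x, D x -> ~ E x -> a x = 0) -> Rintegral mu D a = Rintegral mu E a.
  move=> ha; rewrite Rintegral_mkcond [RHS]Rintegral_mkcond; congr (Rintegral mu setT _).
  apply/funext => x; rewrite !patchE; case: ifPn; rewrite ?in_setE => hD; last first.
    by case: ifPn => //; rewrite in_setE => /ED; rewrite -in_setE (negbTE hD).
  by case: ifPn => // /negP hE; apply: ha => // Ex; apply: hE; rewrite in_setE.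
by rewrite /cintegral; congr (_ +i* _); apply: K => x Dx Ex; rewrite h.
Qed.

End WholeLine.

Section Plateau.
Context {R : realType}.
Implicit Types (x y : R).
Let mu := @lebesgue_measure R.

(** A smooth step: equal to the positive constant [bump_tail 0] up to 0, and to zero from 1 on. *)
Definition bump_tail x : R := Rintegral mu `]x, +oo[ bump.

Lemma exp_decay_bounded_support (F : R -> R[i]) (M K : R) : 0 <= M ->
  (forall y, cabs (F y) <= M) -> (forall y, K <= y -> F y = 0) -> exp_decay F.
Proof.
move=> M0 hM hK; apply: (@exp_decay_intro _ _ (M * expR K) 1) => // y _.
rewrite mul1r -mulrA -expRD; have [yK|Ky] := leP K y.
  by rewrite hK// cabs0 mulr_ge0// expR_ge0.
apply: (le_trans (hM y)); rewrite ler_peMr// -expR0 ler_expR subr_ge0; exact: ltW.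
Qed.

Let ib x : mu.-integrable `]x, +oo[ (EFin \o bump).
Proof.
have cb : ccont (fun y => (bump y)%:C) := ccont_real continuous_bump.
have eb : exp_decay (fun y => (bump y)%:C).
  apply: (@exp_decay_bounded_support _ 1 1) => // y.
    by rewrite cabs_real ger0_norm ?bump_ge0 ?bump_le1.
  by move=> y1; rewrite bump_out ?y1 ?orbT.
exact: (exp_decay_tail_integrable cb eb x).1.
Qed.

Lemma is_derive_bump_tail x : is_derive x 1 bump_tail (- bump x).
Proof. exact: Rtail_derive continuous_bump ib. Qed.

Lemma bump_tail_ge0 x : 0 <= bump_tail x.
Proof. by apply: Rintegral_ge0 => y _; exact: bump_ge0. Qed.

Lemma bump_tail_nonincr x y : x <= y -> bump_tail y <= bump_tail x.
Proof.
move=> xy; rewrite -lerN2.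
apply: (@is_derive_ge0_le _ (fun z => - bump_tail z) bump) => // t _; last exact: bump_ge0.
by apply: (is_derive_eq (is_deriveN (is_derive_bump_tail t))); rewrite opprK.
Qed.

Lemma bump_tail_ge1 x : 1 <= x -> bump_tail x = 0.
Proof.
move=> x1; have -> : bump_tail x = Rintegral mu `]x, +oo[ (fun=> 0).
  apply: eq_Rintegral => y /set_mem; rewrite /= in_itv /= andbT => xy.
  by rewrite -/(bump y) bump_out// (ltW (le_lt_trans x1 xy)) orbT.
by rewrite /Rintegral integral0.
Qed.

Lemma bump_tail_le0 x : x <= 0 -> bump_tail x = bump_tail 0.
Proof.
move=> x0; apply/eqP; rewrite eq_le (bump_tail_nonincr x0) andbT.
apply: (@is_derive_ge0_le _ bump_tail (fun y => - bump y)) => // t /andP[_ t0].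
  exact: is_derive_bump_tail.
by rewrite bump_out ?oppr0// t0.
Qed.

Lemma bump_tail_le x : bump_tail x <= bump_tail 0.
Proof.
have [x0|/ltW x0] := leP x 0; first by rewrite (bump_tail_le0 x0).
exact: bump_tail_nonincr.
Qed.

Lemma bump_tail_gt0 : 0 < bump_tail 0.
Proof.
rewrite lt_neqAle bump_tail_ge0 andbT eq_sym; apply/eqP => c0.
have z x : bump_tail x = 0.
  by apply/eqP; rewrite eq_le bump_tail_ge0 andbT -c0 bump_tail_le.
have h : is_derive (2^-1 : R) 1 bump_tail (- bump 2^-1) := is_derive_bump_tail _.
have h' : is_derive (2^-1 : R) 1 bump_tail 0.
  rewrite (_ : bump_tail = cst 0); last by apply/funext => x; exact: z.
  exact: is_derive_cst.
have := @bump_gt0 R 2^-1; rewrite invr_gt0 ltr0n invf_lt1// ltr1n => /(_ isT isT).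
have [_ e1] := h; have [_ e2] := h'.
by rewrite -oppr_lt0 -e1 e2 ltxx.
Qed.

(** Rises by [bump_tail 0] on [a, a + d] and falls by as much on [N, N + 1]. For small d and large N
    its derivative samples g just to the right of a and far out, where g is negligible. *)
Definition plateau (a d N x : R) : R := bump_tail (x - N) - bump_tail ((x - a) / d).

Definition plateau_der (a d N x : R) : R := d^-1 * bump ((x - a) / d) - bump (x - N).

Lemma is_derive_plateau a d N x : is_derive x 1 (plateau a d N) (plateau_der a d N x).
Proof.
have d1 : is_derive x 1 (fun x => x - N) 1.
  by apply: (is_derive_eq (is_deriveB (is_derive_id x (1 : R)) (is_derive_cst N x 1))); rewrite subr0.
have d2 : is_derive x 1 (fun x => (x - a) / d) d^-1.
  have d3 : is_derive x 1 (fun x => x - a) 1.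
    by apply: (is_derive_eq (is_deriveB (is_derive_id x (1 : R)) (is_derive_cst a x 1))); rewrite subr0.
  by apply: (is_derive_eq (is_deriveM d3 (is_derive_cst d^-1 x 1))); rewrite /GRing.scale /=; ring.
apply: (is_derive_eq (is_deriveB (is_derive_comp1 d1 (is_derive_bump_tail _))
  (is_derive_comp1 d2 (is_derive_bump_tail _)))).
by rewrite /plateau_der; ring.
Qed.

Lemma plateau_out a d N x : 0 < d -> a <= N -> x <= a -> plateau a d N x = 0.
Proof.
move=> d0 aN xa; rewrite /plateau bump_tail_le0 ?subr_le0 ?(le_trans xa)//.
by rewrite bump_tail_le0 ?subrr// pmulr_lle0 ?invr_gt0// subr_le0.
Qed.

Lemma plateau_der_out a d N x : 0 < d -> a <= N -> x <= a -> plateau_der a d N x = 0.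
Proof.
move=> d0 aN xa; rewrite /plateau_der !bump_out ?mulr0 ?subr0//.
  by rewrite subr_le0 (le_trans xa).
by rewrite pmulr_lle0 ?invr_gt0// subr_le0 xa.
Qed.

Lemma test_function_plateau a d N : 0 < d -> d <= 1 -> a <= N -> test_function (plateau a d N).
Proof.
move=> d0 d1 aN; split.
  have E : derive1 (plateau a d N) = plateau_der a d N.
    by apply/funext => x; rewrite derive1E; exact: (is_derive_plateau a d N x).(derive_val).
  case=> [|n] x; first by have [] := is_derive_plateau a d N x.
  rewrite /derive1n iterSr E; apply: smooth_class_derivable.
  have -> : plateau_der a d N = fun x =>
      d^-1 * (flat 0 (d^-1 * x + - a / d) * flat 0 (1 - (d^-1 * x + - a / d))) +
      (-1) * (flat 0 (1 * x + - N) * flat 0 (1 - (1 * x + - N))).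
    apply/funext => y; rewrite /plateau_der /bump mul1r mulN1r; congr (_ * (_ * _) - _);
      congr (flat 0 _); by field; rewrite gt_eqF.
  by repeat constructor.
exists (`|a| + `|N| + 1) => x hx.
have [x0|x0] := leP x 0.
  apply: plateau_out => //; move: hx; rewrite (ler0_norm x0).
  by have := ler_norm (- a); have := normr_ge0 N; rewrite normrN; lra.
move: hx; rewrite (gtr0_norm x0) => hx.
have h1 : 1 <= x - N by have := ler_norm N; have := normr_ge0 a; lra.
have h2 : 1 <= (x - a) / d.
  by rewrite ler_pdivlMr// mul1r; have := ler_norm a; have := normr_ge0 N; lra.
by rewrite /plateau !bump_tail_ge1// subrr.
Qed.

End Plateau.

(** * A decaying function is minus the tail of its weak derivative *)

Section DuBoisReymond.
Context {R : realType}.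
Let mu := @lebesgue_measure R.

Lemma lebesgue_pt_le (f : R -> R) (a e : R) : lebesgue_pt f a -> 0 < e ->
  \forall d \near 0^'+, (\int[mu]_(y in ball a d) `|f y - f a|%:E <= (e * d)%:E)%E.
Proof.
move=> /fine_cvgP[hf hc] e0; near=> d.
have d0 : 0 < d by near: d; exact: nbhs_right_gt.
have fin : davg f a d \is a fin_num by near: d.
(* The ball has length 2 d, so an average of at most e / 2 means an integral of at most e d. *)
have : fine (davg f a d) <= e / 2.
  by near: d; apply: (cvgr_le _ hc); rewrite divr_gt0.
rewrite -lee_fin fineK// /davg /iavg lebesgue_measure_ball ?(ltW d0)// inver.
have d2 : 0 < d *+ 2 by rewrite pmulrn_lgt0.
rewrite (gt_eqF d2) lee_pdivrMl// => h; apply: (le_trans h).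
by rewrite -EFinM lee_fin mulr2n; apply: eq_ler; field.
Unshelve. all: by end_near. Qed.

Variables (be B : R) (g h : R -> R[i]).
Hypotheses (be0 : 0 < be) (B0 : 0 <= B) (mg : cmeasurable g) (mh : cmeasurable h).
Hypothesis hg : {ae mu, forall x, cabs (g x) <= B * expR (- (be * `|x|))}.
Hypothesis hh : {ae mu, forall x, cabs (h x) <= B * expR (- (be * `|x|))}.
Hypothesis wd : weak_derivative g h.

Let mM (F : R -> R[i]) (f : R -> R) (D : set R) : cmeasurable F -> continuous f ->
  measurable D -> cmeasurable_on D (fun y => F y * (f y)%:C).
Proof.
move=> [m1 m2] cf mD; apply: cmeasurable_onM; last exact: (ccont_cmeasurable_on mD (ccont_real cf)).
by split; exact: measurable_funTS.
Qed.

Let cT : continuous (@bump_tail R).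
Proof.
move=> x; apply: differentiable_continuous; apply/derivable1_diffP.
by have [] := is_derive_bump_tail x.
Qed.

Let aff (f : R -> R) (s t : R) : continuous f -> continuous (fun x => f ((x - s) / t)).
Proof.
move=> cf x; apply: (continuous_comp (f := fun x => (x - s) / t)); last exact: cf.
by apply: cvgM; [apply: cvgB; [exact: cvg_id|exact: cvg_cst]|exact: cvg_cst].
Qed.

Let aff1 (f : R -> R) (s : R) : continuous f -> continuous (fun x => f (x - s)).
Proof.
move=> cf; have := @aff f s 1 cf.
by have -> : (fun x => f ((x - s) / 1)) = (fun x => f (x - s)) by apply/funext => x; rewrite divr1.
Qed.

Let iM (F : R -> R[i]) (f : R -> R) (M : R) : cmeasurable F ->
  {ae mu, forall x, cabs (F x) <= B * expR (- (be * `|x|))} -> continuous f ->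
  (forall x, `|f x| <= M) -> forall a, cintegrable `]a, +oo[ (fun y => F y * (f y)%:C).
Proof.
move=> mF hF cf hf a.
apply: (@tail_le _ (fun y => F y * (f y)%:C) (B * M) be a be0 _ _).1.
  exact: mM.
apply: (ae_imp hF) => y hy ay; rewrite cabsM cabs_real.
have M0 : 0 <= M := le_trans (normr_ge0 _) (hf 0).
apply: (@le_trans _ _ (B * expR (- (be * `|y|)) * M)).
  by apply: ler_pM; rewrite ?cabs_ge0.
rewrite mulrAC; apply: ler_wpM2l; first exact: mulr_ge0.
by rewrite ler_expR lerN2 ler_wpM2l ?ler_norm// ltW.
Qed.

(** The decay rate is split in halves: one half makes the tail integrable, the other gives smallness
    in N. *)
Let far (F : R -> R[i]) (f : R -> R) (M N a : R) : 0 <= N -> cmeasurable F ->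
  {ae mu, forall x, cabs (F x) <= B * expR (- (be * `|x|))} -> continuous f ->
  (forall x, `|f x| <= M) -> (forall x, x <= N -> f x = 0) ->
  cabs (tail (fun y => F y * (f y)%:C) a) <=
  B * M / (be / 2) * expR (- (be / 2 * a)) * expR (- (be / 2 * N)).
Proof.
move=> N0 mF hF cf hf hN.
have b20 : 0 < be / 2 by rewrite divr_gt0.
have M0 : 0 <= M := le_trans (normr_ge0 _) (hf 0).
have -> : B * M / (be / 2) * expR (- (be / 2 * a)) * expR (- (be / 2 * N)) =
   (B * M * expR (- (be / 2 * N))) / (be / 2) * expR (- (be / 2 * a)) by ring.
apply: (@tail_le _ (fun y => F y * (f y)%:C) _ (be / 2) a b20 _ _).2.
  exact: mM.
apply: (ae_imp hF) => y hy ay; rewrite cabsM cabs_real.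
have [yN|Ny] := leP y N.
  by rewrite hN// normr0 mulr0 !mulr_ge0 ?expR_ge0.
apply: (@le_trans _ _ (B * expR (- (be * `|y|)) * M)).
  by apply: ler_pM; rewrite ?cabs_ge0.
rewrite (gtr0_norm (le_lt_trans N0 Ny)) mulrAC -[leRHS]mulrA -expRD.
apply: ler_wpM2l; first exact: mulr_ge0.
by rewrite ler_expR; have := ler_wpM2l (ltW b20) (ltW Ny); lra.
Qed.

(** To the right of a the cut-off is supported in [a, a + d]. Dominating it by an exponential of
    rate 1/d lets [tail_le] produce the factor d. *)
Let near_part (F : R -> R[i]) (a d : R) : 0 < d -> cmeasurable F ->
  {ae mu, forall x, cabs (F x) <= B * expR (- (be * `|x|))} ->
  cabs (tail (fun y => F y * (bump_tail ((y - a) / d))%:C) a) <= B * bump_tail 0 * expR 1 * d.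
Proof.
move=> d0 mF hF; have di : 0 < d^-1 by rewrite invr_gt0.
have -> : B * bump_tail 0 * expR 1 * d =
   B * bump_tail 0 * expR (1 + d^-1 * a) / d^-1 * expR (- (d^-1 * a)).
  rewrite invrK expRD expRN; have := expR_gt0 (d^-1 * a).
  by move: (expR (d^-1 * a)) => u u0; field; rewrite gt_eqF.
apply: (@tail_le _ (fun y => F y * (bump_tail ((y - a) / d))%:C) _ d^-1 a di _ _).2.
  by apply: mM => //; exact: aff.
apply: (ae_imp hF) => y hy ay; rewrite cabsM cabs_real (ger0_norm (bump_tail_ge0 _)).
rewrite -mulrA -expRD -mulrA; apply: ler_pM; rewrite ?cabs_ge0 ?bump_tail_ge0//.
  apply: (le_trans hy); rewrite ler_piMr// -expR0 ler_expR oppr_le0.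
  by rewrite mulr_ge0// ltW.
have [z1|z1] := leP 1 ((y - a) / d).
  by rewrite bump_tail_ge1// mulr_ge0 ?bump_tail_ge0 ?expR_ge0.
apply: (le_trans (bump_tail_le _)); rewrite ler_peMr ?bump_tail_ge0// -expR0 ler_expR.
by rewrite expR0; move: z1; rewrite mulrBl ![_ / d]mulrC; lra.
Qed.

Let kernel_tail (a d : R) : 0 < d ->
  tail (fun y => (d^-1 * bump ((y - a) / d))%:C) a = (bump_tail 0)%:C /\
  tail_integrable (fun y => (d^-1 * bump ((y - a) / d))%:C).
Proof.
move=> d0; pose k y : R[i] := (d^-1 * bump ((y - a) / d))%:C.
have ck : ccont k.
  apply: ccont_real => x; apply: cvgM; first exact: cvg_cst.
  exact: (@aff _ a d continuous_bump x).
have big y : a + d <= y -> 1 <= (y - a) / d.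
  by move=> hy; rewrite ler_pdivlMr// mul1r; lra.
have ek : exp_decay k.
  apply: (@exp_decay_bounded_support _ _ d^-1 (a + d)) => [|y|y /big hy].
  - by rewrite invr_ge0 ltW.
  - rewrite cabs_real ger0_norm; last by rewrite mulr_ge0 ?bump_ge0// invr_ge0 ltW.
    by rewrite ler_piMr ?bump_le1// invr_ge0 ltW.
  - by rewrite /k bump_out ?hy ?orbT// mulr0.
split; last exact: exp_decay_tail_integrable.
have dG y : cder (fun y => (- bump_tail ((y - a) / d))%:C) y (k y).
  have d3 : is_derive y 1 (fun x => x - a) 1.
    by apply: (is_derive_eq (is_deriveB (is_derive_id y (1 : R)) (is_derive_cst a y 1))); rewrite subr0.
  have d2 : is_derive y 1 (fun x => (x - a) / d) d^-1.
    by apply: (is_derive_eq (is_deriveM d3 (is_derive_cst d^-1 y 1))); rewrite /GRing.scale /=; ring.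
  apply: cder_real; apply: (is_derive_eq (is_deriveN (is_derive_comp1 d2 (is_derive_bump_tail _)))).
  by ring.
have eG : exp_decay (fun y => (- bump_tail ((y - a) / d))%:C).
  apply: (@exp_decay_bounded_support _ _ (bump_tail 0) (a + d)) => [|y|y /big hy].
  - exact: bump_tail_ge0.
  - by rewrite cabs_real normrN ger0_norm ?bump_tail_ge0// bump_tail_le.
  - by rewrite bump_tail_ge1// oppr0.
by rewrite (tail_primitive _ ck ek dG eG) subrr mul0r rmorphN opprK.
Qed.

Let part_integral (f : R -> R) (a d e : R) : 0 < d -> measurable_fun setT f ->
  mu.-integrable `]a, a + d[ (EFin \o f) ->
  (\int[mu]_(y in ball a d) `|f y - f a|%:E <= (e * d)%:E)%E ->
  mu.-integrable `]a, a + d[ (EFin \o (fun y => `|f y - f a|)) /\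
  Rintegral mu `]a, a + d[ (fun y => `|f y - f a|) <= e * d.
Proof.
move=> d0 mf jf hf; have mD := @measurable_itv R `]a, a + d[.
have mG : measurable_fun setT (fun y => `|f y - f a|%:E).
  apply/measurable_EFinP; apply: measurableT_comp => //.
  by apply: measurable_funB => //; exact: measurable_cst.
have ic : mu.-integrable `]a, a + d[ (EFin \o (fun=> f a)).
  apply/integrableP; split; first exact: measurable_cst.
  rewrite integral_cst//; apply: lte_mul_pinfty => //.
  have := @lebesgue_measure_itv R `]a, a + d[ => /= ->.
  by rewrite lte_fin ltrDl d0 -EFinD ltry.
have jG : mu.-integrable `]a, a + d[ (EFin \o (fun y => `|f y - f a|)).
  have := @integrable_norm _ _ _ mu _ (fun y => f y - f a).
  apply => //; have := @integrableB _ _ _ mu _ mD _ _ jf ic; exact: eq_integrable.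
split => //; rewrite -lee_fin /Rintegral fineK; last exact: integrable_fin_num.
apply: le_trans hf; apply: ge0_subset_integral => //.
- exact: measurable_ball.
- exact: measurable_funTS.
- move=> y; rewrite /= in_itv/= => /andP[ay yd].
  by rewrite /ball /= ltr_norml; apply/andP; split; lra.
Qed.

Let kernel_part (a d e : R) : 0 < d ->
  (\int[mu]_(y in ball a d) `|complex.Re (g y) - complex.Re (g a)|%:E <= (e * d)%:E)%E ->
  (\int[mu]_(y in ball a d) `|complex.Im (g y) - complex.Im (g a)|%:E <= (e * d)%:E)%E ->
  cabs (tail (fun y => (g a - g y) * (d^-1 * bump ((y - a) / d))%:C) a) <= 2 * e.
Proof.
move=> d0 h1 h2; have [mg1 mg2] := mg; have mD := @measurable_itv R `]a, a + d[.
have di : 0 < d^-1 by rewrite invr_gt0.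
have sub : `]a, a + d[%classic `<=` `]a, +oo[%classic.
  by move=> y; rewrite /= !in_itv/= andbT => /andP[].
have ig : cintegrable `]a, a + d[ g.
  apply: (cintegrableS (measurable_itv _) mD sub).
  apply: (cintegrable_ext (measurable_itv _) _ (@iM g (fun=> 1) 1 mg hg _ _ a)).
  - by move=> y _; rewrite mulr1.
  - exact: cst_continuous.
  - by move=> x; rewrite normr1.
have [j1 b1] := @part_integral _ a d e d0 mg1 ig.1 h1.
have [j2 b2] := @part_integral _ a d e d0 mg2 ig.2 h2.
rewrite /tail (@cintegral_restrict R _ `]a, a + d[ _ _ _ sub) //; last first.
  move=> y; rewrite /= !in_itv/= andbT => ay /negP; rewrite ay/= -leNgt => ady.
  by rewrite bump_out ?mulr0 ?mulr0//; rewrite ler_pdivlMr// mul1r; apply/orP; right; lra.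
pose G y := `|complex.Re (g y) - complex.Re (g a)| + `|complex.Im (g y) - complex.Im (g a)|.
have iG : mu.-integrable `]a, a + d[ (EFin \o G).
  have := @integrableD _ _ _ mu _ mD _ _ j1 j2; exact: eq_integrable.
have idG : mu.-integrable `]a, a + d[ (EFin \o (fun y => d^-1 * G y)).
  have := @integrableZl _ _ _ mu _ mD d^-1 _ iG; exact: eq_integrable.
apply: (@le_trans _ _ (Rintegral mu `]a, a + d[ (fun y => d^-1 * G y))).
  have [] // := @cintegral_le R `]a, a + d[ (fun y => (g a - g y) * (d^-1 * bump ((y - a) / d))%:C)
    (fun y => d^-1 * G y) mD.
  - apply: (@mM (fun y => g a - g y)) => //.
      split.
        rewrite (_ : (fun _ => _) = fun x => complex.Re (g a) - complex.Re (g x)).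
          by apply: measurable_funB => //; exact: measurable_cst.
        by apply/funext => x; rewrite !ReImE.
      rewrite (_ : (fun _ => _) = fun x => complex.Im (g a) - complex.Im (g x)).
        by apply: measurable_funB => //; exact: measurable_cst.
      by apply/funext => x; rewrite !ReImE.
    move=> x; apply: cvgM; first exact: cvg_cst.
    exact: (@aff _ a d continuous_bump x).
  - apply: ae_all => y _.
    have k0 : 0 <= d^-1 * bump ((y - a) / d).
      by apply: mulr_ge0; [exact: ltW|exact: bump_ge0].
    rewrite cabsM cabs_real (ger0_norm k0) mulrC; apply: ler_pM; rewrite ?cabs_ge0 ?k0//.
      by rewrite ler_piMr ?bump_le1// ltW.
    by rewrite cabsBC; apply: (le_trans (cabs_le_ReIm _)); rewrite !ReImE.
rewrite RintegralZl// mulrC ler_pdivrMr//.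
have -> : Rintegral mu `]a, a + d[ G =
   Rintegral mu `]a, a + d[ (fun y => `|complex.Re (g y) - complex.Re (g a)|) +
   Rintegral mu `]a, a + d[ (fun y => `|complex.Im (g y) - complex.Im (g a)|).
  exact: RintegralD.
by rewrite mulr2n !mulrDl mul1r; exact: lerD.
Qed.

(** The weak derivative is tested with the plateau that starts at a. The rising part of its
    derivative is an approximate identity of mass [bump_tail 0], whence this factor. *)
Let at_point (a d e : R) : 0 < d -> d <= 1 ->
  (\int[mu]_(y in ball a d) `|complex.Re (g y) - complex.Re (g a)|%:E <= (e * d)%:E)%E ->
  (\int[mu]_(y in ball a d) `|complex.Im (g y) - complex.Im (g a)|%:E <= (e * d)%:E)%E ->
  bump_tail 0 * cabs (g a + tail h a) <= 2 * e + B * bump_tail 0 * expR 1 * d.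
Proof.
move=> d0 d1 h1 h2; rewrite -subr_le0; have b20 : 0 < be / 2 by rewrite divr_gt0.
pose c := @bump_tail R 0; have c0 : 0 <= c := bump_tail_ge0 0.
pose Y := B * 1 / (be / 2) * expR (- (be / 2 * a)) + B * c / (be / 2) * expR (- (be / 2 * a)).
(* The end N = |a| + x of the plateau is sent to infinity; Y collects the constants of the two terms
   beyond N. *)
apply: (@le_exp_decay0 _ _ Y (be / 2) b20) => x x0.
pose N := `|a| + x; have N0 : 0 <= N by rewrite addr_ge0.
have aN : a <= N by rewrite (le_trans (ler_norm a))// lerDl.
pose k y := d^-1 * bump ((y - a) / d).
pose s y : R := bump (y - N).
pose u y : R := bump_tail ((y - a) / d).
pose v y : R := c - bump_tail (y - N).
have ck : continuous k.
  by move=> y; apply: cvgM; [exact: cvg_cst|exact: (@aff _ a d continuous_bump y)].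
have cs : continuous s by exact: aff1 continuous_bump.
have cu : continuous u by exact: aff cT.
have cv : continuous v.
  by move=> y; apply: cvgB; [exact: cvg_cst|exact: (@aff1 _ N cT y)].
have hk y : `|k y| <= d^-1.
  have di : 0 <= d^-1 by rewrite invr_ge0 ltW.
  rewrite ger0_norm; first by rewrite ler_piMr// bump_le1.
  by apply: mulr_ge0 => //; exact: bump_ge0.
have hs y : `|s y| <= 1 by rewrite ger0_norm ?bump_ge0 ?bump_le1.
have hu y : `|u y| <= c by rewrite ger0_norm ?bump_tail_ge0 ?bump_tail_le.
have hv y : `|v y| <= c.
  by rewrite ger0_norm ?subr_ge0 ?bump_tail_le// gerBl bump_tail_ge0.
have igk := @iM g k _ mg hg ck hk a; have igs := @iM g s _ mg hg cs hs a.
have ihu := @iM h u _ mh hh cu hu a; have ihv := @iM h v _ mh hh cv hv a.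
have ih : cintegrable `]a, +oo[ h.
  apply: (cintegrable_ext (measurable_itv _) _ (@iM h (fun=> 1) 1 mh hh _ _ a)).
  - by move=> y _; rewrite mulr1.
  - exact: cst_continuous.
  - by move=> y; rewrite normr1.
have mI := @measurable_itv R `]a, +oo[.
have [kt ki] := kernel_tail a d0.
have igak : cintegrable `]a, +oo[ (fun y => g a * (k y)%:C) by exact: cintegrableZ.
have E1 : (c%:C * (g a + tail h a) : R[i]) =
   tail (fun y => (g a - g y) * (k y)%:C) a + tail (fun y => g y * (k y)%:C) a + c%:C * tail h a.
  rewrite -(cintegralD mI) //; last first.
    by apply: cintegrable_ext mI _ (cintegrableB mI igak igk) => y _; rewrite mulrBl.
  rewrite (@cintegral_ext R _ _ (fun y => g a * (k y)%:C)); last by move=> y _; ring.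
  by rewrite cintegralZ// -/(tail _ _) kt; ring.
have dom (f : R -> R) : continuous f -> (forall y, y <= a -> f y = 0) -> forall F,
    cintegral setT (fun y => F y * (f y)%:C) = tail (fun y => F y * (f y)%:C) a.
  move=> cf f0 F; apply: cintegral_restrict => // y _ /negP.
  by rewrite /= in_itv/= andbT -leNgt => ya; rewrite f0// mulr0.
have cp : continuous (plateau a d N).
  move=> y; apply: differentiable_continuous; apply/derivable1_diffP.
  by have [] := is_derive_plateau a d N y.
have E2 : tail (fun y => g y * (k y)%:C) a - tail (fun y => g y * (s y)%:C) a =
   - tail (fun y => h y * (plateau a d N y)%:C) a.
  have := wd (test_function_plateau d0 d1 aN).
  have -> : derive1 (plateau a d N) = plateau_der a d N.
    by apply/funext => y; rewrite derive1E; exact: (is_derive_plateau a d N y).(derive_val).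
  rewrite (dom (plateau a d N)) // => [|y]; last exact: plateau_out.
  rewrite (dom (plateau_der a d N)) => [|y|y]; last first.
  - exact: plateau_der_out.
  - by apply: cvgB; [exact: ck|exact: cs].
  move=> <-; rewrite -(cintegralB mI)//; apply: cintegral_ext => y _.
  by rewrite /plateau_der -/(k y) -/(s y) rmorphB mulrBr.
have E3 : c%:C * tail h a - tail (fun y => h y * (plateau a d N y)%:C) a =
    tail (fun y => h y * (v y)%:C) a + tail (fun y => h y * (u y)%:C) a.
  rewrite -(cintegralD mI) // -(cintegralZ _ mI) // -(cintegralB mI); last 2 first.
  - exact: cintegrableZ.
  - apply: (cintegrable_ext mI _ (cintegrableB mI (cintegrableZ c%:C mI ih)
      (cintegrableD mI ihv ihu))) => y _.
    by rewrite /plateau /v /u !rmorphB; ring.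
  by apply: cintegral_ext => y _; rewrite /plateau /v /u !rmorphB; ring.
have E : (c%:C * (g a + tail h a) : R[i]) =
   tail (fun y => (g a - g y) * (k y)%:C) a + tail (fun y => h y * (u y)%:C) a +
   (tail (fun y => g y * (s y)%:C) a + tail (fun y => h y * (v y)%:C) a).
  move: E1 E2 E3; move: (tail (fun y => (g a - g y) * (k y)%:C) a)
    (tail (fun y => g y * (k y)%:C) a) (tail (fun y => g y * (s y)%:C) a)
    (tail (fun y => h y * (plateau a d N y)%:C) a) (tail (fun y => h y * (v y)%:C) a)
    (tail (fun y => h y * (u y)%:C) a) (c%:C * tail h a) (c%:C * (g a + tail h a)).
  move=> A1 A2 A3 A4 A5 A6 A7 A8 -> E2 E3.
  have -> : A2 = A3 - A4 by rewrite -E2; ring.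
  have -> : A7 = A5 + A6 + A4 by rewrite -E3; ring.
  ring.
have -> : bump_tail 0 * cabs (g a + tail h a) = cabs (c%:C * (g a + tail h a)).
  by rewrite cabsM cabs_real ger0_norm.
rewrite E lerBlDr [leRHS]addrC; apply: (le_trans (cabsD _ _)); apply: lerD.
  apply: (le_trans (cabsD _ _)); apply: lerD; first exact: kernel_part.
  exact: near_part.
apply: (le_trans (cabsD _ _)); rewrite /Y mulrDl.
have eN : expR (- (be / 2 * N)) <= expR (- (be / 2 * x)).
  by rewrite ler_expR lerN2 ler_wpM2l ?(ltW b20)// lerDr.
have fac M : 0 <= M -> B * M / (be / 2) * expR (- (be / 2 * a)) * expR (- (be / 2 * N)) <=
    B * M / (be / 2) * expR (- (be / 2 * a)) * expR (- (be / 2 * x)).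
  move=> M0; apply: ler_wpM2l eN; apply: mulr_ge0; last exact: expR_ge0.
  by apply: mulr_ge0; [exact: mulr_ge0|rewrite invr_ge0 ltW].
apply: lerD.
- apply: le_trans (fac 1 ler01); apply: far => // y yN.
  by rewrite /s bump_out// subr_le0 yN.
- apply: le_trans (fac c c0); apply: far => // y yN.
  by rewrite /v bump_tail_le0 ?subrr// subr_le0.
Qed.

(** At a common Lebesgue point of both components the error in [at_point] tends to 0 with d. The
    decay at infinity fixes the constant of integration. *)
Lemma du_bois_reymond : {ae mu, forall x, g x = - tail h x}.
Proof.
have [mg1 mg2] := mg.
have [[i1 i2] _] := cintegral_setT_halves be0 mg hg.
have p1 := lebesgue_differentiation (open_integrable_locally openT i1).
have p2 := lebesgue_differentiation (open_integrable_locally openT i2).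
apply: (ae_imp (ae_and p1 p2)) => a [l1 l2]; apply/eqP; rewrite -subr_eq0 opprK -cabs_eq0.
have c0 := @bump_tail_gt0 R.
rewrite eq_le cabs_ge0 andbT -(pmulr_rle0 _ c0); apply/ler_addgt0Pr => e e0; rewrite add0r.
pose X := 2 + B * bump_tail 0 * expR 1.
have X0 : 0 < X by rewrite /X ltr_pwDl// !mulr_ge0 ?expR_ge0// ltW.
pose e' := e / X; have e'0 : 0 < e' by rewrite divr_gt0.
have [d [d0 d1 de q1 q2]] : exists d, [/\ 0 < d, d <= 1, d <= e',
   (\int[mu]_(y in ball a d) `|complex.Re (g y) - complex.Re (g a)|%:E <= (e' * d)%:E)%E &
   (\int[mu]_(y in ball a d) `|complex.Im (g y) - complex.Im (g a)|%:E <= (e' * d)%:E)%E].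
  near (0 : R)^'+ => d; exists d; split.
  - by near: d; exact: nbhs_right_gt.
  - by near: d; exact: nbhs_right_le.
  - by near: d; exact: nbhs_right_le.
  - by near: d; exact: lebesgue_pt_le l1 e'0.
  - by near: d; exact: lebesgue_pt_le l2 e'0.
apply: (le_trans (at_point d0 d1 q1 q2)).
apply: (@le_trans _ _ (2 * e' + B * bump_tail 0 * expR 1 * e')).
  by rewrite lerD2l ler_wpM2l// !mulr_ge0 ?expR_ge0// ltW.
by rewrite -mulrDl -/X /e' mulrC divfK// gt_eqF.
Unshelve. all: by end_near. Qed.

End DuBoisReymond.

(** * The modes of the potential *)

Section SobolevMode.
Context {R : realType}.
Let mu := @lebesgue_measure R.

Lemma continuous_cabs (f : R -> R[i]) : ccont f -> continuous (fun x => cabs (f x)).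
Proof.
move=> [c1 c2] x.
have -> : (fun x => cabs (f x)) = fun x => Num.sqrt (complex.Re (f x) ^+ 2 + complex.Im (f x) ^+ 2).
  by apply/funext => y; case: (f y).
apply: (continuous_comp (f := fun x => complex.Re (f x) ^+ 2 + complex.Im (f x) ^+ 2)).
  by apply: cvgD; rewrite expr2; apply: cvgM; first [exact: c1|exact: c2].
exact: sqrt_continuous.
Qed.

(** A violation would persist on a ball, which has positive measure. *)
Lemma ae_le_continuous (u v : R -> R) : continuous u -> continuous v ->
  {ae mu, forall x, u x <= v x} -> forall x, u x <= v x.
Proof.
move=> cu cv [N [mN N0 hN]] x; rewrite leNgt; apply/negP => vu.
have : \forall y \near x, v y < u y.
  have cw : continuous (fun y => u y - v y) by move=> y; apply: cvgB; [exact: cu|exact: cv].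
  near=> y; rewrite -subr_gt0; near: y.
  by apply: (cvgr_gt (u x - v x) (cw x)); rewrite subr_gt0.
move=> /nbhs_ballP[e /= e0 he].
have bN : ball x e `<=` N by move=> y /he vuy; apply: hN => /=; apply/negP; rewrite -ltNge.
have : (mu (ball x e) <= mu N)%E by apply: le_measure; rewrite ?inE//; exact: measurable_ball.
rewrite N0 /mu lebesgue_measure_ball ?(ltW e0)// lee_fin leNgt pmulrn_lgt0//.
by rewrite e0.
Unshelve. all: by end_near. Qed.

Lemma tail_subr (F : R -> R[i]) y z (M : R) : y <= z -> cmeasurable F ->
  cintegrable `]y, +oo[ F -> {ae mu, forall t, y < t -> t <= z -> cabs (F t) <= M} ->
  cabs (tail F y - tail F z) <= M * (z - y).
Proof.
move=> yz [m1 m2] [i1 i2] hM.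
have split_tail f : mu.-integrable `]y, +oo[ (EFin \o f) ->
    Rintegral mu `]y, +oo[ f = Rintegral mu `]y, z] f + Rintegral mu `]z, +oo[ f.
  move=> jf; have U : `]y, z]%classic `|` `]z, +oo[%classic = `]y, +oo[%classic.
    apply/seteqP; split => x; rewrite /= !in_itv /= ?andbT.
      by case=> [/andP[]//|]; exact: le_lt_trans.
    by move=> yx; rewrite yx /=; case: (leP x z); [left|right].
  rewrite -U Rintegral_setU ?U//; apply/disj_setPS => x [].
  by rewrite /= !in_itv /= andbT => /andP[_ xz] zx; move: (le_lt_trans xz zx); rewrite ltxx.
have -> : tail F y - tail F z = cintegral `]y, z] F.
  rewrite /tail /cintegral split_tail// split_tail//.
  by apply: complex_ext; rewrite !ReImE /= addrK.
have mD := @measurable_itv R `]y, z].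
have muD : mu `]y, z] = (z - y)%:E.
  apply: (etrans (@lebesgue_measure_itv R `]y, z])); rewrite /= lte_fin.
  by case: ltgtP yz => // -> _; rewrite subrr.
have ic : mu.-integrable `]y, z] (EFin \o (fun=> M)).
  apply/integrableP; split; first exact: measurable_cst.
  rewrite integral_cst// -/mu; apply: lte_mul_pinfty => //.
  by rewrite [X in (X < _)%E]muD ltry.
have [||_] := @cintegral_le R `]y, z] F (fun=> M) mD _ ic.
- by split; exact: measurable_funTS.
- by apply: (ae_imp hM) => t ht; rewrite /= in_itv /= => /andP[]; exact: ht.
move=> /le_trans; apply; rewrite /Rintegral integral_cst//=.
by rewrite [X in fine (_ * X)]muD -EFinM.
Qed.

(** The difference of two tails is an integral over a bounded interval, on which h is bounded by its
    decay at the endpoint closest to 0: y in the first case, - y in the second. *)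
Lemma half_lipschitz_tail (be B : R) (h : R -> R[i]) : 0 < be -> 0 <= B -> cmeasurable h ->
  {ae mu, forall x, cabs (h x) <= B * expR (- (be * `|x|))} ->
  [/\ ccont (fun x => - tail h x), half_lipschitz be B (fun x => - tail h x) &
     half_lipschitz be B (fun x => - tail h (- x))].
Proof.
move=> be0 B0 mh hh; have [ih _] := cintegral_setT_halves be0 mh hh.
have it y : cintegrable `]y, +oo[ h by apply: cintegrableS ih.
have mono (t y : R) : `|y| <= `|t| -> expR (- (be * `|t|)) <= expR (- (be * `|y|)).
  by move=> yt; rewrite ler_expR lerN2 ler_wpM2l// ltW.
have lip y z : y <= z -> cabs (- tail h z - - tail h y) <= B * (z - y).
  move=> yz; rewrite opprK addrC; apply: tail_subr => //.
  apply: (ae_imp hh) => t ht _ _; apply: (le_trans ht); rewrite ler_piMr//.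
  by rewrite -expR0 ler_expR oppr_le0 mulr_ge0// ltW.
split.
- have K (r : R[i] -> R) : (forall u v, r (u - v) = r u - r v) ->
    (forall u, `|r u| <= cabs u) -> continuous (fun x => r (- tail h x)).
    move=> rB rle x; apply/cvgrPdist_le => e e0.
    near=> y; rewrite -rB; apply: (le_trans (rle _)).
    have hxy : `|x - y| <= e / (B + 1).
      near: y; apply: (@cvgr_dist_le _ R^o _ _ _ id); first exact: cvg_id.
      by rewrite divr_gt0// ltr_wpDl.
    have : cabs (- tail h x - - tail h y) <= B * `|x - y|.
      case: (leP y x) => xy; first by rewrite ger0_norm ?subr_ge0// lip.
      by rewrite cabsBC distrC ger0_norm ?subr_ge0 ?lip// ltW.
    move=> /le_trans; apply; apply: (@le_trans _ _ ((B + 1) * `|x - y|)).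
      by rewrite ler_wpM2r// lerDl.
    by rewrite mulrC -ler_pdivlMr// ltr_wpDl.
  split; [apply: (K (@complex.Re R))|apply: (K (@complex.Im R))] => //.
  - by move=> u v; rewrite !ReImE.
  - exact: cabs_Re.
  - by move=> u v; rewrite !ReImE.
  - exact: cabs_Im.
- move=> y z y0 yz; rewrite opprK addrC mulrAC; apply: tail_subr => //.
  apply: (ae_imp hh) => t ht yt _; apply: (le_trans ht); rewrite ler_wpM2l//.
  have := @mono t y; rewrite (ger0_norm y0); apply.
  by rewrite (le_trans (ltW yt))// ler_norm.
- move=> y z y0 yz; rewrite opprK addrC cabsBC.
  have -> : B * (z - y) * expR (- (be * y)) = B * expR (- (be * y)) * (- y - - z) by ring.
  apply: tail_subr => //; first by rewrite lerN2.
  apply: (ae_imp hh) => t ht _ ty; apply: (le_trans ht); rewrite ler_wpM2l//.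
  have := @mono t y; rewrite (ger0_norm y0); apply.
  have t0 : t <= 0 by rewrite (le_trans ty)// oppr_le0.
  by rewrite (ler0_norm t0) lerNr.
Unshelve. all: by end_near. Qed.

(** The representatives are built downwards. [p2] is minus the tail of the third weak derivative,
    which is merely bounded, so [p2] is Lipschitz; [p1] and [p0] are then minus the tails of
    continuous functions and classically differentiable. *)
Lemma weak_derivatives_mode (be B : R) (d : nat -> R -> R[i]) : 0 < be -> 0 <= B ->
  (forall l, (l <= 3)%N -> cmeasurable (d l)) ->
  (forall l, (l < 3)%N -> weak_derivative (d l) (d l.+1)) ->
  (forall l, (l <= 3)%N -> {ae mu, forall x, cabs (d l x) <= B * expR (- (be * `|x|))}) ->
  exists p0 p1 p2, is_mode be B p0 p1 p2 /\ {ae mu, forall x, p0 x = d 0%N x}.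
Proof.
move=> be0 B0 md wd hd.
have dB l : (l < 3)%N -> {ae mu, forall x, d l x = - tail (d l.+1) x}.
  by move=> l3; apply: (@du_bois_reymond _ be B) => //;
    [exact: md (ltnW l3)|exact: md|exact: hd (ltnW l3)|exact: hd|exact: wd].
have decay : continuous (fun x : R => B * expR (- (be * `|x|))).
  move=> x; apply: cvgM; first exact: cvg_cst.
  apply: (continuous_comp (f := fun x => - (be * `|x|))); last exact: continuous_expR.
  by apply: cvgN; apply: cvgM; [exact: cvg_cst|exact: norm_continuous].
have [c2 l2 l2'] := half_lipschitz_tail be0 B0 (md 3%N isT) (hd 3%N isT).
pose p2 x : R[i] := - tail (d 3%N) x.
have step l p : (l < 2)%N -> ccont p -> {ae mu, forall x, p x = d l.+1 x} ->
    [/\ forall x, cder (fun y => - tail p y) x (p x),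
      forall x, cabs (p x) <= B * expR (- (be * `|x|)) &
      {ae mu, forall x, - tail p x = d l x}].
  move=> l2_ cp hp.
  have bp : forall x, cabs (p x) <= B * expR (- (be * `|x|)).
    apply: ae_le_continuous => //; first exact: continuous_cabs.
    have l3 : (l.+1 <= 3)%N := ltnW l2_.
    by apply: (ae_imp (ae_and hp (hd l.+1 l3))) => x [->].
  have ip : tail_integrable p.
    apply: exp_decay_tail_integrable => //; apply: (exp_decay_intro be0 (M := B)) => y y0.
    by have := bp y; rewrite (ger0_norm y0).
  split => //.
    by move=> x; apply: (cder_eq (cderN (tail_der x cp ip))); rewrite opprK.
  have l3 : (l < 3)%N := ltnW l2_.
  apply: (ae_imp (dB l l3)) => x ->; congr (- _); rewrite /tail.
  have [m1 m2] := md l.+1 l3.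
  have [] // := @cintegral_ae_eq R `]x, +oo[ p (d l.+1) (measurable_itv _) (ip x) _ hp.
  by split; exact: measurable_funTS.
have h2 : {ae mu, forall x, p2 x = d 2%N x} by apply: (ae_imp (dB 2%N isT)) => x ->.
have [d1 b2 h1] := step 1%N p2 isT c2 h2.
pose p1 x : R[i] := - tail p2 x.
have [d0 b1 h0] := step 0%N p1 isT (cder_ccont d1) h1.
exists (fun x => - tail p1 x), p1, p2; split; last exact: h0.
split; [exact: d0|exact: d1|exact: c2| |exact: (conj l2 l2')].
split; [|exact: b1|exact: b2].
apply: ae_le_continuous => //; first exact: continuous_cabs (cder_ccont d0).
by apply: (ae_imp (ae_and h0 (hd 0%N isT))) => x [->].
Qed.

Lemma Linfty_norm_ge0 (be : R) (g : R -> R[i]) : (0 <= Linfty_norm be g)%E.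
Proof.
apply: ess_sup_ger => [|t]; last by rewrite lee_fin mulr_ge0 ?expR_ge0 ?cabs_ge0.
have : (mu (ball (0%R : R) 1%R) <= mu setT)%E by apply: le_measure; rewrite ?inE//; exact: measurable_ball.
by apply: lt_le_trans; rewrite /mu lebesgue_measure_ball// lte_fin.
Qed.

Lemma Linfty_norm_le (be B : R) (g : R -> R[i]) : (Linfty_norm be g <= B%:E)%E ->
  {ae mu, forall x, cabs (g x) <= B * expR (- (be * `|x|))}.
Proof.
move=> h; have := ess_sup_ge mu (fun x => (expR (be * `|x|) * cabs (g x))%:E).
move=> /ae_imp; apply => x hx.
have : ((expR (be * `|x|) * cabs (g x))%:E <= B%:E)%E by exact: le_trans h.
by rewrite lee_fin expRN mulrC -ler_pdivlMr ?expR_gt0.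
Qed.

Lemma sobolev_norm_ge0 n (be : R) (g : R -> R[i]) : (0 <= sobolev_norm n be g)%E.
Proof.
apply: le_ereal_inf_tmp => s [d [_ _ _ ->]].
by apply: sume_ge0 => l _; exact: Linfty_norm_ge0.
Qed.

(** The infimum need not be known to be attained: the strict inequality selects a family of weak
    derivatives whose total norm is below B. *)
Lemma sobolev_mode (be B : R) (q : R -> R[i]) : 0 < be -> (sobolev_norm 3 be q < B%:E)%E ->
  cmeasurable q /\ exists p0 p1 p2, is_mode be B p0 p1 p2 /\ {ae mu, forall x, p0 x = q x}.
Proof.
move=> be0 hB.
have B0 : 0 <= B by rewrite -lee_fin (le_trans (sobolev_norm_ge0 3 be q))// ltW.
have [s [d [dq md wd sE]] sB] := ereal_inf_lt hB.
rewrite -dq; split; first exact: md.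
apply: weak_derivatives_mode => // l l3; apply: Linfty_norm_le.
apply: le_trans (ltW sB); rewrite sE (bigD1 (Ordinal (l3 : l < 4)%N))//= leeDl//.
by apply: sume_ge0 => i _; exact: Linfty_norm_ge0.
Qed.

End SobolevMode.

Section LimitMeasurable.
Context {R : realType} {d : measure_display} {T : measurableType d}.

(** The sequence may diverge at some points, where [limn] takes the value [point]; [b] tests where
    the upper and lower limits agree and are finite. This matters because the series of the q_j
    themselves are controlled only almost everywhere. *)
Lemma measurable_limn (u : nat -> T -> R) : (forall n, measurable_fun setT (u n)) ->
  measurable_fun setT (fun x => limn (u^~ x)).
Proof.
move=> mu.
have me n : measurable_fun setT (EFin \o u n) by exact/measurable_EFinP.
pose F x : \bar R := limn_esup (fun n => (u n x)%:E).
pose G x : \bar R := (- limn_esup (fun n => (- u n x)%R%:E))%E.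
have mF : measurable_fun setT F := measurable_fun_limn_esup me.
have mG : measurable_fun setT G.
  apply: measurableT_comp => //; apply: measurable_fun_limn_esup => n.
  by apply/measurable_EFinP; apply: measurableT_comp.
have GE x : G x = limn_einf (fun n => (u n x)%:E) by rewrite /G /limn_einf.
pose b x := (F x == G x) && (F x \is a fin_num).
have -> : (fun x => limn (u^~ x)) = fun x => if b x then fine (F x) else point.
  apply/funext => x; case: ifPn => [/andP[/eqP FG Ff]|nb].
    have c : (u n x)%:E @[n --> \oo] --> F x.
      apply: (@squeeze_cvge _ _ _ _ (einfs (fun n => (u n x)%:E)) _ (esups (fun n => (u n x)%:E))).
      - apply: nearW => n; apply/andP; split.
          by apply: ereal_inf_lbound; exists n => //=.
        by apply: ereal_sup_ubound; exists n => //=.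
      - by rewrite FG GE limn_einf_lim; exact: is_cvg_einfs.
      - by rewrite /F limn_esup_lim; exact: is_cvg_esups.
    apply: (cvg_lim (@Rhausdorff R)).
    by move: c; rewrite -(fineK Ff) => /fine_cvgP[_].
  apply: dvgP => /cvg_ex[l hl]; move/negP: nb; apply.
  have he : (u n x)%:E @[n --> \oo] --> l%:E by apply/fine_cvgP; split; [exact: nearW|].
  have [e1 e2] := cvg_limn_einf_sup he.
  by rewrite /b GE e1 /F e2 eqxx.
have mb : measurable_fun setT b.
  apply: measurable_and; first exact: measurable_fun_eqe.
  apply: (measurable_fun_bool true).
  have -> : [set: T] `&` (fun x => F x \is a fin_num) @^-1` [set true] =
    [set: T] `&` [set x | F x \is a fin_num] by apply/seteqP; split => x [].
  exact: emeasurable_fin_num.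
apply: measurable_fun_ifT => //.
by apply: (measurableT_comp (fine_measurable measurableT)).
Qed.

End LimitMeasurable.

Section NonzeroIntegers.

(** Lists the indices of the symmetric partial sums of [sum_nz], which thereby become sums over a
    list closed under negation, as [ModeSum] wants. *)
Definition nz_ints N : seq int :=
  [seq n%:Z | n <- index_iota 1 N] ++ [seq - n%:Z | n <- index_iota 1 N].

Lemma big_nz_ints (M : nmodType) N (a : int -> M) :
  \sum_(j <- nz_ints N) a j = \sum_(1 <= n < N) (a n%:Z + a (- n%:Z)).
Proof. by rewrite big_cat !big_map big_split. Qed.

Lemma mem_nz_ints N j : (j \in nz_ints N) = (j != 0) && (`|j| < N)%N.
Proof.
rewrite mem_cat; case: (intP j) => [|n|n].
- by apply/negbTE; rewrite negb_or; apply/andP; split; apply/mapP => -[[|m]]; rewrite mem_index_iota.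
- rewrite absz_nat /=; apply/orP/idP => [[/mapP[m]|/mapP[m]]|nN].
  + by rewrite mem_index_iota => /andP[_ mN] [->].
  + by rewrite mem_index_iota => /andP[+ _]; case: m.
  + by left; apply/mapP; exists n.+1; rewrite // mem_index_iota.
- rewrite abszN absz_nat oppr_eq0 /=; apply/orP/idP => [[/mapP[m]|/mapP[m]]|nN].
  + by rewrite mem_index_iota => /andP[+ _]; case: m.
  + by rewrite mem_index_iota => /andP[_ mN] /oppr_inj [->].
  + by right; apply/mapP; exists n.+1; rewrite // mem_index_iota.
Qed.

Lemma uniq_nz_ints N : uniq (nz_ints N).
Proof.
rewrite cat_uniq !map_inj_uniq ?iota_uniq /= ?andbT; first last.
- by move=> m n [].
- by move=> m n /oppr_inj[].
apply/hasPn => j /mapP[m]; rewrite mem_index_iota => /andP[m0 _] ->.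
by apply/mapP => -[n]; rewrite mem_index_iota => /andP[n0 _]; case: m m0 => // m _; case: n n0.
Qed.

Lemma opp_nz_ints N j : j \in nz_ints N -> - j \in nz_ints N.
Proof. by rewrite !mem_nz_ints oppr_eq0 abszN. Qed.

End NonzeroIntegers.

Section ModesOfPotential.
Context {R : realType}.
Variables (beta theta : R) (q : int -> R -> R[i]) (lam : int -> R).
Hypothesis hV : hypotheses_V beta theta q lam.
Let mu := @lebesgue_measure R.
Let be0 : 0 < beta := V_beta_gt0 hV.
Let s j : \bar R := sobolev_norm 3 beta (q j).
Let S : \bar R := (\esum_(j in [set j : int | (j != 0)%R]) s j)%E.

Let s_ge0 j : (0 <= s j)%E. Proof. exact: sobolev_norm_ge0. Qed.

Let sum_s_le (J : seq int) : uniq J -> {in J, forall j, j != 0} -> (\sum_(j <- J) s j <= S)%E.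
Proof.
move=> uJ J0; apply: esum_ge; exists [set` J]; last by rewrite fsbig_seq.
by split; [exact: finite_seq|move=> j /= /J0].
Qed.

Let s_fin j : j != 0 -> s j \is a fin_num.
Proof.
move=> j0; have := @sum_s_le [:: j] isT; rewrite big_seq1 => h.
rewrite ge0_fin_numE//; apply: le_lt_trans (V_summable hV); apply: h => i.
by rewrite inE => /eqP ->.
Qed.

(** The slack [2^-1 ^+ |j|] provides the strict inequality of [sobolev_mode] and adds at most 2 over
    both signs. At 0, where nothing is known of q, the value 1 goes with the zero mode. *)
Let B j : R := if j == 0 then 1 else fine (s j) + 2^-1 ^+ `|j|%N.

Let sum_half N : \sum_(1 <= n < N) (2^-1 ^+ n : R) <= 1.
Proof.
suff : \sum_(1 <= n < N) (2^-1 ^+ n : R) <= 1 - 2^-1 ^+ N.-1.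
  by move=> /le_trans; apply; rewrite gerBl exprn_ge0// invr_ge0.
case: N => [|N]; first by rewrite big_geq// expr0 subrr.
elim: N => [|N IH]; first by rewrite big_geq// expr0 subrr.
rewrite big_nat_recr//=; apply: (le_trans (lerD IH (lexx _))).
by rewrite /= exprS; apply: eq_ler; field.
Qed.

Let sum_B N : \sum_(j <- nz_ints N) B j <= fine S + 2.
Proof.
have J0 : {in nz_ints N, forall j, j != 0} by move=> j; rewrite mem_nz_ints => /andP[].
have -> : \sum_(j <- nz_ints N) B j =
   \sum_(j <- nz_ints N) fine (s j) + \sum_(j <- nz_ints N) 2^-1 ^+ `|j|%N.
  rewrite -big_split /= big_seq [RHS]big_seq; apply: eq_bigr => j /J0 j0.
  by rewrite /B (negbTE j0).
apply: lerD.
  have -> : \sum_(j <- nz_ints N) fine (s j) = fine (\sum_(j <- nz_ints N) s j)%E.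
    rewrite big_seq [in RHS]big_seq -sum_fine// => j /J0; exact: s_fin.
  have le1 := sum_s_le (uniq_nz_ints N) J0.
  have S0 : (0 <= S)%E by apply: esum_ge0.
  have Sf : S \is a fin_num by rewrite ge0_fin_numE// (V_summable hV).
  by apply: fine_le => //; rewrite ge0_fin_numE ?sume_ge0// (le_lt_trans le1)// (V_summable hV).
rewrite big_nz_ints.
have -> : \sum_(1 <= n < N) (2^-1 ^+ `|n%:Z|%N + 2^-1 ^+ `|- n%:Z|%N : R) =
   2 * \sum_(1 <= n < N) (2^-1 ^+ n : R).
  by rewrite mulr_sumr; apply: eq_bigr => n _; rewrite abszN absz_nat mulr2n mulrDl mul1r.
by rewrite -[leRHS]mulr1 ler_wpM2l.
Qed.

Let mode_ex j : exists p : (R -> R[i]) * (R -> R[i]) * (R -> R[i]),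
  is_mode beta (B j) p.1.1 p.1.2 p.2 /\
  (j != 0 -> cmeasurable (q j) /\ {ae mu, forall x, p.1.1 x = q j x}).
Proof.
have [->|j0] := eqVneq j 0.
  exists (fun=> 0, fun=> 0, fun=> 0); split=> //=; rewrite /B eqxx.
  split; [| |exact: ccont_cst| |].
  - by move=> x; exact: cder_cst.
  - by move=> x; exact: cder_cst.
  - by split => x; rewrite cabs0 mulr_ge0 ?expR_ge0.
  - by split => y z y0 yz; rewrite subrr cabs0 !mulr_ge0 ?expR_ge0// subr_ge0.
have hs : (s j < (B j)%:E)%E.
  by rewrite /B (negbTE j0) -{1}(fineK (s_fin j0)) lte_fin ltrDl exprn_gt0// invr_gt0.
have [mq [p0 [p1 [p2 [hp pq]]]]] := sobolev_mode be0 hs.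
by exists (p0, p1, p2).
Qed.

Lemma potential_modes : exists p0 p1 p2 B Btot,
  [/\ forall j, is_mode beta (B j) (p0 j) (p1 j) (p2 j),
      forall N, \sum_(j <- nz_ints N) B j <= Btot,
      {ae mu, forall x, forall j, j != 0 -> p0 j x = q j x},
      forall j x, j != 0 -> p0 (- j) x = conjc (p0 j x) &
      forall j, j != 0 -> cmeasurable (q j)].
Proof.
pose p j := sval (cid (mode_ex j)); have hp j := svalP (cid (mode_ex j)).
have pq j : j != 0 -> {ae mu, forall x, (p j).1.1 x = q j x} by move=> j0; exact: ((hp j).2 j0).2.
exists (fun j => (p j).1.1), (fun j => (p j).1.2), (fun j => (p j).2), B, (fine S + 2).
split => //.
- by move=> j; exact: (hp j).1.
(* Countable intersections are taken over the natural numbers, so the indices are grouped by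
   absolute value. *)
- have h : {ae mu, forall x, forall n : nat, forall j : int, `|j|%N = n -> j != 0 -> (p j).1.1 x = q j x}.
    apply: ae_foralln => n; have [->|n0] := eqVneq n 0%N.
      by apply: ae_all => x j /eqP; rewrite absz_eq0 => ->.
    have n1 : n%:Z != 0 :> int by rewrite eqz_nat.
    have n2 : - n%:Z != 0 :> int by rewrite oppr_eq0.
    apply: (ae_imp (ae_and (pq _ n1) (pq _ n2))) => x [e1 e2] j jn _.
    move: e1 e2; rewrite -{}jn; case: (intP j) => [|m|m]; rewrite ?abszN ?absz_nat//.
  by apply: (ae_imp h) => x hx j; exact: (hx `|j|%N j erefl).
(* The symmetry of the q_j passes to the representatives almost everywhere, and then everywhere by
   continuity. *)
- move=> j x j0; apply/eqP; rewrite -subr_eq0 -cabs_eq0 eq_le cabs_ge0 andbT.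
  have jN : - j != 0 by rewrite oppr_eq0.
  have c1 i : ccont (p i).1.1 by have [d _ _ _ _] := (hp i).1; exact: cder_ccont d.
  move: x; apply: (ae_le_continuous (v := fun=> 0)); last 2 first.
  + exact: cst_continuous.
  + by apply: (ae_imp (ae_and (pq _ j0) (pq _ jN))) => x [-> ->]; rewrite (V_conj hV x j0) subrr cabs0.
  + by apply: continuous_cabs; apply: ccontB => //; exact: ccont_conj.
- by move=> j j0; exact: ((hp j).2 j0).1.
Qed.

End ModesOfPotential.

(** * Series over the nonzero integers with a summable majorant *)

Section SumNz.
Context {R : realType}.
Variables (B : int -> R) (Btot : R).
Hypotheses (B0 : forall j, 0 <= B j) (hB : forall N, \sum_(j <- nz_ints N) B j <= Btot).
Implicit Types (a : int -> R) (N : nat).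

Lemma sum_nzE a : sum_nz a = limn (fun N => \sum_(j <- nz_ints N) a j).
Proof.
rewrite /sum_nz; have -> // : (fun N => \sum_(1 <= n < N) (a n%:Z + a (- n%:Z))) =
  (fun N => \sum_(j <- nz_ints N) a j).
by apply/funext => N; rewrite big_nz_ints.
Qed.

Lemma eq_sum_nz a b : (forall j, j != 0 -> a j = b j) -> sum_nz a = sum_nz b.
Proof.
move=> ab; rewrite !sum_nzE; have -> // : (fun N => \sum_(j <- nz_ints N) a j) =
  (fun N => \sum_(j <- nz_ints N) b j).
apply/funext => N; rewrite big_seq [RHS]big_seq; apply: eq_bigr => j.
by rewrite mem_nz_ints => /andP[/ab].
Qed.

Lemma nz_partial_homo a : (forall j, j != 0 -> 0 <= a j) ->
  {homo (fun N => \sum_(j <- nz_ints N) a j) : n m / (n <= m)%N >-> n <= m}.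
Proof.
move=> a0 n m; case: n => [|n] nm.
  rewrite [leLHS]big_nz_ints big_geq// big_seq; apply: sumr_ge0 => j.
  by rewrite mem_nz_ints => /andP[/a0].
rewrite !big_nz_ints (big_cat_nat (ltn0Sn n) nm)/= lerDl big_nat_cond.
apply: sumr_ge0 => i /andP[/andP[ni _] _].
have i0 : i != 0%N by rewrite -lt0n (leq_trans _ ni).
by rewrite addr_ge0// a0// ?oppr_eq0 eqz_nat.
Qed.

(** The partial sums are a difference of two nondecreasing bounded sequences, those of a + B e and
    of B e. *)
Lemma sum_nz_cvg a (e : R) : 0 <= e -> (forall j, j != 0 -> `|a j| <= B j * e) ->
  cvgn (fun N => \sum_(j <- nz_ints N) a j).
Proof.
move=> e0 ha.
have c1 : cvgn (fun N => \sum_(j <- nz_ints N) (B j * e)).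
  apply: nondecreasing_is_cvgn.
    by apply: nz_partial_homo => j _; exact: mulr_ge0.
  exists (Btot * e) => _ [N _ <-]; rewrite -mulr_suml; exact: ler_wpM2r.
have c2 : cvgn (fun N => \sum_(j <- nz_ints N) (a j + B j * e)).
  apply: nondecreasing_is_cvgn.
    apply: nz_partial_homo => j /ha; rewrite ler_norml => /andP[h _]; by rewrite -lerBlDr sub0r.
  exists (2 * (Btot * e)) => _ [N _ <-].
  apply: (@le_trans _ _ (2 * (\sum_(j <- nz_ints N) B j * e))); last first.
    by rewrite ler_wpM2l// -mulr_suml ler_wpM2r.
  rewrite mulr_sumr big_seq [leRHS]big_seq; apply: ler_sum => j.
  rewrite mem_nz_ints => /andP[/ha h _].
  by rewrite mulr2n mulrDl mul1r lerD2r (le_trans (ler_norm _)).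
have -> : (fun N => \sum_(j <- nz_ints N) a j) =
  (fun N => \sum_(j <- nz_ints N) (a j + B j * e)) - (fun N => \sum_(j <- nz_ints N) (B j * e)).
  by apply/funext => N; rewrite /= -[RHS]sumrB; apply: eq_bigr => j _; rewrite addrK.
exact: is_cvgB.
Qed.

Definition sum_nz_rest N : R := sum_nz B - \sum_(j <- nz_ints N) B j.

Let cB : cvgn (fun N => \sum_(j <- nz_ints N) B j).
Proof.
apply: (@sum_nz_cvg B 1) => // j _; by rewrite mulr1 ger0_norm.
Qed.

Lemma sum_nz_rest_ge0 N : 0 <= sum_nz_rest N.
Proof.
rewrite subr_ge0 sum_nzE; apply: (nondecreasing_cvgn_le _ cB).
by apply: nz_partial_homo => j _.
Qed.

Lemma sum_nz_rest0_le : sum_nz_rest 0 <= Btot.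
Proof.
rewrite /sum_nz_rest big_nz_ints big_geq// subr0 sum_nzE; apply: limr_le => //.
exact: nearW.
Qed.

Lemma sum_nz_rest_small (e : R) : 0 < e -> exists2 N, (0 < N)%N & sum_nz_rest N <= e.
Proof.
move=> e0; have := cB; rewrite -sum_nzE => /cvgrPdist_le /(_ e e0) h.
near \oo => N; exists N; first by near: N; exact: nbhs_infty_gt.
apply: (le_trans (ler_norm _)); near: N; exact: h.
Unshelve. all: by end_near. Qed.

(** The range starts at [maxn 1 n] because the partial sums start at 1; n = 0 and n = 1 both give
    the empty sum. *)
Lemma nz_partial_tail a n m : (n <= m)%N ->
  \sum_(j <- nz_ints m) a j - \sum_(j <- nz_ints n) a j =
  \sum_(maxn 1 n <= i < m) (a i%:Z + a (- i%:Z)).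
Proof.
rewrite !big_nz_ints; case: n => [|n] nm; first by rewrite [X in _ - X]big_geq// subr0.
by rewrite (big_cat_nat (ltn0Sn n) nm)/= addrAC subrr add0r (maxn_idPr _).
Qed.

(** The factor e will carry the decay in x, so that one remainder of the series of B serves all x.
    The case N = 0 bounds the sum itself. *)
Lemma sum_nz_approx a (e : R) N : 0 <= e -> (forall j, j != 0 -> `|a j| <= B j * e) ->
  `|sum_nz a - \sum_(j <- nz_ints N) a j| <= sum_nz_rest N * e.
Proof.
move=> e0 ha; have ca := sum_nz_cvg e0 ha.
pose S N := \sum_(j <- nz_ints N) a j.
have cv : `|S m - S N| @[m --> \oo] --> `|sum_nz a - S N|.
  by apply: cvg_norm; apply: cvgB; [rewrite sum_nzE|exact: cvg_cst].
rewrite -(cvg_lim (@Rhausdorff R) cv); apply: limr_le.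
  by apply/cvg_ex; exists `|sum_nz a - S N|.
near=> m.
have nm : (N <= m)%N by near: m; exact: nbhs_infty_ge.
have bm : \sum_(j <- nz_ints m) B j <= sum_nz B by rewrite -subr_ge0 sum_nz_rest_ge0.
apply: (@le_trans _ _ ((\sum_(j <- nz_ints m) B j - \sum_(j <- nz_ints N) B j) * e)); last first.
  by rewrite ler_wpM2r// lerD2r.
rewrite /S !(nz_partial_tail _ nm); apply: (le_trans (ler_norm_sum _ _ _)).
rewrite mulr_suml big_nat_cond [leRHS]big_nat_cond; apply: ler_sum => n /andP[/andP[n1 _] _].
have n0 : n != 0%N by rewrite -lt0n (leq_trans _ n1)// leq_maxl.
by rewrite mulrDl; apply: (le_trans (ler_normD _ _)); apply: lerD; apply: ha; rewrite ?oppr_eq0 eqz_nat.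
Unshelve. all: by end_near. Qed.

Lemma continuous_sum_nz (a : int -> R -> R) : (forall j, continuous (a j)) ->
  (forall j x, j != 0 -> `|a j x| <= B j) -> continuous (fun x => sum_nz (a^~ x)).
Proof.
move=> ca ha x; apply/cvgrPdist_le => e e0.
have e3 : 0 < e / 3 by rewrite divr_gt0.
have [N N0 hN] := sum_nz_rest_small e3.
have app y : `|sum_nz (a^~ y) - \sum_(j <- nz_ints N) a j y| <= e / 3.
  have h j : j != 0 -> `|a j y| <= B j * 1 by rewrite mulr1; exact: ha.
  by apply: (le_trans (sum_nz_approx N ler01 h)); rewrite mulr1.
have cS : continuous (fun y => \sum_(j <- nz_ints N) a j y).
  move=> y; elim: (nz_ints N) => [|j J IH].
    by under eq_fun do rewrite big_nil; exact: cvg_cst.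
  rewrite (_ : (fun z => \sum_(i <- j :: J) a i z) = fun z => a j z + \sum_(i <- J) a i z).
    by apply: cvgD IH; exact: ca.
  by apply/funext => z; rewrite big_cons.
have /cvgrPdist_le /(_ _ e3) hS := cS x.
near=> y.
have h3 : `|\sum_(j <- nz_ints N) a j x - \sum_(j <- nz_ints N) a j y| <= e / 3.
  by near: y; exact: hS.
have -> : sum_nz (a^~ x) - sum_nz (a^~ y) =
  (sum_nz (a^~ x) - \sum_(j <- nz_ints N) a j x) +
  (\sum_(j <- nz_ints N) a j x - \sum_(j <- nz_ints N) a j y) -
  (sum_nz (a^~ y) - \sum_(j <- nz_ints N) a j y) by ring.
have -> : e = e / 3 + e / 3 + e / 3 by field.
apply: (le_trans (ler_normB _ _)); apply: lerD => //.
by apply: (le_trans (ler_normD _ _)); apply: lerD.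
Unshelve. all: by end_near. Qed.

End SumNz.

Lemma measurable_sum_nz {R : realType} (a : int -> R -> R) :
  (forall j, j != 0 -> measurable_fun setT (a j)) -> measurable_fun setT (fun x => sum_nz (a^~ x)).
Proof.
move=> ma; have -> : (fun x => sum_nz (a^~ x)) = fun x => limn (fun N => \sum_(j <- nz_ints N) a j x).
  by apply/funext => x; rewrite sum_nzE.
apply: measurable_limn => N.
have : {in nz_ints N, forall j, j != 0} by move=> j; rewrite mem_nz_ints => /andP[].
elim: (nz_ints N) => [|j J IH] J0.
  by rewrite (_ : (fun x => _) = cst 0) //; apply/funext => x; rewrite big_nil.
rewrite (_ : (fun x => _) = fun x => a j x + \sum_(i <- J) a i x); last first.
  by apply/funext => x; rewrite big_cons.
apply: measurable_funD; first by apply: ma; apply: J0; rewrite mem_head.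
by apply: IH => i iJ; apply: J0; rewrite in_cons iJ orbT.
Qed.

Lemma osc_opp {R : realType} (om x : R) : osc (- om) x = conjc (osc om x).
Proof.
rewrite /osc; have -> : 'i * (- om)%:C * x%:C = 0 +i* (- (om * x)) :> R[i].
  by apply: complex_ext; rewrite !ReImE /=; ring.
have -> : 'i * om%:C * x%:C = 0 +i* (om * x) :> R[i].
  by apply: complex_ext; rewrite !ReImE /=; ring.
by rewrite /cexp /= cosN sinN; apply: complex_ext => /=; ring.
Qed.

(** * The Wronskian estimate for the given potential *)

Section MainEstimate.
Context {R : realType}.
Variables (beta theta : R) (q : int -> R -> R[i]) (lam : int -> R).
Hypothesis hV : hypotheses_V beta theta q lam.
Variables (p0 p1 p2 : int -> R -> R[i]) (B : int -> R) (Btot : R).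
Hypothesis hp : forall j, is_mode beta (B j) (p0 j) (p1 j) (p2 j).
Hypothesis hB : forall N, \sum_(j <- nz_ints N) B j <= Btot.
Hypothesis pq : {ae lebesgue_measure, forall x, forall j, j != 0 -> p0 j x = q j x}.
Hypothesis p0_conj : forall j x, j != 0 -> p0 (- j) x = conjc (p0 j x).
Hypothesis mq : forall j, j != 0 -> cmeasurable (q j).
Let mu := @lebesgue_measure R.
Let be0 : 0 < beta := V_beta_gt0 hV.
Let theta0 : 0 < theta := V_theta_gt0 hV.

Let B0 j : 0 <= B j. Proof. exact: mode_B_ge0 (hp j). Qed.
Let Btot0 : 0 <= Btot.
Proof. by have := hB 0; rewrite big_nz_ints big_geq. Qed.

Let B_le j : j != 0 -> B j <= Btot.
Proof.
move=> j0; apply: le_trans (hB `|j|%N.+1).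
rewrite (bigD1_seq j) ?uniq_nz_ints ?mem_nz_ints ?j0 ?ltnS//= lerDl.
exact: sumr_ge0.
Qed.

Let e1 (x : R) : expR (- (beta * `|x|)) <= 1.
Proof. by rewrite -expR0 ler_expR oppr_le0 mulr_ge0// ltW. Qed.

Let hp0 j x : cabs (p0 j x) <= B j * expR (- (beta * `|x|)).
Proof. by have [_ _ _ [h _ _] _] := hp j. Qed.

Let cp0 j : ccont (p0 j). Proof. by have [d _ _ _ _] := hp j; exact: cder_ccont d. Qed.

Definition mode_term eps j x : R := complex.Re (p0 j x * osc (freq eps lam j) x).
(** The continuous representative of [q_eps]; [mode_lambda] plays the same role for [Lambda_eff]. *)
Definition mode_potential eps x : R := sum_nz (fun j => mode_term eps j x).
Definition mode_lambda_term j x : R := cabs (p0 j x) ^+ 2 / lam j ^+ 2.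
Definition mode_lambda x : R := (4 * pi ^+ 2)^-1 * sum_nz (fun j => mode_lambda_term j x).

Let term_le eps j x : `|mode_term eps j x| <= B j * expR (- (beta * `|x|)).
Proof. by apply: (le_trans (cabs_Re _)); rewrite cabsM cabs_osc mulr1. Qed.

(** One of the two factors [B j] in the bound on |p0 j|^2 is estimated by [Btot], so the series of
    [mode_lambda] has B itself as majorant. *)
Let Lc : R := Btot / theta ^+ 2.
Let Lc0 : 0 <= Lc. Proof. by rewrite /Lc divr_ge0// exprn_ge0// ltW. Qed.

Let lterm_le j x : j != 0 -> `|mode_lambda_term j x| <= B j * (Lc * expR (- (beta * `|x|))).
Proof.
move=> j0; have l0 := V_away0 hV j0.
have lj : theta ^+ 2 <= lam j ^+ 2.
  by rewrite -[leRHS]real_normK ?num_real// lerXn2r ?nnegrE// ltW.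
have l2 : 0 < lam j ^+ 2 by rewrite (lt_le_trans _ lj)// exprn_gt0.
rewrite /mode_lambda_term ger0_norm; last by rewrite divr_ge0 ?sqr_ge0.
have -> : B j * (Lc * expR (- (beta * `|x|))) =
   (B j * expR (- (beta * `|x|))) * Btot / theta ^+ 2 by rewrite /Lc; ring.
apply: ler_pM; rewrite ?sqr_ge0 ?invr_ge0 ?sqr_ge0//; last first.
  by rewrite lef_pV2 ?posrE// exprn_gt0.
rewrite expr2; apply: ler_pM; rewrite ?cabs_ge0//.
by apply: (le_trans (hp0 j x)); apply: le_trans (B_le j0); rewrite ler_piMr.
Qed.

Let pi2_gt0 : 0 < 4 * pi ^+ 2 :> R.
Proof. by rewrite mulr_gt0// exprn_gt0// pi_gt0. Qed.

Let cosc_term eps j : continuous (mode_term eps j).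
Proof. by have [c _] := ccontM (cp0 j) (ccont_osc (freq eps lam j)); exact: c. Qed.

Lemma continuous_mode_potential eps : continuous (mode_potential eps).
Proof.
apply: (@continuous_sum_nz _ B Btot B0 hB (fun j x => mode_term eps j x)) => // j x _.
by apply: (le_trans (term_le _ _ _)); rewrite ler_piMr.
Qed.

Lemma continuous_mode_lambda : continuous mode_lambda.
Proof.
move=> x; apply: cvgM; first exact: cvg_cst; move: x.
have BL0 j : 0 <= B j * Lc by rewrite mulr_ge0.
have hBL N : \sum_(j <- nz_ints N) B j * Lc <= Btot * Lc by rewrite -mulr_suml ler_wpM2r.
apply: (@continuous_sum_nz _ (fun j => B j * Lc) (Btot * Lc) BL0 hBL (fun j x => mode_lambda_term j x)).
  move=> j y; apply: cvgM; last exact: cvg_cst.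
  by rewrite expr2; apply: cvgM; exact: continuous_cabs (cp0 j) y.
move=> j x j0; apply: (le_trans (lterm_le x j0)); rewrite mulrA ler_piMr// .
Qed.

(** A common bound for [mode_potential] and [mode_lambda]; the 1 keeps it positive when all modes
    vanish. *)
Let A : R := Btot + (4 * pi ^+ 2)^-1 * (Btot * Lc) + 1.
Let A0 : 0 < A.
Proof. by rewrite /A ltr_wpDl// addr_ge0// mulr_ge0 ?invr_ge0 ?(ltW pi2_gt0)// mulr_ge0. Qed.

Let rest_le (x : R) : sum_nz_rest B 0 * expR (- (beta * `|x|)) <= Btot * expR (- (beta * `|x|)).
Proof. by rewrite ler_wpM2r ?expR_ge0//; exact: sum_nz_rest0_le B0 hB. Qed.

Lemma mode_potential_le eps x : `|mode_potential eps x| <= A * expR (- (beta * `|x|)).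
Proof.
have := sum_nz_approx B0 hB 0 (expR_ge0 (- (beta * `|x|))) (fun j _ => term_le eps j x).
rewrite big_nz_ints big_geq// subr0 => /le_trans; apply; apply: (le_trans (rest_le x)).
rewrite ler_wpM2r ?expR_ge0// /A -addrA lerDl addr_ge0// mulr_ge0 ?invr_ge0 ?(ltW pi2_gt0)//.
exact: mulr_ge0.
Qed.

Lemma mode_lambda_le x : `|mode_lambda x| <= A * expR (- (beta * `|x|)).
Proof.
have eL : 0 <= Lc * expR (- (beta * `|x|)) by rewrite mulr_ge0 ?expR_ge0.
have := sum_nz_approx B0 hB 0 eL (fun j j0 => lterm_le x j0).
rewrite big_nz_ints big_geq// subr0 => h.
have i0 : 0 <= (4 * pi ^+ 2)^-1 :> R by rewrite invr_ge0 ltW.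
rewrite /mode_lambda normrM (ger0_norm i0).
apply: (@le_trans _ _ ((4 * pi ^+ 2)^-1 * (Btot * Lc * expR (- (beta * `|x|))))).
  rewrite ler_wpM2l//; apply: (le_trans h); rewrite -mulrA ler_wpM2r//.
  exact: sum_nz_rest0_le B0 hB.
by rewrite mulrA ler_wpM2r ?expR_ge0// /A addrAC lerDr addr_ge0.
Qed.

Lemma mode_potential_approx eps : 0 < eps ->
  exists N, mode_approx beta eps p0 lam (nz_ints N) (mode_potential eps) mode_lambda.
Proof.
move=> eps0; have e30 : 0 < eps ^+ 3 by exact: exprn_gt0.
(* One truncation serves both approximations, whose errors are the remainder times 1 and times
   Lc. *)
have h0 : 0 < eps ^+ 3 / (1 + Lc) by rewrite divr_gt0// ltr_pwDl.
have [N _ hN] := sum_nz_rest_small B0 hB h0; exists N.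
have r0 := sum_nz_rest_ge0 B0 hB N.
have hN1 : sum_nz_rest B N * (1 + Lc) <= eps ^+ 3 by rewrite -ler_pdivlMr// ltr_pwDl.
split => x.
(* The truncated sum is real because the terms of j and - j are conjugate. *)
- set Z := \sum_(j <- _) _; have ZE : Z = (\sum_(j <- nz_ints N) mode_term eps j x)%:C.
    apply: complex_ext => /=.
      by rewrite /Z (big_morph (@complex.Re R) (@ReD R) (erefl _)).
    rewrite /Z (big_morph (@complex.Im R) (@ImD R) (erefl _)) big_nz_ints big1_seq// => n.
    rewrite mem_index_iota => /andP[_ /andP[n1 _]].
    have n0 : n%:Z != 0 :> int by rewrite eqz_nat -lt0n.
    have -> : p0 (- n%:Z) x * osc (freq eps lam (- n%:Z)) x =
       conjc (p0 n%:Z x * osc (freq eps lam n%:Z) x).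
      rewrite p0_conj// conjM; congr (_ * _).
      by rewrite /freq (V_opp hV n0) mulrN mulNr osc_opp.
    by case: (p0 n%:Z x * _) => a b /=; rewrite subrr.
  rewrite ZE -rmorphB cabs_real.
  apply: (le_trans (sum_nz_approx B0 hB N (expR_ge0 _) (fun j _ => term_le eps j x))).
  rewrite ler_wpM2r ?expR_ge0//; apply: le_trans hN1.
  by rewrite ler_peMr// lerDl.
- have eL : 0 <= Lc * expR (- (beta * `|x|)) by rewrite mulr_ge0 ?expR_ge0.
  have -> : 4 * pi ^+ 2 * mode_lambda x = sum_nz (fun j => mode_lambda_term j x).
    by rewrite /mode_lambda mulrA mulfV ?mul1r// gt_eqF.
  apply: (le_trans (sum_nz_approx B0 hB N eL (fun j j0 => lterm_le x j0))).
  rewrite mulrA ler_wpM2r ?expR_ge0//; apply: le_trans hN1.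
  by rewrite ler_wpM2l// lerDr.
Qed.

Lemma q_epsE eps x : q_eps q lam eps x =
  sum_nz (fun j => complex.Re (q j x * osc (freq eps lam j) x)).
Proof.
rewrite /q_eps /potential /csum_nz /=; apply: eq_sum_nz => j _; congr (complex.Re (_ * cexp _)).
by apply: complex_ext; rewrite /freq !ReImE /=; ring.
Qed.

Lemma measurable_q_eps eps : measurable_fun setT (q_eps q lam eps).
Proof.
rewrite (_ : q_eps q lam eps = fun x =>
  sum_nz ((fun j x => complex.Re (q j x * osc (freq eps lam j) x))^~ x)); last first.
  by apply/funext => x; exact: q_epsE.
apply: measurable_sum_nz => j j0.
have co := ccont_cmeasurable_on measurableT (ccont_osc (freq eps lam j)).
by have [] := cmeasurable_onM (mq j0) co.
Qed.

Lemma measurable_Lambda_eff : measurable_fun setT (Lambda_eff q lam).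
Proof.
apply: measurable_funM; first exact: measurable_cst.
apply: (@measurable_sum_nz _ (fun j x => cabs (q j x) ^+ 2 / lam j ^+ 2)) => j j0.
have [m1 m2] := mq j0; apply: measurable_funM; last exact: measurable_cst.
rewrite (_ : (fun x => cabs (q j x) ^+ 2) =
  fun x => complex.Re (q j x) ^+ 2 + complex.Im (q j x) ^+ 2).
  by apply: measurable_funD; apply: measurable_funX.
by apply/funext => x; rewrite cabs_sqr.
Qed.

Lemma ae_mode_potential eps : {ae mu, forall x, mode_potential eps x = q_eps q lam eps x}.
Proof.
apply: (ae_imp pq) => x hx; rewrite q_epsE; apply: eq_sum_nz => j j0.
by rewrite /mode_term hx.
Qed.

Lemma ae_mode_lambda : {ae mu, forall x, mode_lambda x = Lambda_eff q lam x}.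
Proof.
apply: (ae_imp pq) => x hx; congr (_ * _); apply: eq_sum_nz => j j0.
by rewrite /mode_lambda_term hx.
Qed.

Lemma mode_lambda_integral :
  tail (fun y => (mode_lambda y)%:C) 0 + tail (fun y => (mode_lambda (- y))%:C) 0 =
  (Rintegral mu setT (Lambda_eff q lam))%:C.
Proof.
have mL : cmeasurable (fun y => (mode_lambda y)%:C).
  exact: ccont_cmeasurable_on measurableT (ccont_real continuous_mode_lambda).
have hL : {ae mu, forall y, cabs ((mode_lambda y)%:C) <= A * expR (- (beta * `|y|))}.
  by apply: ae_all => y; rewrite cabs_real mode_lambda_le.
have [iL <-] := cintegral_setT_halves be0 mL hL.
have mE : cmeasurable_on setT (fun y => (Lambda_eff q lam y)%:C).
  by split; [exact: measurable_Lambda_eff|exact: measurable_cst].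
have [|_ ->] := @cintegral_ae_eq R setT _ _ measurableT iL mE.
  by apply: (ae_imp ae_mode_lambda) => y ->.
by rewrite /cintegral /=; congr (_ +i* _); rewrite /Rintegral integral0.
Qed.

Lemma mode_family N : is_mode_family beta theta Btot p0 p1 p2 B lam (nz_ints N).
Proof.
have nz j : j \in nz_ints N -> j != 0 by rewrite mem_nz_ints => /andP[].
split => //; first exact: uniq_nz_ints.
split.
- by move=> j; exact: opp_nz_ints.
- by move=> j /nz; exact: V_away0 hV j.
- by move=> j /nz; exact: V_opp hV j.
- by move=> j l /nz j0 /nz l0; exact: V_separated hV j l j0 l0.
- by move=> j /nz j0 x; exact: p0_conj.
Qed.

Lemma mode_wronskian_estimate al K0 : 0 < al -> al < beta / 2 ->
  exists2 M, 0 <= M & forall eps k, 0 < eps -> eps <= 1 -> `|complex.Im k| <= al -> cabs k <= K0 ->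
  cabs (jost_wronskian (q_eps q lam eps) k + 2 * 'i * (k - (eps ^+ 2)%:C * kappa_star q lam))
    <= M * eps ^+ 3 /\
  cabs (jost_wronskian (sigma_eff q lam eps) k + 2 * 'i * (k - (eps ^+ 2)%:C * kappa_star q lam))
    <= M * eps ^+ 3.
Proof.
move=> al0 albe.
pose M1 := osc_wr_const al beta theta Btot A K0; pose M2 := small_wr_const al beta A K0.
exists (`|M1| + `|M2|) => [|eps k eps0 eps1 hk hkK]; first by rewrite addr_ge0.
have e30 : 0 <= eps ^+ 3 by rewrite exprn_ge0// ltW.
have zE : 2 * 'i * (k - (eps ^+ 2)%:C * kappa_star q lam) = 2 * 'i * k +
    (eps ^+ 2)%:C * (tail (fun y => (mode_lambda y)%:C) 0 +
      tail (fun y => (mode_lambda (- y))%:C) 0).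
  rewrite mode_lambda_integral /kappa_star -/mu mulrBr; congr (_ + _).
  have -> : 2 * 'i * ((eps ^+ 2)%:C * ('i / 2 * (Rintegral mu setT (Lambda_eff q lam))%:C)) =
    ('i * 'i) * ((eps ^+ 2)%:C * (Rintegral mu setT (Lambda_eff q lam))%:C) :> R[i] by field.
  by rewrite i_sqr mulN1r opprK.
have [N apx] := mode_potential_approx eps0.
split; rewrite zE addrA.
- apply: (@le_trans _ _ (M1 * eps ^+ 3)).
    apply: (@wronskian_oscillating _ al beta theta Btot A K0 eps (mode_potential eps) mode_lambda k
      al0 albe A0 theta0 eps0 eps1 continuous_mode_lambda mode_lambda_le hk hkK _ _ _ _ _ _ _
      (continuous_mode_potential (eps := eps)) (mode_potential_le eps) (mode_family N) apx).
      exact: measurable_q_eps.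
    exact: ae_mode_potential.
  by rewrite ler_wpM2r// (le_trans (ler_norm _))// lerDl.
- apply: (@le_trans _ _ (M2 * eps ^+ 3)).
    apply: (@wronskian_small _ al beta A K0 eps _ mode_lambda k
      al0 albe A0 eps0 eps1 continuous_mode_lambda mode_lambda_le hk hkK _ erefl).
      apply: measurableT_comp => //; apply: measurable_funM; first exact: measurable_cst.
      exact: measurable_Lambda_eff.
    by apply: (ae_imp ae_mode_lambda) => x; rewrite /sigma_eff => ->.
  by rewrite ler_wpM2r// (le_trans (ler_norm _))// lerDr.
Qed.

End MainEstimate.

Lemma wronskian_estimate (R : realType) (beta theta al K0 : R) q lam :
  hypotheses_V beta theta q lam -> 0 < al -> al < beta / 2 ->
  exists2 M, 0 <= M & forall eps k, 0 < eps -> eps <= 1 -> `|complex.Im k| <= al -> cabs k <= K0 ->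
  cabs (jost_wronskian (q_eps q lam eps) k + 2 * 'i * (k - (eps ^+ 2)%:C * kappa_star q lam))
    <= M * eps ^+ 3 /\
  cabs (jost_wronskian (sigma_eff q lam eps) k + 2 * 'i * (k - (eps ^+ 2)%:C * kappa_star q lam))
    <= M * eps ^+ 3.
Proof.
move=> hV al0 albe; have [p0 [p1 [p2 [B [Btot [hp hB pq pc mq]]]]]] := potential_modes hV.
exact: (mode_wronskian_estimate hV hp hB pq pc mq).
Qed.

(** * Conclusion *)

Section Algebra.
Context {R : realType}.
Implicit Types (k z W w v : R[i]) (M d eps : R).

Lemma compact_cabs_bound (K : set R[i]) : compact (K : set R[i]^o) ->
  exists K0, forall k, K k -> cabs k <= K0.
Proof.
move=> cK.
(* The radii of balls in [R[i]^o] are complex numbers, positive ones being real; continuity of the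
   real-valued modulus is therefore checked on balls. *)
have cc : continuous (cabs : R[i]^o -> R).
  move=> z A /nbhs_ballP[e /= e0 he]; apply/nbhs_ballP.
  exists (e%:C) => [|w]; first by rewrite /= ltcE /= eqxx.
  rewrite /ball /= => zw; apply: he; rewrite /ball /=; move: zw.
  rewrite ltcE => /andP[_]; apply: le_lt_trans.
  have tri (u v : R[i]) : cabs u - cabs v <= cabs (u - v).
    by rewrite lerBlDr; have := cabsD (u - v) v; rewrite subrK.
  have h := tri w z; rewrite (cabsBC w z) in h.
  by rewrite /= ler_norml tri andbT lerNl opprB.
have [M [_ hM]] := compact_bounded (continuous_compact (continuous_subspaceT cc) cK).
exists (M + 1) => k Kk; apply: (le_trans (ler_norm _)).
by apply: (hM (M + 1)); [rewrite ltrDl|exists k].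
Qed.

(* [-2 i z] is the leading part of the Wronskians *)
Lemma wronskian_lower z W (d : R) : cabs (W + 2 * 'i * z) <= d -> d <= cabs z -> cabs z <= cabs W.
Proof.
move=> hW dz; have -> : W = (W + 2 * 'i * z) - 2 * 'i * z by ring.
have h := cabsB (W + 2 * 'i * z - 2 * 'i * z) (W + 2 * 'i * z).
have E : W + 2 * 'i * z - 2 * 'i * z - (W + 2 * 'i * z) = - (2 * 'i * z) by ring.
move: h; rewrite E cabsN cabsM cabsM cabs_i (cabs_nat 2) mulr1.
by move: (cabs _) (cabs _) hW dz => a b; lra.
Qed.

Lemma cabs_div_le z w (a b : R) : 0 < b -> cabs z <= a -> b <= cabs w -> cabs (z / w) <= a / b.
Proof.
move=> b0 za bw; rewrite cabsM cabsV; apply: ler_pM; rewrite ?cabs_ge0 ?invr_ge0 ?cabs_ge0//.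
by rewrite lef_pV2 ?posrE// (lt_le_trans b0).
Qed.

Lemma cabs_neq0 w (b : R) : 0 < b -> b <= cabs w -> w != 0.
Proof. by move=> b0 bw; rewrite -cabs_gt0 (lt_le_trans b0). Qed.

Variables (z k Ws Wq : R[i]) (d : R).
Hypotheses (hs : cabs (Ws + 2 * 'i * z) <= d) (hq : cabs (Wq + 2 * 'i * z) <= d).
Hypotheses (z0 : 0 < cabs z) (dz : d <= cabs z).

Let sub_le : cabs (Wq - Ws) <= 2 * d.
Proof.
have -> : Wq - Ws = (Wq + 2 * 'i * z) - (Ws + 2 * 'i * z) by ring.
have -> : 2 * d = d + d by ring.
by apply: (le_trans (cabsB _ _)); exact: lerD.
Qed.

Let ls := wronskian_lower hs dz.
Let lq := wronskian_lower hq dz.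
Let s0 : Ws != 0 := cabs_neq0 z0 ls.
Let q0 : Wq != 0 := cabs_neq0 z0 lq.

Lemma wronskian_neq0 : Ws != 0 /\ Wq != 0. Proof. by []. Qed.

Lemma ratio_bound : cabs (Wq / Ws - 1) <= 2 * d / cabs z.
Proof.
have -> : Wq / Ws - 1 = (Wq - Ws) / Ws by field.
exact: cabs_div_le.
Qed.

Lemma transmission_sub_bound : cabs (- (2 * 'i * k) / Ws - - (2 * 'i * k) / Wq) <=
  4 * d * cabs k / cabs z ^+ 2.
Proof.
have -> : - (2 * 'i * k) / Ws - - (2 * 'i * k) / Wq = - ((2 * 'i * k) * (Wq - Ws)) / (Ws * Wq).
  by field; rewrite q0 s0.
apply: cabs_div_le; first exact: exprn_gt0.
  rewrite cabsN !cabsM cabs_i (cabs_nat 2) mulr1.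
  have -> : 4 * d * cabs k = 2 * cabs k * (2 * d) by ring.
  by rewrite ler_wpM2l// mulr_ge0 ?cabs_ge0.
by rewrite cabsM expr2; apply: ler_pM; rewrite ?cabs_ge0.
Qed.

Lemma transmission_limit_bound : cabs (- (2 * 'i * k) / Wq - k / z) <= d * cabs k / cabs z ^+ 2.
Proof.
have z1 : z != 0 by rewrite -cabs_gt0.
have -> : - (2 * 'i * k) / Wq - k / z = - (k * (Wq + 2 * 'i * z)) / (Wq * z).
  by field; rewrite q0 z1.
apply: cabs_div_le; first exact: exprn_gt0.
  by rewrite cabsN cabsM mulrC; apply: ler_wpM2r; rewrite ?cabs_ge0.
by rewrite cabsM expr2; apply: ler_pM; rewrite ?cabs_ge0.
Qed.

End Algebra.

Theorem corollary3p5 (R : realType) (beta theta alpha : R)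
    (q : int -> R -> R[i]) (lam : int -> R) (K : set R[i]) (C tau : R)
    (hV : hypotheses_V beta theta q lam) (hK : hypotheses_K beta alpha K)
    (hC : 0 < C) (htau : tau < 3) :
  exists2 eps0 : R, 0 < eps0 &
  [/\
    (* (a) *)
    exists M : R, forall (eps : R) (k : R[i]), 0 < eps < eps0 -> K k ->
      C * eps `^ tau <= cabs (k - (eps ^+ 2)%:C * kappa_star q lam) ->
      [/\ jost_wronskian (sigma_eff q lam eps) k != 0,
          jost_wronskian (q_eps q lam eps) k != 0 &
          cabs (transmission_ratio (sigma_eff q lam eps) (q_eps q lam eps) k - 1)
            <= M * eps `^ (3 - tau)],
    (* (b) *)
    exists M : R, forall (eps : R) (k : R[i]), 0 < eps < eps0 -> K k ->
      C * eps `^ tau <= cabs (k - (eps ^+ 2)%:C * kappa_star q lam) ->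
      C * cabs k <= cabs (k - (eps ^+ 2)%:C * kappa_star q lam) ->
      cabs (transmission (sigma_eff q lam eps) k
            - transmission (q_eps q lam eps) k) <= M * eps `^ (3 - tau) /\
      cabs (transmission (q_eps q lam eps) k
            - k / (k - (eps ^+ 2)%:C * kappa_star q lam))
        <= M * eps `^ (3 - tau) &
    (* (c) *)
    exists M : R, forall kappa : R[i], kappa != kappa_star q lam ->
      exists M' eps1 : R, 0 < eps1 /\
      forall eps : R, 0 < eps < eps1 ->
      let k := (eps ^+ 2)%:C * kappa in
      [/\ jost_wronskian (sigma_eff q lam eps) k != 0,
          jost_wronskian (q_eps q lam eps) k != 0,
          cabs (transmission (sigma_eff q lam eps) k
                - transmission (q_eps q lam eps) k)
            <= M * (eps * cabs kappa / cabs (kappa - kappa_star q lam) ^+ 2),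
          cabs (transmission (sigma_eff q lam eps) k
                - transmission (q_eps q lam eps) k) <= M' * eps &
          cabs (transmission (q_eps q lam eps) k
                - kappa / (kappa - kappa_star q lam)) <= M' * eps]].

Proof.
have [al0 al_lt cK sK] := hK.
have [K1 hK1] := compact_cabs_bound cK.
(* K1 bounds K. The 1 is for part (c), where the point eps^2 kappa need not lie in K but has modulus
   at most 1 for small eps. *)
pose K0 := Num.max K1 1.
have [M M0 hM] := wronskian_estimate K0 hV al0 al_lt.
have t0 : 0 < 3 - tau by rewrite subr_gt0.
have M1 : 0 < M + 1 by rewrite ltr_wpDl.
pose ks := kappa_star q lam.
(* Below this threshold the error M eps^3 is at most C eps^tau, the assumed distance to the pole;
   [M + 1] avoids a division by zero. *)
pose eps0 := Num.min 1 ((C / (M + 1)) `^ (3 - tau)^-1).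
have CM0 : 0 < C / (M + 1) by rewrite divr_gt0.
have e0 : 0 < eps0 by rewrite lt_min ltr01 powR_gt0.
have cube eps : 0 < eps -> eps ^+ 3 = eps `^ (3 - tau) * eps `^ tau.
  move=> eps_gt0; rewrite -powRD; last by rewrite (gt_eqF eps_gt0) implybT.
  by rewrite subrK powR_mulrn// ltW.
have small eps : 0 < eps < eps0 -> eps <= 1 /\ M * eps ^+ 3 <= C * eps `^ tau.
  move=> /andP[eps_gt0]; rewrite lt_min => /andP[/ltW eps1 /ltW h]; split => //.
  rewrite cube// mulrA ler_wpM2r ?powR_ge0//.
  have : eps `^ (3 - tau) <= C / (M + 1).
    have := ge0_ler_powR (ltW t0) _ _ h; rewrite !nnegrE => /(_ (ltW eps_gt0) (powR_ge0 _ _)).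
    by rewrite -powRrM mulVf ?gt_eqF// powRr1// ltW.
  rewrite ler_pdivlMr// => h'; apply: le_trans h'; rewrite mulrC ler_wpM2l ?powR_ge0//.
  by rewrite lerDl.
(* Stated without K, C and tau, so that it serves all three parts: the only conditions are that the
   error is below the leading part and that the latter is nonzero. *)
have core eps k : 0 < eps -> eps <= 1 -> `|complex.Im k| <= alpha -> cabs k <= K0 ->
    M * eps ^+ 3 <= cabs (k - (eps ^+ 2)%:C * ks) -> 0 < cabs (k - (eps ^+ 2)%:C * ks) ->
    [/\ jost_wronskian (sigma_eff q lam eps) k != 0,
        jost_wronskian (q_eps q lam eps) k != 0,
        cabs (transmission_ratio (sigma_eff q lam eps) (q_eps q lam eps) k - 1) <=
          2 * (M * eps ^+ 3) / cabs (k - (eps ^+ 2)%:C * ks),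
        cabs (transmission (sigma_eff q lam eps) k - transmission (q_eps q lam eps) k) <=
          4 * (M * eps ^+ 3) * cabs k / cabs (k - (eps ^+ 2)%:C * ks) ^+ 2 &
        cabs (transmission (q_eps q lam eps) k - k / (k - (eps ^+ 2)%:C * ks)) <=
          M * eps ^+ 3 * cabs k / cabs (k - (eps ^+ 2)%:C * ks) ^+ 2].
  move=> eps_gt0 eps1 hk hkK dz z0; have [hq hs] := hM _ _ eps_gt0 eps1 hk hkK.
  have [s0 q0] := wronskian_neq0 hs hq z0 dz.
  have ts U : jost_wronskian U k != 0 -> transmission U k = - (2 * 'i * k) / jost_wronskian U k.
    by move=> U0; rewrite /transmission U0.
  rewrite (ts _ s0) (ts _ q0) /transmission_ratio.
  split; [exact: s0|exact: q0|exact: ratio_bound hs hq z0 dz| |].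
    exact: transmission_sub_bound hs hq z0 dz.
  exact: transmission_limit_bound hq z0 dz.
have inK eps k : 0 < eps < eps0 -> K k -> C * eps `^ tau <= cabs (k - (eps ^+ 2)%:C * ks) ->
    [/\ eps <= 1, `|complex.Im k| <= alpha, cabs k <= K0,
      M * eps ^+ 3 <= cabs (k - (eps ^+ 2)%:C * ks) & 0 < cabs (k - (eps ^+ 2)%:C * ks)].
  move=> he Kk hz; have [eps1 h] := small _ he; have /andP[eps_gt0 _] := he; split => //.
  - exact: ltW (sK _ Kk).
  - by rewrite le_max hK1.
  - exact: le_trans hz.
  - by apply: lt_le_trans hz; rewrite mulr_gt0// powR_gt0.
have bound eps (z : R) : 0 < eps -> C * eps `^ tau <= z ->
    M * eps ^+ 3 / z <= M / C * eps `^ (3 - tau).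
  move=> eps_gt0 hz; have p0 : 0 < C * eps `^ tau by rewrite mulr_gt0// powR_gt0.
  rewrite ler_pdivrMr; last exact: lt_le_trans hz.
  rewrite cube//; apply: (@le_trans _ _ (M / C * eps `^ (3 - tau) * (C * eps `^ tau))).
    by apply: eq_ler; field; rewrite gt_eqF.
  by rewrite ler_wpM2l// mulr_ge0 ?powR_ge0// divr_ge0// ltW.
exists eps0 => //; split.
- exists (2 * (M / C)) => eps k he Kk hz; have /andP[eps_gt0 _] := he.
  have [eps1 hk hkK dz z0] := inK _ _ he Kk hz.
  have [s0 q0 h _ _] := core _ _ eps_gt0 eps1 hk hkK dz z0; split => //.
  apply: (le_trans h); rewrite -(mulrA 2 _ _^-1) -(mulrA 2 (M / C)).
  by rewrite ler_wpM2l// bound.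
- exists (4 * (M / C) / C) => eps k he Kk hz hz2; have /andP[eps_gt0 _] := he.
  have [eps1 hk hkK dz z0] := inK _ _ he Kk hz.
  have [_ _ _ h1 h2] := core _ _ eps_gt0 eps1 hk hkK dz z0.
  set z := cabs (k - _) in hz hz2 dz z0 h1 h2.
  (* The extra assumption of (b) controls one of the two factors 1/z; the other is controlled as in
     (a). This is where the second division by C comes from. *)
  have kz : cabs k / z <= C^-1 by rewrite ler_pdivrMr// mulrC ler_pdivlMr// mulrC.
  have b : M * eps ^+ 3 * cabs k / z ^+ 2 <= M / C * eps `^ (3 - tau) / C.
    have -> : M * eps ^+ 3 * cabs k / z ^+ 2 = M * eps ^+ 3 / z * (cabs k / z).
      by field; rewrite gt_eqF.
    apply: ler_pM => //; last exact: bound.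
      by rewrite divr_ge0 ?(ltW z0)// mulr_ge0// exprn_ge0// ltW.
    by rewrite divr_ge0 ?cabs_ge0// ltW.
  have p0 : 0 <= M / C * eps `^ (3 - tau) / C.
    by rewrite divr_ge0 ?(ltW hC)// mulr_ge0 ?powR_ge0// divr_ge0// ltW.
  split.
    apply: (le_trans h1).
    have -> : 4 * (M * eps ^+ 3) * cabs k / z ^+ 2 = 4 * (M * eps ^+ 3 * cabs k / z ^+ 2) by ring.
    have -> : 4 * (M / C) / C * eps `^ (3 - tau) = 4 * (M / C * eps `^ (3 - tau) / C) by ring.
    by rewrite ler_wpM2l.
  apply: (le_trans h2); apply: (le_trans b).
  have -> : 4 * (M / C) / C * eps `^ (3 - tau) = 4 * (M / C * eps `^ (3 - tau) / C) by ring.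
  by rewrite ler_peMl// ler1n.
- exists (4 * M) => kappa kn.
  set d := cabs (kappa - kappa_star q lam).
  have d0 : 0 < d by rewrite cabs_gt0 subr_eq0.
  have ck0 := cabs_ge0 kappa.
  exists (4 * M * (cabs kappa / d ^+ 2)).
  (* In this order the bounds give eps <= 1, an error below the leading part eps^2 d, |k| <= 1, and
     |Im k| <= alpha. *)
  exists (Num.min (Num.min 1 (d / (M + 1))) (Num.min (cabs kappa + 1)^-1 (alpha / (cabs kappa + 1)))).
  have ck1 : 0 < cabs kappa + 1 by rewrite ltr_wpDl.
  split; first by rewrite !lt_min ltr01 invr_gt0 ck1 !divr_gt0.
  move=> eps /andP[eps_gt0]; rewrite !lt_min => /andP[/andP[/ltW eps1 ed] /andP[ek ea]] k.
  have e20 : 0 <= eps ^+ 2 by rewrite exprn_ge0// ltW.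
  have e2e : eps ^+ 2 <= eps by rewrite expr2 ler_piMr// ltW.
  have ckE : cabs k = eps ^+ 2 * cabs kappa by rewrite cabsM cabs_real ger0_norm.
  have zE : k - (eps ^+ 2)%:C * ks = (eps ^+ 2)%:C * (kappa - kappa_star q lam).
    by rewrite mulrBr.
  have czE : cabs (k - (eps ^+ 2)%:C * ks) = eps ^+ 2 * d by rewrite zE cabsM cabs_real ger0_norm.
  have hk : `|complex.Im k| <= alpha.
    apply: (le_trans (cabs_Im _)); rewrite ckE.
    apply: (@le_trans _ _ (eps * (cabs kappa + 1))).
      by apply: ler_pM => //; rewrite lerDl.
    by rewrite -ler_pdivlMr// ltW.
  have hkK : cabs k <= K0.
    rewrite le_max; apply/orP; right; rewrite ckE.
    apply: (@le_trans _ _ (eps * (cabs kappa + 1))).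
      by apply: ler_pM => //; rewrite lerDl.
    by rewrite -ler_pdivlMr// mul1r ltW.
  have dz : M * eps ^+ 3 <= cabs (k - (eps ^+ 2)%:C * ks).
    rewrite czE exprS mulrCA mulrA [leRHS]mulrC ler_wpM2r//.
    move: ed; rewrite ltr_pdivlMr// => /ltW; apply: le_trans.
    by rewrite ler_wpM2l ?(ltW eps_gt0)// lerDl.
  have z0 : 0 < cabs (k - (eps ^+ 2)%:C * ks) by rewrite czE mulr_gt0// exprn_gt0.
  have [s0 q0 _ h1 h2] := core _ _ eps_gt0 eps1 hk hkK dz z0.
  have en0 : eps != 0 by rewrite gt_eqF.
  have dn0 : d != 0 by rewrite gt_eqF.
  have E : M * eps ^+ 3 * cabs k / cabs (k - (eps ^+ 2)%:C * ks) ^+ 2 =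
      M * (eps * cabs kappa / d ^+ 2).
    by rewrite ckE czE; field; rewrite en0 dn0.
  have E4 : 4 * (M * eps ^+ 3) * cabs k / cabs (k - (eps ^+ 2)%:C * ks) ^+ 2 =
      4 * M * (eps * cabs kappa / d ^+ 2).
    by rewrite -[RHS]mulrA -E; ring.
  rewrite E4 in h1; rewrite E in h2.
  have EM : 4 * M * (cabs kappa / d ^+ 2) * eps = 4 * M * (eps * cabs kappa / d ^+ 2) by ring.
  have kE : k / (k - (eps ^+ 2)%:C * ks) = kappa / (kappa - kappa_star q lam).
    have e2n : (eps ^+ 2)%:C != 0 :> R[i] by rewrite fmorph_eq0 expf_neq0.
    rewrite zE /k invfM mulrACA mulfV// mul1r.
    done.
  split => //; first by rewrite EM.
  rewrite -kE EM; apply: (le_trans h2); rewrite -[leRHS]mulrA ler_peMl ?ler1n//.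
  by rewrite mulr_ge0// divr_ge0 ?exprn_ge0 ?(ltW d0)// mulr_ge0// ltW.
Qed.
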